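(* Let $c,\omega,\delta$ be real constants with $c\neq0$ and $\omega\notin\frac{\pi}{2}\mathbb Z$, and let $\{q_n\}_{n=1}^{\infty}\in l^1$ be a real-valued sequence. Let $\mathcal J$ be the discrete Schrödinger operator on $l^2(\mathbb N)$ with the potential $$b_n=\frac{c\sin(2\omega n+\delta)}{n}+q_n,\qquad n\ge1,$$ and let $\rho'$ be its spectral density. Let $\nu_{cr}\in\{-2\cos\omega,\,2\cos\omega\}$. If $\nu_{cr}$ is neither an eigenvalue nor a half-bound state of $\mathcal J$, then both one-sided limits $$\lim_{\lambda\rightarrow\nu_{cr}+0}\frac{\rho'(\lambda)}{|\lambda-\nu_{cr}|^{\frac{|c|}{2|\sin\omega|}}}\quad\text{and}\quad\lim_{\lambda\rightarrow\nu_{cr}-0}\frac{\rho'(\lambda)}{|\lambda-\nu_{cr}|^{\frac{|c|}{2|\sin\omega|}}}$$ exist.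
   Context: The discrete Schrödinger operator $\mathcal J$ with real potential $\{b_n\}_{n=1}^\infty$ acts in $l^2=l^2(\mathbb N)$ by $(\mathcal Ju)_1=b_1u_1+u_2$ and $(\mathcal Ju)_n=u_{n-1}+b_nu_n+u_{n+1}$ for $n\ge2$, on its maximal domain; it is self-adjoint. The orthogonal polynomials $P_n(\lambda)$ associated with $\mathcal J$ are defined by $P_1(\lambda)=1$, $P_2(\lambda)=\lambda-b_1$ and $P_{n-1}(\lambda)+b_nP_n(\lambda)+P_{n+1}(\lambda)=\lambda P_n(\lambda)$ for $n\ge2$. The spectral measure $\rho$ of $\mathcal J$ is the probability measure on $\mathbb R$ for which $\{P_n\}_{n\ge1}$ is an orthonormal basis of $L_2(\mathbb R,\rho)$; $\mathcal J$ is unitarily equivalent to multiplication by the independent variable in this space. The spectral density $\rho'$ is the derivative of $\rho$. For the operators considered, the spectrum on $(-2,2)\setminus\{\pm2\cos\omega\}$ is purely absolutely continuous with continuous density, and $\rho'$ denotes this continuous density there. A solution $u=\{u_n\}$ of the recurrence $u_{n-1}+b_nu_n+u_{n+1}=\lambda u_n$, $n\ge2$, is called subordinate if it is nonzero and $\lim_{N\to\infty}\frac{\sum_{n=1}^N|u_n|^2}{\sum_{n=1}^N|w_n|^2}=0$ for every solution $w$ of the recurrence linearly independent of $u$. A half-bound state of $\mathcal J$ is a point $\lambda$ at which there is a subordinate solution of the eigenfunction equation of $\mathcal J$ (including the first-line equation $b_1u_1+u_2=\lambda u_1$, i.e. the sequence $\{P_n(\lambda)\}_{n\ge1}$ is subordinate)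 which does not belong to $l^2$. *)

(* Defs.v *)
From HB Require Import structures.
From mathcomp Require Import all_boot all_order all_algebra.
From mathcomp Require Import all_classical all_reals all_analysis.
From mathcomp.real_closed Require Import complex.
Import Order.TTheory GRing.Theory Num.Theory.
Import numFieldNormedType.Exports ComplexField.Normc.

Set Implicit Arguments.
Unset Strict Implicit.
Unset Printing Implicit Defensive.

Local Open Scope classical_set_scope.
Local Open Scope ring_scope.
Local Open Scope complex_scope.

(* Sequences indexed by {1, 2, 3, ...} are encoded as functions on [nat] with
   the index shifted by one: [u k] is the (k+1)-st term. *)

Section discrete_schroedinger.
Context {R : realType}.
Implicit Types (b : nat -> R) (u w : nat -> R[i]) (z : R[i]).

Definition summable_seq (q : nat -> R) := cvgn (series (fun n => `|q n|)).

Definition l2 u := summable_seq (fun n => normc (u n) ^+ 2).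

(* the difference expression; row 0 is the boundary line *)
Definition schroedinger b u (n : nat) : R[i] :=
  match n with
  | 0 => (b 0)%:C * u 0 + u 1
  | k.+1 => u k + (b k.+1)%:C * u k.+1 + u k.+2
  end.

Definition schroedinger_domain b u := l2 u /\ l2 (schroedinger b u).

Definition eigen_equation b z u := forall n, schroedinger b u n = z * u n.

Definition schroedinger_eigenvalue b z :=
  exists u, [/\ schroedinger_domain b u, exists n, u n != 0 &
                eigen_equation b z u].

(* the three-term recurrence without the boundary line *)
Definition recurrence_solution b z u :=
  forall n, schroedinger b u n.+1 = z * u n.+1.

Definition linearly_independent u w :=
  forall s t : R[i], (forall n, s * u n + t * w n = 0) -> s = 0 /\ t = 0.

Definition subordinate b z u :=
  [/\ recurrence_solution b z u, exists n, u n != 0 &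
    forall w, recurrence_solution b z w -> linearly_independent u w ->
      (\sum_(0 <= n < N) normc (u n) ^+ 2) /
      (\sum_(0 <= n < N) normc (w n) ^+ 2) @[N --> \oo] --> (0 : R)].

Definition half_bound_state b z :=
  exists u, [/\ subordinate b z u, eigen_equation b z u & ~ l2 u].

(* [orthpoly b n] is the polynomial P_(n+1) *)
Fixpoint orthpoly b (n : nat) : {poly R} :=
  match n with
  | 0 => 1
  | k.+1 => match k with
            | 0 => 'X - (b 0)%:P
            | l.+1 => ('X - (b k)%:P) * orthpoly b k - orthpoly b l
            end
  end.

Definition orthonormal_system (rho : probability (measurableTypeR R) R)
    (e : nat -> R -> R) :=
  (forall n, e n \in Lfun rho 2%:E) /\
  (forall m n, (\int[rho]_x (e m x * e n x)%:E = (m == n)%:R%:E)%E).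

Definition total_system (rho : probability (measurableTypeR R) R)
    (e : nat -> R -> R) :=
  forall f : R -> R, f \in Lfun rho 2%:E -> forall eps : R, 0 < eps ->
    exists (N : nat) (a : nat -> R),
      ('N[rho]_2%:E[EFin \o (fun x => f x - \sum_(0 <= n < N) a n * e n x)%R]
        < eps%:E)%E.

Definition spectral_measure b (rho : probability (measurableTypeR R) R) :=
  let P n x := (orthpoly b n).[x] in
  orthonormal_system rho P /\ total_system rho P.

(* Derivative of the distribution function. On any open set where rho has a
   continuous density, this is that density, at every point. *)
Definition spectral_density (rho : probability (measurableTypeR R) R) : R -> R :=
  (fun x : R => fine (rho [set t : R | t <= x]))^`()%classic.

Definition oscillating_potential (c omega delta : R) (q : nat -> R) (k : nat)
    : R :=
  c * sin (2 * omega * k.+1%:R + delta) / k.+1%:R + q k.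

End discrete_schroedinger.

(* Main.v *)
(** Let z0 be the unit complex number with 2 Re z0 = nu, and write E_N(x) =
    P_{N+1}(x)^2 - x P_{N+1}(x) P_N(x) + P_N(x)^2 for the "energy" of the
    orthogonal polynomials.

    Since b_n -> 0, the measures E_N d rho converge weakly to the semicircle law:
    on Chebyshev polynomials of the second kind this follows from orthonormality
    and the recurrence, and rho has compact support.  Hence wherever E_N
    converges locally uniformly to a limit A(x)^2 > 0, the density is
    rho'(x) = sqrt (4 - x^2) / (2 pi A(x)^2).

    It remains to show that A(nu + mu) |mu|^beta has a positive limit as
    mu -> 0+ and as mu -> 0-, with beta = |c| / (4 |sin omega|).  In the frame
    F_n = (y_{n+1} - conj(z) y_n) conj(z)^{n+1} the recurrence is a perturbation
    of F_{n+1} = F_n whose oscillating terms are removed by a Harris-Lutz step.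
    Away from nu nothing resonates, and sqrt E_N stabilises once N |mu| is
    large.  At nu the non-oscillating part of the potential leaves
    G_{n+1} = G_n + (beta / n) conj G_n - i mu' G_n up to summable errors, with
    mu' proportional to mu; this is matched with the growth n^beta times a
    Bessel-type function of n mu, which never vanishes.  The multiplicative
    constant K of this growth vanishes only if P_n(nu) is subordinate, that is,
    if nu is an eigenvalue or a half-bound state. *)
Require Import Defs.
From HB Require Import structures.
From mathcomp Require Import all_boot all_order all_algebra.
From mathcomp Require Import all_classical all_reals all_analysis.
From mathcomp.real_closed Require Import complex.
From mathcomp Require Import ring lra zify.
Import Order.TTheory GRing.Theory Num.Theory.
Import numFieldNormedType.Exports ComplexField.Normc.

Set Implicit Arguments.
Unset Strict Implicit.
Unset Printing Implicit Defensive.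

Local Open Scope classical_set_scope.
Local Open Scope ring_scope.
Local Open Scope complex_scope.

Local Notation Re := complex.Re.
Local Notation Im := complex.Im.

(** * Perturbed recursions and the frame of a solution *)

(** The difficulty is uniformity as mu -> 0. At nu + mu one frequency is at distance of order |mu|
    from resonance, so summation by parts costs 1 / (n |mu|) and is useful only for n |mu| >= T; the
    comparison with the Bessel-type model is useful only for n |mu| <= T, where errors mu^2 per step
    add up to T |mu|. Two frames are used accordingly: one at the unit z with 2 Re z = nu + mu,
    whose modulus is sqrt E_n, and one fixed at z0, where mu acts as a perturbation of the potential
    and the modulus is sqrt E_n up to a factor 1 + O(mu). At n |mu| close to T, A(nu + mu) |mu|^beta
    is known, for small mu, up to a relative error of order 1 / T; then T is taken large. The value
    of beta is |c| times 1 / (2 |sin omega|) from variation of constants times 1 / 2 from writing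
    the sine through exponentials. Its sign is absorbed in the phase kappa. The density contains A
    squared, which doubles the exponent. *)

Section complex_modulus.
Context {R : realType}.
Implicit Types z w : R[i].

Lemma normc_ge0 z : 0 <= normc z.
Proof. by case: z => a b; exact: sqrtr_ge0. Qed.

Lemma conjcM z w : conjc (z * w) = conjc z * conjc w. Proof. exact: rmorphM. Qed.
Lemma conjcB z w : conjc (z - w) = conjc z - conjc w. Proof. exact: rmorphB. Qed.
Lemma conjcX z n : conjc (z ^+ n) = conjc z ^+ n. Proof. exact: rmorphXn. Qed.

Lemma realcM (x y : R) : (x * y)%:C = x%:C * y%:C :> R[i]. Proof. exact: rmorphM. Qed.
Lemma realcD (x y : R) : (x + y)%:C = x%:C + y%:C :> R[i]. Proof. exact: rmorphD. Qed.
Lemma realcB (x y : R) : (x - y)%:C = x%:C - y%:C :> R[i]. Proof. exact: rmorphB. Qed.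
Lemma realcV (x : R) : (x^-1)%:C = x%:C^-1 :> R[i]. Proof. exact: fmorphV. Qed.
Lemma realc_eq0 (x : R) : (x%:C == 0 :> R[i]) = (x == 0).
Proof. exact: (inj_eq (@complexI R) x 0). Qed.

Lemma normc_conj z : normc (conjc z) = normc z.
Proof. by case: z => a b; rewrite /normc /= sqrrN. Qed.

Lemma sqr_normcE z : normc z ^+ 2 = Re z ^+ 2 + Im z ^+ 2.
Proof. by case: z => a b; rewrite /normc sqr_sqrtr// addr_ge0 ?sqr_ge0. Qed.

Lemma normc_real (x : R) : normc x%:C = `|x|.
Proof. by rewrite /normc /= expr0n addr0 sqrtr_sqr. Qed.

Lemma normc_i : normc ('i%C : R[i]) = 1.
Proof. by rewrite /normc /= expr0n add0r expr1n sqrtr1. Qed.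

Lemma normcX z n : normc (z ^+ n) = normc z ^+ n.
Proof. by elim: n => [|n IH]; rewrite ?normc1 // !exprS normcM IH. Qed.

Lemma normcB z w : normc (z - w) = normc (w - z).
Proof. by rewrite -normcN opprB. Qed.

Lemma le_normcB z w : normc (z - w) <= normc z + normc w.
Proof. by rewrite -[normc w]normcN le_normcD. Qed.

Lemma normc_lipschitz z w : normc z <= normc w + normc (z - w).
Proof. by have := le_normcD w (z - w); rewrite addrC subrK. Qed.

Lemma normc_dist z w : `|normc z - normc w| <= normc (z - w).
Proof.
have h1 := normc_lipschitz z w; have h2 := normc_lipschitz w z; rewrite (normcB w) in h2.
by rewrite ler_norml; apply/andP; split; lra.
Qed.

Lemma normcRe z : `|Re z| <= normc z.
Proof.
by rewrite -ler_sqr ?nnegrE ?normc_ge0 // sqr_normcE real_normK ?num_real// lerDl sqr_ge0.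
Qed.

Lemma normcIm z : `|Im z| <= normc z.
Proof.
by rewrite -ler_sqr ?nnegrE ?normc_ge0 // sqr_normcE real_normK ?num_real// lerDr sqr_ge0.
Qed.

Lemma normc_le_ReIm z : normc z <= `|Re z| + `|Im z|.
Proof.
rewrite -ler_sqr ?nnegrE ?normc_ge0 ?addr_ge0// sqr_normcE sqrrD.
rewrite !real_normK ?num_real// lerD2r lerDl mulrn_wge0// mulr_ge0//.
Qed.

End complex_modulus.

(** * Averaging step and discrete Gronwall inequalities *)

Section averaging.
Context {R : realType}.

(* One step of the Harris-Lutz transformation F -> F - A F - B (conjc F) : oscillating
   coefficients that are differences A' - A and B' - B are removed at the price
   of terms of second order. *)
Lemma averaging_step (F F' A B A' B' a b E : R[i]) (e ka sg sg' r : R) :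
  F' - F = (a * F + b * conjc F) + (A' - A) * F + (B' - B) * conjc F + E ->
  normc E <= e * normc F -> normc (F' - F) <= ka * normc F ->
  normc A + normc B <= sg -> sg <= 1 / 2 -> normc A' + normc B' <= sg' ->
  normc a + normc b <= r -> 0 <= e -> 0 <= ka ->
  let G := F - A * F - B * conjc F in
  let G' := F' - A' * F' - B' * conjc F' in
  normc (F - G) <= sg * normc F /\ normc F <= 2 * normc G /\
  normc (G' - G - (a * G + b * conjc G)) <= 2 * (e + sg' * ka + r * sg) * normc G.
Proof.
move=> dF lE ldF lAB sg2 lAB' lab e0 ka0 G G'.
have lFG : normc (F - G) <= sg * normc F.
  have -> : F - G = A * F + B * conjc F by rewrite /G; ring.
  apply: (le_trans (le_normcD _ _)).
  by rewrite !normcM normc_conj -mulrDl ler_wpM2r ?normc_ge0.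
have lF : normc F <= 2 * normc G.
  have := normc_lipschitz F G; have := normc_ge0 F; nra.
split=> //; split=> //.
(* The increments [A' - A] and [B' - B] cancel exactly against those in [dF]; what remains is [E]
   and products of a coefficient with [F - G] or [F' - F], both already small relative to [F]. *)
have -> : G' - G - (a * G + b * conjc G) =
   a * (F - G) + b * (conjc (F - G)) + E - A' * (F' - F) - B' * (conjc (F' - F)).
  have eF' : F' = F + (F' - F) by ring.
  move: dF; rewrite /G' /G; move: (F' - F) eF' => D -> ->.
  by rewrite !rmorphB !rmorphD !rmorphM /=; ring.
have h1 := le_normcB (a * (F - G) + b * (conjc (F - G)) + E - A' * (F' - F)) (B' * (conjc (F' - F))).
have h2 := le_normcB (a * (F - G) + b * (conjc (F - G)) + E) (A' * (F' - F)).
have h3 := le_normcD (a * (F - G) + b * (conjc (F - G))) E.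
have h4 := le_normcD (a * (F - G)) (b * (conjc (F - G))).
rewrite !normcM !normc_conj in h1 h2 h3 h4.
have pA := normc_ge0 A; have pB := normc_ge0 B; have pA' := normc_ge0 A'.
have pB' := normc_ge0 B'; have pa := normc_ge0 a; have pb := normc_ge0 b.
have k1 : (normc a + normc b) * normc (F - G) <= r * (sg * normc F).
  by rewrite ler_pM // ?normc_ge0 // addr_ge0.
have k2 : (normc A' + normc B') * normc (F' - F) <= sg' * (ka * normc F).
  by rewrite ler_pM // ?normc_ge0 // addr_ge0.
have k3 : (e + sg' * ka + r * sg) * normc F <= (e + sg' * ka + r * sg) * (2 * normc G).
  have ? : 0 <= sg' by lra.
  have ? : 0 <= r by lra.
  have ? : 0 <= sg by lra.
  by rewrite ler_wpM2l // !addr_ge0 ?mulr_ge0.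
lra.
Qed.

End averaging.

Section gronwall.
Context {R : realType}.

(** The bound is linear in [s], so a small total error means almost no change. The induction carries
    the partial sum of [e] itself: being at most 1/2, it gives [normc (g n) <= 2 * normc (g N)],
    which closes the step. *)
Lemma gronwall_near_constant (g : nat -> R[i]) (e : nat -> R) (N : nat) (s : R) :
  (forall n, 0 <= e n) ->
  (forall n, (N <= n)%N -> normc (g n.+1 - g n) <= e n * normc (g n)) ->
  (forall n, \sum_(N <= j < n) e j <= s) -> s <= 1 / 2 ->
  forall n, (N <= n)%N -> normc (g n - g N) <= 2 * s * normc (g N).
Proof.
move=> e0 ge es s2.
suff H n : normc (g (N + n)%N - g N) <= 2 * (\sum_(N <= j < N + n) e j) * normc (g N).
  move=> n Nn; rewrite -(subnKC Nn); apply: (le_trans (H _)).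
  by rewrite ler_wpM2r ?normc_ge0// ler_pM2l.
elim: n => [|n IH].
  by rewrite addn0 subrr normc0 big_geq // mulr0 mul0r.
rewrite addnS big_nat_recr ?leq_addr //=.
have h1 := le_normcD (g (N + n).+1 - g (N + n)%N) (g (N + n)%N - g N).
rewrite addrA subrK in h1; apply: (le_trans h1).
have h2 := ge (N + n)%N (leq_addr _ _).
have h3 := es (N + n)%N.
have h4 := normc_lipschitz (g (N + n)%N) (g N).
have h5 := normc_ge0 (g N); have h6 := e0 (N + n)%N.
have h7 : (\sum_(N <= j < N + n) e j) * normc (g N) <= 1 / 2 * normc (g N).
  by rewrite ler_wpM2r //; lra.
have h8 : e (N + n)%N * normc (g (N + n)%N) <= e (N + n)%N * (2 * normc (g N)).
  by rewrite ler_wpM2l //; lra.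
lra.
Qed.

(** Shifting by [C] absorbs the forcing: the hypothesis becomes
    [d n.+1 + C <= (1 + e n) * (d n + C)], and [1 + e n <= expR (e n)]. *)
Lemma gronwall_affine (d e : nat -> R) (N M : nat) (C : R) :
  (forall n, 0 <= e n) -> (forall n, 0 <= d n) -> 0 <= C ->
  (forall n, (N <= n < M)%N -> d n.+1 <= (1 + e n) * d n + C * e n) ->
  forall n, (N <= n <= M)%N ->
  d n + C <= (d N + C) * expR (\sum_(N <= j < n) e j).
Proof.
move=> e0 d0 C0 H n /andP[Nn nM].
suff K k : (N + k <= M)%N ->
    d (N + k)%N + C <= (d N + C) * expR (\sum_(N <= j < N + k) e j).
  by rewrite -(subnKC Nn); apply: K; rewrite subnKC.
elim: k => [|k IH] kM.
  by rewrite addn0 big_geq // expR0 mulr1.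
rewrite addnS big_nat_recr ?leq_addr //= expRD mulrA.
have h1 : d (N + k).+1 <= (1 + e (N + k)%N) * d (N + k)%N + C * e (N + k)%N.
  by apply: H; rewrite leq_addr -addnS.
have h2 := IH (leq_trans (leq_add (leqnn N) (leqnSn k)) kM).
have h3 := expR_ge1Dx (e (N + k)%N).
apply: (@le_trans _ _ ((d (N + k)%N + C) * (1 + e (N + k)%N))); first by lra.
by apply: ler_pM => //; rewrite ?addr_ge0.
Qed.

End gronwall.

(** * Summation by parts for unimodular frequencies *)

Section oscillation.
Context {R : realType}.
Implicit Types (xi z : R[i]).

Lemma normc_unit xi : xi * conjc xi = 1 -> normc xi = 1.
Proof.
move=> h; apply/eqP; rewrite -sqrp_eq1 ?normc_ge0// expr2.
by rewrite -{2}(normc_conj xi) -normcM h normc1.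
Qed.

Lemma unit_conj xi : xi * conjc xi = 1 -> (conjc xi) * (conjc (conjc xi)) = 1.
Proof. by move=> h; rewrite conjcK mulrC. Qed.

Lemma unitX xi n : xi * conjc xi = 1 -> xi ^+ n * (conjc (xi ^+ n)) = 1.
Proof. by move=> h; rewrite rmorphXn -exprMn h expr1n. Qed.

Lemma unitM xi z : xi * conjc xi = 1 -> z * conjc z = 1 -> (xi * z) * (conjc (xi * z)) = 1.
Proof. by move=> h k; rewrite rmorphM /= mulrACA h k mulr1. Qed.

(* the increments of [osc xi] are [xi ^+ k / k] up to a summable error *)
Definition osc xi k := xi ^+ k / ((1 - (conjc xi)) * (k%:R : R)%:C).

Definition osc_err xi n :=
  xi ^+ n.+1 / ((1 - (conjc xi)) * ((n.+1%:R : R)%:C * (n.+2%:R : R)%:C)).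

Lemma natc_neq0 n : (n.+1%:R : R)%:C != 0.
Proof. by rewrite realc_eq0 pnatr_eq0. Qed.

(** Since [conjc xi] inverts [xi], the sequence [xi ^+ k / (1 - conjc xi)] has increments
    [xi ^+ k.+1]; dividing it by [k] adds an error of order [1 / k^2]. Both [osc] and [osc_err]
    carry the factor [1 / (1 - conjc xi)], the price of a frequency close to 1. *)
Lemma osc_step xi n : xi * conjc xi = 1 -> (conjc xi) != 1 ->
  osc xi n.+2 - osc xi n.+1 =
  xi ^+ n.+2 * (n.+2%:R^-1 : R)%:C - osc_err xi n.
Proof.
move=> h x1; rewrite /osc /osc_err.
have n1 := natc_neq0 n; have n2 := natc_neq0 n.+1.
have d : 1 - (conjc xi) != 0 by rewrite subr_eq0 eq_sym.
have e : (n.+2%:R : R)%:C = (n.+1%:R)%:C + 1 by rewrite -[in LHS]addn1 natrD rmorphD.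
have hx : xi ^+ n.+1 = xi ^+ n.+2 * conjc xi
  by rewrite [xi ^+ n.+2]exprSr -mulrA h mulr1.
have -> : (n.+2%:R^-1 : R)%:C = (n.+2%:R : R)%:C^-1 by exact: realcV.
rewrite e in n2 *.
move: n1 n2 d; rewrite hx; move: (_%:C) (xi ^+ n.+2) (conjc xi) => a W c n1 n2 d.
by field; rewrite n1 n2 d.
Qed.

Lemma normc_natc n : normc ((n%:R : R)%:C) = n%:R.
Proof. by rewrite normc_real normr_nat. Qed.

Lemma osc_bound xi n d : xi * conjc xi = 1 -> 0 < d -> d <= normc (1 - (conjc xi)) ->
  normc (osc xi n.+1) <= (d * n.+1%:R)^-1.
Proof.
move=> h d0 dx; rewrite /osc normcM normcX normc_unit // expr1n mul1r.
rewrite normcV normcM normc_natc lef_pV2 ?posrE ?mulr_gt0 ?ltr0Sn// ?ler_pM2r ?ltr0Sn//.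
exact: lt_le_trans dx.
Qed.

Lemma osc_err_bound xi n d : xi * conjc xi = 1 -> 0 < d -> d <= normc (1 - (conjc xi)) ->
  normc (osc_err xi n) <= (d * (n.+1%:R * n.+2%:R))^-1.
Proof.
move=> h d0 dx; rewrite /osc_err normcM normcX normc_unit // expr1n mul1r.
have n12 : 0 < n.+1%:R * n.+2%:R :> R by rewrite mulr_gt0 ?ltr0Sn.
rewrite normcV !normcM !normc_natc lef_pV2 ?posrE ?mulr_gt0 ?ltr0Sn// ?ler_pM2r//.
exact: lt_le_trans dx.
Qed.

End oscillation.

(** * The frame of a real solution *)

Section frame.
Context {R : realType}.
Implicit Types (ze : R[i]) (y b : nat -> R) (la : R).

Definition solves y b la := forall n, y n.+2 = (la - b n.+1) * y n.+1 - y n.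

Definition frame ze y n := ((y n.+1)%:C - (conjc ze) * (y n)%:C) * conjc ze ^+ n.+1.

(** Variation of constants: the free equation at energy [2 * Re ze] leaves the frame constant. The
    difference between [la] and [2 * Re ze] is counted as part of the potential, which allows a
    frame fixed at [z0] for all energies near the critical one. *)
Lemma frame_step ze y b la n : ze * conjc ze = 1 -> Im ze != 0 -> solves y b la ->
  frame ze y n.+1 - frame ze y n =
  'i%C * ((b n.+1 - (la - 2 * Re ze)) / (2 * Im ze))%:C *
    (frame ze y n - (conjc (frame ze y n)) * conjc ze ^+ n.+2 ^+ 2).
Proof.
move=> h s0 yb; rewrite /frame yb realcB realcM !conjcM !conjcB !conjcM !conjcX !conjcK !conjc_real.
set v := b n.+1 - _.
have -> : (la - b n.+1)%:C * (y n.+1)%:C = (ze + conjc ze - v%:C) * (y n.+1)%:C.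
  congr (_ * _); rewrite addcJ -[2%:R](rmorph_nat (real_complex R)) -realcM -realcB.
  by congr (_%:C); rewrite /v /=; ring.
have dz : ze - (conjc ze) = 'i%C * (2 * Im ze)%:C.
  by case: (ze) => x t; simpc; congr (_ +i* _); rewrite /=; ring.
have i2 : ('i%C * 'i%C = -1 :> R[i]) by rewrite -expr2 sqr_i.
have s2 : (2 * Im ze)%:C != 0 :> R[i].
  by rewrite realc_eq0 mulf_neq0 ?pnatr_eq0.
rewrite realcM realcV.
move: (2 * Im ze)%:C s2 dz => s s2 dz.
have hn : ze ^+ n.+1 * conjc ze ^+ n.+1 = 1 by rewrite -exprMn h expr1n.
rewrite (exprS (conjc ze) n.+1).
move: (ze ^+ n.+1) ((conjc ze) ^+ n.+1) hn => Z W hn.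
move: (y n.+1)%:C (y n)%:C v%:C => p q w.
transitivity (- w * p * ((conjc ze) * W)).
  transitivity (- w * p * (conjc ze * W) + (ze * conjc ze - 1) * p * W); first by ring.
  by rewrite h subrr !mul0r addr0.
have -> : 'i%C * (w / s) * ((p - (conjc ze) * q) * W - (p - ze * q) * Z * ((conjc ze) * W) ^+ 2)
   = 'i%C * (w / s) * W * ((p - (conjc ze) * q) - (p - ze * q) * (Z * W) * conjc ze ^+ 2) by ring.
rewrite hn mulr1.
have -> : p - (conjc ze) * q - (p - ze * q) * conjc ze ^+ 2 = (conjc ze) * p * (ze - (conjc ze)).
  have -> : (conjc ze) * p * (ze - (conjc ze)) = (ze * conjc ze) * p - (conjc ze) ^+ 2 * p by ring.
  have -> : p - (conjc ze) * q - (p - ze * q) * conjc ze ^+ 2 =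
    p - (conjc ze) ^+ 2 * p + conjc ze * q * (ze * conjc ze - 1) by ring.
  by rewrite h; ring.
rewrite dz.
transitivity (('i%C * 'i%C) * w * p * (conjc ze * W)); first by rewrite i2; ring.
by field.
Qed.

Lemma frame_energy ze y n : ze * conjc ze = 1 ->
  normc (frame ze y n) ^+ 2 = y n.+1 ^+ 2 - 2 * Re ze * y n.+1 * y n + y n ^+ 2.
Proof.
move=> h; rewrite /frame normcM normcX normc_conj (normc_unit h) expr1n mulr1 sqr_normcE.
have : Re ze ^+ 2 + Im ze ^+ 2 = 1 by rewrite -sqr_normcE (normc_unit h) expr1n.
by case: (ze) => a b /= ab; have -> : y n ^+ 2 = (a ^+ 2 + b ^+ 2) * y n ^+ 2;
  [rewrite ab mul1r | ring].
Qed.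

End frame.

(** * The resonant potential and the frame away from resonance *)

Section resonant_potential.
Context {R : realType}.
Variables (z0 kappa : R[i]) (beta : R) (q Q : nat -> R).
Hypothesis z0_unit : z0 * conjc z0 = 1.
Hypothesis kappa_unit : kappa * conjc kappa = 1.
Hypothesis z0_im : Im z0 != 0.
Hypothesis beta_gt0 : 0 < beta.
Hypothesis qQ : forall N n, \sum_(N <= j < n) `|q j.+1| <= Q N.

(** For [z0 = exp(i w)] and [kappa = exp(i phi)] the imaginary part is [sin(2 w n + 2 phi)] with
    [n = k + 1]. The prefactor is normalised so that the resonant coefficient of the averaged
    recursion is [kappa ^+ 2 * beta / n] with [beta > 0]. *)
Definition resonant_potential k :=
  - (4 * Im z0 * beta) * Im ((kappa * z0 ^+ k.+1) ^+ 2) / k.+1%:R + q k.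

Local Notation b := resonant_potential.

Lemma normc_unitX2 (u : R[i]) k : u * conjc u = 1 -> normc ((u ^+ k) ^+ 2) = 1.
Proof. by move=> h; rewrite !normcX normc_unit // !expr1n. Qed.

Lemma normc_twist (f u : R[i]) : normc u = 1 -> normc (f - conjc f * u) <= 2 * normc f.
Proof.
move=> u1; apply: (le_trans (le_normcB _ _)).
by rewrite normcM normc_conj u1 mulr1 mulr2n mulrDl !mul1r.
Qed.

Lemma resonant_potential_bound k :
  `|b k| <= 4 * `|Im z0| * beta / k.+1%:R + `|q k|.
Proof.
rewrite /b; apply: (le_trans (ler_normD _ _)); rewrite lerD2r.
rewrite normrM normfV normr_nat ler_pM2r ?invr_gt0 ?ltr0Sn//.
rewrite normrM normrN normrM normrM (gtr0_norm beta_gt0) normr_nat.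
rewrite -[leRHS]mulr1 ler_wpM2l ?mulr_ge0 ?(ltW beta_gt0)//.
apply: (le_trans (normcIm _)).
by rewrite normcX normcM normcX !normc_unit// expr1n mul1r expr1n.
Qed.

Lemma resonant_potential_split k (s : R) : s != 0 ->
  'i%C * (b k / (2 * s))%:C =
  - (Im z0 * beta / s)%:C * (kappa ^+ 2 * (z0 ^+ 2) ^+ k.+1
      - conjc kappa ^+ 2 * (conjc z0 ^+ 2) ^+ k.+1) * (k.+1%:R^-1 : R)%:C
  + 'i%C * (q k / (2 * s))%:C.
Proof.
move=> s0; rewrite /b mulrDl realcD mulrDr; congr (_ + _).
rewrite -!exprM !(mulnC 2) !exprM -!exprMn -!conjcX -!conjcM -!conjcX.
move: (_ ^+ 2) => Y.
have e : (Im Y)%:C * (2 * 'i%C) = Y - conjc Y.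
  by case: Y => x y; simpc; congr (_ +i* _); rewrite /=; ring.
have i2 : ('i%C * 'i%C = -1 :> R[i]) by rewrite -expr2 sqr_i.
rewrite -e. rewrite !(@realcM R) !(@realcV R) (@realcM R).
have -> : (- (4 * Im z0 * beta))%:C = - (4 * (Im z0)%:C * beta%:C) :> R[i].
  by rewrite -(rmorph_nat (real_complex R) 4) /= -!realcM; exact: rmorphN.
rewrite [(2%:C)](rmorph_nat (real_complex R) 2).
have := natc_neq0 k (R := R); have : s%:C != 0 :> R[i] by rewrite realc_eq0.
move: (_.+1%:R)%:C s%:C => n t tn nn.
by field; rewrite tn nn.
Qed.

Lemma telescope_inv N n : (N <= n)%N ->
  \sum_(N <= j < n) (j.+1%:R * j.+2%:R : R)^-1 = N.+1%:R^-1 - n.+1%:R^-1.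
Proof.
move=> Nn; rewrite (@telescope_sumr_eq _ N n (fun j => - (j.+1%:R : R)^-1)) //.
  by rewrite opprK addrC.
move=> k _; have k1 : (k.+1%:R : R) != 0 by rewrite pnatr_eq0.
have k2 : (k.+1%:R + 1 : R) != 0 by rewrite -(natrD _ _ 1) addn1 pnatr_eq0.
have -> : (k.+2%:R : R) = k.+1%:R + 1 by rewrite -(natrD _ _ 1) addn1.
move: (k.+1%:R) k1 k2 => x k1 k2; field; rewrite k1 k2 //.
Qed.

Lemma sum_inv_le N n : \sum_(N <= j < n) (j.+1%:R * j.+2%:R : R)^-1 <= N.+1%:R^-1.
Proof.
have [Nn|nN] := leqP N n; first by rewrite telescope_inv // gerBl invr_ge0.
by rewrite big_geq ?(ltnW nN)// invr_ge0.
Qed.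

Definition amplitude (sm : R) := 4 * `|Im z0| * beta / sm.
(** Cost of the averaging, with [c1 = amplitude sm]: [2 * c1] from the errors of summation by parts,
    [2 * c1 ^+ 2] from products of two coefficients of order [1 / n], and [3 / sm] from [q], which
    enters [averaging_step] through [e] and again, halved, through [sg' * ka]. *)
Definition tail_const (sm : R) := 2 * amplitude sm + 2 * amplitude sm ^+ 2 + 3 / sm.

Section tail.
Variables (ze : R[i]) (la sm d : R) (y : nat -> R).
Hypotheses (ze_unit : ze * conjc ze = 1) (sm_gt0 : 0 < sm).
Hypotheses (ze_im : sm <= `|Im ze|) (d_gt0 : 0 < d).
Hypothesis dist : forall u, u \in [:: z0 ^+ 2; conjc z0 ^+ 2;
    z0 ^+ 2 * conjc ze ^+ 2; conjc z0 ^+ 2 * conjc ze ^+ 2] ->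
  d <= normc (1 - conjc u).
Hypothesis ze_re : la = 2 * Re ze.
Hypothesis ysol : solves y b la.

Local Notation c1 := (amplitude sm).
Local Notation C1 := (tail_const sm).
Let F := frame ze y.
Let g := (Im z0 * beta / Im ze)%:C : R[i].
(** The factor [conjc ze ^+ 2] per step that accompanies [conjc F] shifts the frequencies [z0 ^+ 2]
    and [conjc z0 ^+ 2] of the potential, so [A] and [B] involve four frequencies in all. For [ze]
    near [z0] the one in danger of resonance is [z0 ^+ 2 * conjc ze ^+ 2]. *)
Let A n := - g * (kappa ^+ 2 * osc (z0 ^+ 2) n.+1
  - conjc kappa ^+ 2 * osc (conjc z0 ^+ 2) n.+1).
Let B n := g * (kappa ^+ 2 * osc (z0 ^+ 2 * conjc ze ^+ 2) n.+1
  - conjc kappa ^+ 2 * osc (conjc z0 ^+ 2 * conjc ze ^+ 2) n.+1).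
Let G n := F n - A n * F n - B n * conjc (F n).

Let s_neq0 : Im ze != 0.
Proof. by rewrite -normr_gt0 (lt_le_trans sm_gt0). Qed.

Let unit_dist u : u \in [:: z0 ^+ 2; conjc z0 ^+ 2;
    z0 ^+ 2 * conjc ze ^+ 2; conjc z0 ^+ 2 * conjc ze ^+ 2] ->
  [/\ u * conjc u = 1, conjc u != 1 & d <= normc (1 - conjc u)].
Proof.
move=> hu; have du := dist hu; split => //.
- move: hu; rewrite !inE => /or4P[] /eqP ->;
    by rewrite ?unitM ?unitX ?unit_conj.
- apply: contraTneq du => ->; rewrite subrr normc0 -ltNge //.
Qed.

Let normc_g : normc g <= c1 / 4.
Proof.
rewrite normc_real normrM normfV normrM (gtr0_norm beta_gt0) /amplitude.
rewrite [leRHS](_ : _ = `|Im z0| * beta / sm); last by field; rewrite gt_eqF.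
rewrite ler_wpM2l ?mulr_ge0 ?(ltW beta_gt0)//.
by rewrite lef_pV2 ?posrE// (lt_le_trans sm_gt0).
Qed.

Let comb (u v : R[i]) (x : R) : normc u <= x -> normc v <= x ->
  normc (g * (kappa ^+ 2 * u - conjc kappa ^+ 2 * v)) <= c1 / 2 * x.
Proof.
move=> ux vx.
have x0 : 0 <= x by apply: le_trans ux; exact: normc_ge0.
have h : normc (kappa ^+ 2 * u - conjc kappa ^+ 2 * v) <= x + x.
  apply: (le_trans (le_normcB _ _)); apply: lerD;
  by rewrite normcM normcX ?normc_conj (normc_unit kappa_unit) expr1n mul1r.
rewrite normcM; apply: (@le_trans _ _ (c1 / 4 * (x + x))); last by lra.
by apply: ler_pM => //; exact: normc_ge0.
Qed.

Let AB_bound n : normc (A n) + normc (B n) <= c1 / (d * n.+1%:R).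
Proof.
have [h1 _ d1] := unit_dist (u := z0 ^+ 2) (mem_head _ _).
have [h2 _ d2] : [/\ _, _ & _] := unit_dist (u := conjc z0 ^+ 2) ltac:(by rewrite !inE eqxx orbT).
have [h3 _ d3] : [/\ _, _ & _] := unit_dist (u := z0 ^+ 2 * conjc ze ^+ 2) ltac:(by rewrite !inE eqxx !orbT).
have [h4 _ d4] : [/\ _, _ & _] :=
  unit_dist (u := conjc z0 ^+ 2 * conjc ze ^+ 2) ltac:(by rewrite !inE eqxx !orbT).
have k1 := comb (osc_bound n h1 d_gt0 d1) (osc_bound n h2 d_gt0 d2).
have k2 := comb (osc_bound n h3 d_gt0 d3) (osc_bound n h4 d_gt0 d4).
by rewrite /A /B mulNr normcN [amplitude sm in leRHS]splitr mulrDl lerD.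
Qed.

Let E n :=
  - g * (kappa ^+ 2 * osc_err (z0 ^+ 2) n
         - conjc kappa ^+ 2 * osc_err (conjc z0 ^+ 2) n) * F n
  + g * (kappa ^+ 2 * osc_err (z0 ^+ 2 * conjc ze ^+ 2) n
         - conjc kappa ^+ 2 * osc_err (conjc z0 ^+ 2 * conjc ze ^+ 2) n) * conjc (F n)
  + 'i%C * (q n.+1 / (2 * Im ze))%:C * (F n - conjc (F n) * conjc ze ^+ n.+2 ^+ 2).

Let tail_step n : F n.+1 - F n =
  (0 * F n + 0 * conjc (F n)) + (A n.+1 - A n) * F n + (B n.+1 - B n) * conjc (F n) + E n.
Proof.
have [h1 n1 _] := unit_dist (u := z0 ^+ 2) (mem_head _ _).
have [h2 n2 _] : [/\ _, _ & _] := unit_dist (u := conjc z0 ^+ 2) ltac:(by rewrite !inE eqxx orbT).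
have [h3 n3 _] : [/\ _, _ & _] := unit_dist (u := z0 ^+ 2 * conjc ze ^+ 2) ltac:(by rewrite !inE eqxx !orbT).
have [h4 n4 _] : [/\ _, _ & _] :=
  unit_dist (u := conjc z0 ^+ 2 * conjc ze ^+ 2) ltac:(by rewrite !inE eqxx !orbT).
have s1 := osc_step n h1 n1; have s2 := osc_step n h2 n2.
have s3 := osc_step n h3 n3; have s4 := osc_step n h4 n4.
rewrite (frame_step n ze_unit s_neq0 ysol) ze_re subrr subr0.
rewrite (resonant_potential_split n.+1 s_neq0) -/g -/(F n).
have -> : A n.+1 - A n = - g * (kappa ^+ 2 * (osc (z0 ^+ 2) n.+2 - osc (z0 ^+ 2) n.+1)
   - conjc kappa ^+ 2 * (osc (conjc z0 ^+ 2) n.+2 - osc (conjc z0 ^+ 2) n.+1)).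
  by rewrite /A; ring.
have -> : B n.+1 - B n = g * (kappa ^+ 2 *
   (osc (z0 ^+ 2 * conjc ze ^+ 2) n.+2 - osc (z0 ^+ 2 * conjc ze ^+ 2) n.+1)
   - conjc kappa ^+ 2 * (osc (conjc z0 ^+ 2 * conjc ze ^+ 2) n.+2
   - osc (conjc z0 ^+ 2 * conjc ze ^+ 2) n.+1)).
  by rewrite /B; ring.
rewrite s1 s2 s3 s4 /E (exprMn n.+2 (z0 ^+ 2)) (exprMn n.+2 (conjc z0 ^+ 2)) (exprAC (conjc ze) n.+2 2).
by ring.
Qed.

Let q_bound n : normc ('i%C * (q n.+1 / (2 * Im ze))%:C *
    (F n - conjc (F n) * conjc ze ^+ n.+2 ^+ 2)) <= `|q n.+1| / sm * normc (F n).
Proof.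
rewrite normcM (normcM 'i%C) normc_i mul1r normc_real.
have h : normc (F n - conjc (F n) * conjc ze ^+ n.+2 ^+ 2) <= 2 * normc (F n).
  by rewrite normc_twist // normc_unitX2 ?unit_conj.
have h2 : `|q n.+1 / (2 * Im ze)| <= `|q n.+1| / (2 * sm).
  rewrite normrM normfV ler_wpM2l// lef_pV2 ?posrE ?mulr_gt0 ?normr_gt0 ?mulf_neq0//.
  by rewrite normrM normr_nat ler_pM2l.
apply: (@le_trans _ _ (`|q n.+1| / (2 * sm) * (2 * normc (F n)))).
  by apply: ler_pM => //; exact: normc_ge0.
by rewrite [leRHS](_ : _ = `|q n.+1| / (2 * sm) * (2 * normc (F n)))//; field; rewrite gt_eqF.
Qed.

Let E_bound n : normc (E n) <=
  (`|q n.+1| / sm + c1 / d * (n.+1%:R * n.+2%:R)^-1) * normc (F n).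
Proof.
have [h1 _ d1] := unit_dist (u := z0 ^+ 2) (mem_head _ _).
have [h2 _ d2] : [/\ _, _ & _] := unit_dist (u := conjc z0 ^+ 2) ltac:(by rewrite !inE eqxx orbT).
have [h3 _ d3] : [/\ _, _ & _] := unit_dist (u := z0 ^+ 2 * conjc ze ^+ 2) ltac:(by rewrite !inE eqxx !orbT).
have [h4 _ d4] : [/\ _, _ & _] :=
  unit_dist (u := conjc z0 ^+ 2 * conjc ze ^+ 2) ltac:(by rewrite !inE eqxx !orbT).
have k1 := comb (osc_err_bound n h1 d_gt0 d1) (osc_err_bound n h2 d_gt0 d2).
have k2 := comb (osc_err_bound n h3 d_gt0 d3) (osc_err_bound n h4 d_gt0 d4).
have F0 := normc_ge0 (F n).
apply: (le_trans (le_normcD _ _)).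
rewrite [leRHS]mulrDl [leRHS]addrC; apply: lerD; last exact: q_bound.
apply: (le_trans (le_normcD _ _)).
rewrite (normcM (- _ * _)) (normcM (g * _)) normc_conj -mulrDl ler_wpM2r// mulNr normcN.
rewrite (_ : c1 / d * _ = c1 / 2 * (d * (n.+1%:R * n.+2%:R))^-1 +
    c1 / 2 * (d * (n.+1%:R * n.+2%:R))^-1); first exact: lerD.
by rewrite -mulrDl -splitr [in RHS]invfM mulrA.
Qed.

Let dF_bound n : normc (F n.+1 - F n) <= (c1 / n.+2%:R + `|q n.+1| / sm) * normc (F n).
Proof.
rewrite (frame_step n ze_unit s_neq0 ysol) ze_re subrr subr0.
rewrite normcM (normcM 'i%C) normc_i mul1r normc_real -/(F n).
have h : normc (F n - conjc (F n) * conjc ze ^+ n.+2 ^+ 2) <= 2 * normc (F n).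
  by rewrite normc_twist // normc_unitX2 ?unit_conj.
have hb := resonant_potential_bound n.+1.
have h2 : `|b n.+1 / (2 * Im ze)| <= (4 * `|Im z0| * beta / n.+2%:R + `|q n.+1|) / (2 * sm).
  rewrite normrM normfV ler_pM ?invr_ge0//.
  rewrite lef_pV2 ?posrE ?mulr_gt0 ?normr_gt0 ?mulf_neq0//.
  by rewrite normrM normr_nat ler_pM2l.
apply: (@le_trans _ _ ((4 * `|Im z0| * beta / n.+2%:R + `|q n.+1|) / (2 * sm) * (2 * normc (F n)))).
  by apply: ler_pM => //; exact: normc_ge0.
rewrite /amplitude le_eqVlt; apply/orP; left; apply/eqP.
have n2 : (n.+2%:R : R) != 0 by rewrite pnatr_eq0.
by move: (n.+2%:R) n2 => x x0; field; rewrite x0 gt_eqF.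
Qed.

(** All four frequencies are removed, so [averaging_step] applies with [a = b = 0] and the corrected
    frame [G] is almost constant; at both ends [F - G] is small relative to [F]. In the application
    [d] is proportional to the detuning, so smallness means that [N] times the detuning is large. *)
Lemma frame_tail N n : (N <= n)%N ->
  C1 * ((d * N.+1%:R)^-1 + Q N) <= 1 / 2 ->
  normc (frame ze y n - frame ze y N) <=
    7 * C1 * ((d * N.+1%:R)^-1 + Q N) * normc (frame ze y N).
Proof.
move=> Nn small; have c10 : 0 <= c1 by rewrite /amplitude !mulr_ge0 ?invr_ge0 ?(ltW beta_gt0) ?(ltW sm_gt0).
have sm0 : 0 <= sm^-1 by rewrite invr_ge0 ltW.
have C10 : 0 <= C1 by rewrite /tail_const; move: c1 c10 => x x0; have := sqr_ge0 x; lra.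
have C12 : 2 * c1 <= C1 by rewrite /tail_const; move: c1 => x; have := sqr_ge0 x; lra.
have Q0 : 0 <= Q N by apply: le_trans (qQ N N); rewrite big_geq.
have dN0 k : 0 <= (d * k.+1%:R)^-1 by rewrite invr_ge0 mulr_ge0 // ltW.
have dN k : (N <= k)%N -> (d * k.+1%:R)^-1 <= (d * N.+1%:R)^-1.
  move=> Nk; rewrite lef_pV2 ?posrE ?mulr_gt0 ?ltr0Sn//.
  by rewrite ler_pM2l// ler_nat.
have arith (c dv x p r t1 t2 : R) : t1 <= c ^+ 2 * (dv * x) -> t2 <= 1 / 2 * (p * r) ->
    0 <= c ^+ 2 * p -> 0 <= c * p -> 0 <= r * (dv * x) ->
    2 * (p * r + c * dv * x + (t1 + t2)) <= (2 * c + 2 * c ^+ 2 + 3 * r) * (dv * x + p).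
  by move=> *; lra.
pose sg k := c1 / (d * k.+1%:R).
have sg2 k : (N <= k)%N -> sg k <= c1 * (d * N.+1%:R)^-1.
  by move=> Nk; rewrite /sg ler_wpM2l // dN.
have sgN : c1 * (d * N.+1%:R)^-1 <= 1 / 2 * (C1 * ((d * N.+1%:R)^-1 + Q N)).
  have h1 : 2 * c1 * (d * N.+1%:R)^-1 <= C1 * (d * N.+1%:R)^-1 by rewrite ler_wpM2r.
  have h2 : 0 <= C1 * Q N by rewrite mulr_ge0.
  by move: (_^-1) (Q N) h1 h2 => x t; move: C1 c1 => u v ? ?; nra.
have sgh k : (N <= k)%N -> sg k <= 1 / 2.
  move=> Nk; apply: (le_trans (sg2 k Nk)); apply: (le_trans sgN).
  by rewrite -[leRHS]mulr1 ler_wpM2l //; apply: (le_trans small); lra.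
pose e k := C1 * (d^-1 * (k.+1%:R * k.+2%:R)^-1 + `|q k.+1|).
have D0 k : 0 <= (k.+1%:R * k.+2%:R : R)^-1 by rewrite invr_ge0 mulr_ge0.
have dV0 : 0 <= d^-1 by rewrite invr_ge0 ltW.
have step k : (N <= k)%N -> normc (F k - G k) <= sg k * normc (F k) /\
    normc (F k) <= 2 * normc (G k) /\
    normc (G k.+1 - G k) <= e k * normc (G k).
  move=> Nk.
  have [] := averaging_step (tail_step k) (E_bound k) (dF_bound k) (AB_bound k)
    (sgh k Nk) (AB_bound k.+1) (lexx _).
  - exact: (addr_ge0 (mulr_ge0 (normr_ge0 _) sm0) (mulr_ge0 (mulr_ge0 c10 dV0) (D0 k))).
  - by rewrite addr_ge0 // mulr_ge0 // invr_ge0.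
  move=> p1 [p2 p3]; split => //; split => //.
  rewrite !mul0r addr0 subr0 !normc0 addr0 mul0r addr0 in p3.
  apply: (le_trans p3); rewrite ler_wpM2r ?normc_ge0 // /e /tail_const.
  have t1 : c1 / (d * k.+2%:R) * (c1 / k.+2%:R) <= c1 ^+ 2 * (d^-1 * (k.+1%:R * k.+2%:R)^-1).
    rewrite [leLHS](_ : _ = c1 ^+ 2 * (d^-1 * (k.+2%:R * k.+2%:R)^-1)); last first.
      have n2 : (k.+2%:R : R) != 0 by rewrite pnatr_eq0.
      by move: (k.+2%:R) n2 => x x0; field; rewrite x0 gt_eqF.
    rewrite ler_wpM2l ?sqr_ge0// ler_wpM2l// lef_pV2 ?posrE ?mulr_gt0 ?ltr0Sn//.
    by rewrite ler_pM2r ?ltr0Sn// ler_nat.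
  have t2 : c1 / (d * k.+2%:R) * (`|q k.+1| / sm) <= 1 / 2 * (`|q k.+1| / sm).
    by rewrite ler_wpM2r ?mulr_ge0// sgh// leqW.
  have u0 : 0 <= c1 ^+ 2 * `|q k.+1| by rewrite mulr_ge0 ?sqr_ge0.
  have u1 : 0 <= c1 * `|q k.+1| by rewrite mulr_ge0.
  have u2 : 0 <= sm^-1 * (d^-1 * (k.+1%:R * k.+2%:R)^-1) by rewrite !mulr_ge0.
  by rewrite (mulrDr (c1 / (d * k.+2%:R))); exact: arith.
have e0 k : 0 <= e k by rewrite /e mulr_ge0 // addr_ge0 ?mulr_ge0.
have es k : \sum_(N <= j < k) e j <= C1 * ((d * N.+1%:R)^-1 + Q N).
  rewrite -mulr_sumr ler_wpM2l // big_split /= -mulr_sumr lerD //.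
  by rewrite invfM ler_wpM2l // sum_inv_le.
have gc := gronwall_near_constant e0 (fun k Nk => (step k Nk).2.2) es small Nn.
have [n1 [n2 _]] := step n Nn; have [m1 [m2 _]] := step N (leqnn _).
rewrite -/(F n) -/(F N).
have k1 := normc_lipschitz (G n) (G N).
have k2 := normc_lipschitz (G N) (F N); rewrite normcB in k2.
have k3 := le_normcD (F n - G n) (G n - G N).
have k4 := le_normcD (F n - G n + (G n - G N)) (G N - F N).
have ee : F n - G n + (G n - G N) + (G N - F N) = F n - F N by ring.
rewrite ee in k4; rewrite [normc (G N - F N)]normcB in k4.
have F0 := normc_ge0 (F N); have GN0 := normc_ge0 (G N).
move: gc sgN small; set x := _^-1 + Q N => gc sgN small.
have x0 : 0 <= x by rewrite addr_ge0.
have Fn0 := normc_ge0 (F n).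
have r1 : normc (F n - G n) <= 1 / 2 * (C1 * x) * normc (F n).
  by apply: (le_trans n1); rewrite ler_wpM2r//; apply: (le_trans (sg2 n Nn)).
have r2 : normc (F N - G N) <= 1 / 2 * (C1 * x) * normc (F N).
  by apply: (le_trans m1); rewrite ler_wpM2r//; apply: (le_trans (sg2 N (leqnn _))).
have Cx0 : 0 <= C1 * x by rewrite mulr_ge0.
rewrite -(mulrA 7); move: (C1 * x) small r1 r2 gc Cx0 => Cx small r1 r2 gc Cx0.
have b1 : normc (G N) <= 5 / 4 * normc (F N) by nra.
have b2 : normc (G n) <= 5 / 2 * normc (F N) by nra.
have b3 : normc (F n) <= 5 * normc (F N) by lra.
have a1 : Cx * normc (F n) <= Cx * (5 * normc (F N)) by rewrite ler_wpM2l.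
have a2 : Cx * normc (G N) <= Cx * (5 / 4 * normc (F N)) by rewrite ler_wpM2l.
have a3 : 0 <= Cx * normc (F N) by rewrite mulr_ge0.
lra.
Qed.
End tail.
End resonant_potential.

(** * The averaged frame at the critical energy *)

Section resonant_frame.
Context {R : realType}.
Variables (z0 kappa : R[i]) (beta d : R) (q : nat -> R).
Hypothesis z0_unit : z0 * conjc z0 = 1.
Hypothesis kappa_unit : kappa * conjc kappa = 1.
Hypothesis z0_im : Im z0 != 0.
Hypothesis beta_gt0 : 0 < beta.
Hypothesis d_gt0 : 0 < d.
Hypothesis dist0 : forall u, u \in [:: z0 ^+ 2; conjc z0 ^+ 2;
    conjc z0 ^+ 2 * conjc z0 ^+ 2] -> d <= normc (1 - conjc u).

Local Notation b := (resonant_potential z0 kappa beta q).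

(* The averaged frame [res_G] satisfies G' - G = res_lin G + res_conj (conj G) up
   to summable errors; [res_A] and [res_B] sum the oscillating coefficients. *)
Definition res_lin (mu : R) : R[i] := - ('i%C * (mu / (2 * Im z0))%:C).
Definition res_conj n : R[i] := kappa ^+ 2 * (beta / n.+2%:R)%:C.

Definition res_A n : R[i] := - beta%:C * (kappa ^+ 2 * osc (z0 ^+ 2) n.+1
  - conjc kappa ^+ 2 * osc (conjc z0 ^+ 2) n.+1).
(** The term of frequency [z0 ^+ 2 * conjc z0 ^+ 2 = 1] does not oscillate and stays behind as
    [res_conj]. The detuning has a coefficient [mu] without decay; its oscillating part is summed
    exactly as a geometric progression, which contributes an amount of order [mu] to the
    transformation. *)
Definition res_B (mu : R) n : R[i] :=
  - beta%:C * (conjc kappa ^+ 2 * osc (conjc z0 ^+ 2 * conjc z0 ^+ 2) n.+1)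
  + 'i%C * (mu / (2 * Im z0))%:C * ((conjc z0 ^+ 2) ^+ n.+1 / (1 - z0 ^+ 2)).
Definition res_G (mu : R) (y : nat -> R) n : R[i] :=
  frame z0 y n - res_A n * frame z0 y n - res_B mu n * conjc (frame z0 y n).

Definition res_c : R := (3 * beta + `|Im z0|^-1) / d.
(** Collected from [averaging_step]: [q] contributes 2 directly and 1 through [sg' <= 1 / 2],
    summation by parts gives [6 * beta / d], and the products of two small quantities give
    [2 * res_c * (5 * beta + 2 / |Im z0|)], with a further 4 from
    [(1/n + |mu|)^2 <= 4 (1/(n (n+1)) + mu^2)]. *)
Definition res_C : R := 3 / `|Im z0| + 6 * beta / d +
  8 * res_c * (5 * beta + 2 / `|Im z0|).

Let E (mu : R) y n : R[i] :=
  - beta%:C * (kappa ^+ 2 * osc_err (z0 ^+ 2) n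
         - conjc kappa ^+ 2 * osc_err (conjc z0 ^+ 2) n) * frame z0 y n
  - beta%:C * (conjc kappa ^+ 2 * osc_err (conjc z0 ^+ 2 * conjc z0 ^+ 2) n)
     * conjc (frame z0 y n)
  + 'i%C * (q n.+1 / (2 * Im z0))%:C *
    (frame z0 y n - conjc (frame z0 y n) * conjc z0 ^+ n.+2 ^+ 2).

Let unit_dist u : u \in [:: z0 ^+ 2; conjc z0 ^+ 2;
    conjc z0 ^+ 2 * conjc z0 ^+ 2] ->
  [/\ u * conjc u = 1, conjc u != 1 & d <= normc (1 - conjc u)].
Proof.
move=> hu; have du := dist0 hu; split => //.
- move: hu; rewrite !inE => /or3P[] /eqP ->;
    by rewrite ?unitM ?unitX ?unit_conj.
- by apply: contraTneq du => ->; rewrite subrr normc0 -ltNge.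
Qed.

Let m1 : z0 ^+ 2 \in [:: z0 ^+ 2; conjc z0 ^+ 2; conjc z0 ^+ 2 * conjc z0 ^+ 2].
Proof. exact: mem_head. Qed.
Let m2 : conjc z0 ^+ 2 \in [:: z0 ^+ 2; conjc z0 ^+ 2; conjc z0 ^+ 2 * conjc z0 ^+ 2].
Proof. by rewrite !inE eqxx orbT. Qed.
Let m3 : conjc z0 ^+ 2 * conjc z0 ^+ 2 \in
  [:: z0 ^+ 2; conjc z0 ^+ 2; conjc z0 ^+ 2 * conjc z0 ^+ 2].
Proof. by rewrite !inE eqxx !orbT. Qed.

Let res_step mu y n : solves y b (2 * Re z0 + mu) ->
  frame z0 y n.+1 - frame z0 y n =
  (res_lin mu * frame z0 y n + res_conj n * conjc (frame z0 y n))
  + (res_A n.+1 - res_A n) * frame z0 y n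
  + (res_B mu n.+1 - res_B mu n) * conjc (frame z0 y n) + E mu y n.
Proof.
move=> ysol.
have [h1 n1 _] := unit_dist m1; have [h2 n2 _] := unit_dist m2.
have [h3 n3 _] := unit_dist m3.
have s1 := osc_step n h1 n1; have s2 := osc_step n h2 n2; have s3 := osc_step n h3 n3.
rewrite (frame_step n z0_unit z0_im ysol).
have -> : 'i%C * ((b n.+1 - (2 * Re z0 + mu - 2 * Re z0)) / (2 * Im z0))%:C =
   'i%C * (b n.+1 / (2 * Im z0))%:C - 'i%C * (mu / (2 * Im z0))%:C.
  by rewrite -mulrBr -(@realcB R); congr (_ * _%:C); rewrite -mulrBl; congr (_ / _); ring.
rewrite (resonant_potential_split _ _ _ _ _ z0_im) /res_conj /res_lin.
have -> : Im z0 * beta / Im z0 = beta by field.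
have -> : (beta / n.+2%:R)%:C = beta%:C * (n.+2%:R^-1)%:C by exact: (@realcM R).
have -> : res_A n.+1 - res_A n = - beta%:C * (kappa ^+ 2 * (osc (z0 ^+ 2) n.+2 - osc (z0 ^+ 2) n.+1)
   - conjc kappa ^+ 2 * (osc (conjc z0 ^+ 2) n.+2 - osc (conjc z0 ^+ 2) n.+1)).
  by rewrite /res_A; ring.
have z2 : 1 - z0 ^+ 2 != 0.
  by rewrite subr_eq0 eq_sym; move: n2; rewrite conjcX conjcK.
have zz : conjc z0 ^+ 2 * z0 ^+ 2 = 1 by rewrite -exprMn mulrC z0_unit expr1n.
have -> : res_B mu n.+1 - res_B mu n = - beta%:C * (conjc kappa ^+ 2 *
   (osc (conjc z0 ^+ 2 * conjc z0 ^+ 2) n.+2 - osc (conjc z0 ^+ 2 * conjc z0 ^+ 2) n.+1))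
   + 'i%C * (mu / (2 * Im z0))%:C * (conjc z0 ^+ 2) ^+ n.+2.
  rewrite /res_B.
  have e : (conjc z0 ^+ 2) ^+ n.+2 = (conjc z0 ^+ 2) ^+ n.+2 / (1 - z0 ^+ 2)
     - (conjc z0 ^+ 2) ^+ n.+1 / (1 - z0 ^+ 2).
    have -> : (conjc z0 ^+ 2) ^+ n.+1 = (conjc z0 ^+ 2) ^+ n.+2 * z0 ^+ 2.
      by rewrite [_ ^+ n.+2]exprSr -mulrA zz mulr1.
    by move: (_ ^+ n.+2) (z0 ^+ 2) z2 => W v v1; field.
  by rewrite [in RHS]e; ring.
rewrite s1 s2 s3 /E (exprMn n.+2 (conjc z0 ^+ 2)) (exprAC (conjc z0) n.+2 2).
have zzn : (conjc z0 ^+ 2) ^+ n.+2 * (z0 ^+ 2) ^+ n.+2 = 1.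
  by rewrite -exprMn zz expr1n.
move: ((conjc z0 ^+ 2) ^+ n.+2) ((z0 ^+ 2) ^+ n.+2) zzn => w v vw.
apply/eqP; rewrite -subr_eq0; apply/eqP.
set K := (n.+2%:R^-1)%:C; set f := frame z0 y n.
transitivity (beta%:C * kappa ^+ 2 * K * conjc f * (w * v - 1)); first by ring.
by rewrite vw subrr mulr0.
Qed.

Let S := `|Im z0|^-1.

Let S_gt0 : 0 < S.
Proof. by rewrite invr_gt0 normr_gt0. Qed.

Let normc_mu mu : normc ('i%C * (mu / (2 * Im z0))%:C) = `|mu| * S / 2.
Proof.
by rewrite normcM normc_i mul1r normc_real normrM normfV normrM normr_nat invfM mulrA mulrAC.
Qed.

Let normc_kX (u : R[i]) : u * conjc u = 1 -> normc (u ^+ 2) = 1.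
Proof. by move=> h; rewrite normcX (normc_unit h) expr1n. Qed.

Let kk : conjc kappa * conjc (conjc kappa) = 1.
Proof. exact: unit_conj. Qed.

Let normc_beta (u : R[i]) : normc (- beta%:C * u) = beta * normc u.
Proof. by rewrite mulNr normcN normcM normc_real gtr0_norm. Qed.

Let pair_bound (u v : R[i]) x : normc u <= x -> normc v <= x ->
  normc (- beta%:C * (kappa ^+ 2 * u - conjc kappa ^+ 2 * v)) <= 2 * beta * x.
Proof.
move=> ux vx; rewrite normc_beta -mulrA mulrCA ler_pM2l//.
apply: (le_trans (le_normcB _ _)).
by rewrite (normcM _ u) (normcM _ v) (normc_kX kappa_unit) (normc_kX kk); lra.
Qed.

Let single_bound (v : R[i]) x : normc v <= x ->
  normc (- beta%:C * (conjc kappa ^+ 2 * v)) <= beta * x.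
Proof. by move=> vx; rewrite normc_beta ler_pM2l// (normcM _ v) (normc_kX kk) mul1r. Qed.

Let Xn (mu : R) n := n.+1%:R^-1 + `|mu|.

Let AB_bound mu n : normc (res_A n) + normc (res_B mu n) <= res_c * Xn mu n.
Proof.
have [h1 _ d1] := unit_dist m1; have [h2 _ d2] := unit_dist m2.
have [h3 _ d3] := unit_dist m3.
have k1 := pair_bound (osc_bound n h1 d_gt0 d1) (osc_bound n h2 d_gt0 d2).
have k2 := single_bound (osc_bound n h3 d_gt0 d3).
have k3 : normc ('i%C * (mu / (2 * Im z0))%:C * ((conjc z0 ^+ 2) ^+ n.+1 / (1 - z0 ^+ 2)))
   <= `|mu| * S / 2 * d^-1.
  rewrite normcM normc_mu ler_wpM2l ?mulr_ge0 ?(ltW S_gt0)//.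
  rewrite normcM normcX (normc_unit h2) expr1n mul1r normcV.
  have dz : d <= normc (1 - z0 ^+ 2) by rewrite -[z0 ^+ 2]conjcK [in conjc (z0 ^+ 2)]conjcX.
  by rewrite lef_pV2 ?posrE// (lt_le_trans d_gt0).
have k4 := le_normcD (- beta%:C * (conjc kappa ^+ 2 * osc (conjc z0 ^+ 2 * conjc z0 ^+ 2) n.+1))
  ('i%C * (mu / (2 * Im z0))%:C * ((conjc z0 ^+ 2) ^+ n.+1 / (1 - z0 ^+ 2))).
rewrite /res_A /res_B /res_c /Xn -/S.
have t : forall D N : R, 0 <= D -> 0 <= N ->
   2 * beta * (D * N) + (beta * (D * N) + `|mu| * S / 2 * D) <=
   (3 * beta + S) * D * (N + `|mu|).
  move=> D N D0 N0.
  have a1 : 0 <= beta * (D * `|mu|) by rewrite !mulr_ge0 // ltW.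
  have a2 : 0 <= S * (D * `|mu|) by rewrite !mulr_ge0 // ltW.
  have a3 : 0 <= S * (D * N) by rewrite !mulr_ge0 // ltW.
  by lra.
have := t d^-1 n.+1%:R^-1; rewrite !invr_ge0 ler0n (ltW d_gt0) -invfM => /(_ isT isT).
apply: le_trans; apply: lerD => //; apply: (le_trans k4); exact: lerD.
Qed.

Let E_bound mu y n : normc (E mu y n) <=
  (`|q n.+1| * S + 3 * beta / d * (n.+1%:R * n.+2%:R)^-1) * normc (frame z0 y n).
Proof.
have [h1 _ d1] := unit_dist m1; have [h2 _ d2] := unit_dist m2.
have [h3 _ d3] := unit_dist m3.
have k1 := pair_bound (osc_err_bound n h1 d_gt0 d1) (osc_err_bound n h2 d_gt0 d2).
have k2 := single_bound (osc_err_bound n h3 d_gt0 d3).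
rewrite /E; set f := frame z0 y n.
have k3 : normc ('i%C * (q n.+1 / (2 * Im z0))%:C * (f - conjc f * conjc z0 ^+ n.+2 ^+ 2))
    <= `|q n.+1| * S / 2 * (2 * normc f).
  rewrite normcM normc_mu ler_wpM2l ?mulr_ge0 ?(ltW S_gt0)//.
  by rewrite normc_twist // normc_unitX2 ?unit_conj.
have f0 := normc_ge0 f.
apply: (le_trans (le_normcD _ _)).
have -> : (`|q n.+1| * S + 3 * beta / d * (n.+1%:R * n.+2%:R)^-1) * normc f =
   (2 * beta * (d^-1 * (n.+1%:R * n.+2%:R)^-1) * normc f +
   beta * (d^-1 * (n.+1%:R * n.+2%:R)^-1) * normc f) + `|q n.+1| * S / 2 * (2 * normc f).
  by move: (_^-1) (d^-1) => x t; field.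
rewrite -invfM; apply: lerD => //; apply: (le_trans (le_normcB _ _)); apply: lerD.
  by rewrite normcM ler_wpM2r.
by move: k2; rewrite mulNr normcN => k2; rewrite (normcM (_ * _) (conjc f)) normc_conj ler_wpM2r.
Qed.

Let dF_bound mu y n : solves y b (2 * Re z0 + mu) ->
  normc (frame z0 y n.+1 - frame z0 y n) <=
  ((4 * beta + S) * Xn mu n + `|q n.+1| * S) * normc (frame z0 y n).
Proof.
move=> ysol; rewrite (frame_step n z0_unit z0_im ysol); set f := frame z0 y n.
rewrite normcM normc_mu.
have h : normc (f - conjc f * conjc z0 ^+ n.+2 ^+ 2) <= 2 * normc f.
  by rewrite normc_twist // normc_unitX2 ?unit_conj.
have hb := resonant_potential_bound q z0_unit kappa_unit beta_gt0 n.+1.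
set v := b n.+1 - _.
have hv : `|v| * S <= (4 * beta + S) * Xn mu n + `|q n.+1| * S.
  have : `|v| <= `|b n.+1| + `|mu|.
    by rewrite /v (_ : _ - _ = b n.+1 - mu) ?ler_normB//; ring.
  have nn : n.+2%:R^-1 <= n.+1%:R^-1 :> R by rewrite lef_pV2 ?posrE ?ltr0Sn// ler_nat.
  have nn0 : 0 <= n.+1%:R^-1 :> R by rewrite invr_ge0.
  move=> hv; apply: (@le_trans _ _ ((4 * `|Im z0| * beta / n.+2%:R + `|q n.+1| + `|mu|) * S)).
    by rewrite ler_wpM2r ?(ltW S_gt0)//; apply: (le_trans hv); rewrite lerD2r.
  have SE : `|Im z0| * S = 1 by rewrite mulfV // normr_eq0.
  have -> : (4 * `|Im z0| * beta / n.+2%:R + `|q n.+1| + `|mu|) * S =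
     4 * beta * n.+2%:R^-1 * (`|Im z0| * S) + `|q n.+1| * S + `|mu| * S by ring.
  rewrite SE mulr1 /Xn.
  have a1 : beta * n.+2%:R^-1 <= beta * n.+1%:R^-1 by rewrite ler_pM2l.
  have a2 : 0 <= beta * `|mu| by rewrite mulr_ge0 // ltW.
  have a3 : 0 <= S * n.+1%:R^-1 by rewrite mulr_ge0 // ltW.
  by move: (n.+2%:R^-1) (n.+1%:R^-1) a1 a3 => *; lra.
have f0 := normc_ge0 f.
apply: (@le_trans _ _ (`|v| * S / 2 * (2 * normc f))).
  by rewrite ler_wpM2l ?mulr_ge0 ?(ltW S_gt0).
rewrite (_ : _ / 2 * _ = `|v| * S * normc f); last by field.
by rewrite ler_wpM2r.
Qed.

Let lin_bound mu n : normc (res_lin mu) + normc (res_conj n) <= (beta + S) * Xn mu n.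
Proof.
rewrite /res_lin normcN normc_mu /res_conj normcM (normc_kX kappa_unit) mul1r.
rewrite normc_real normrM normfV normr_nat gtr0_norm // /Xn.
have nn : n.+2%:R^-1 <= n.+1%:R^-1 :> R by rewrite lef_pV2 ?posrE ?ltr0Sn// ler_nat.
have nn0 : 0 <= n.+1%:R^-1 :> R by rewrite invr_ge0.
have a1 : beta * n.+2%:R^-1 <= beta * n.+1%:R^-1 by rewrite ler_pM2l.
have a2 : 0 <= beta * `|mu| by rewrite mulr_ge0 // ltW.
have a3 : 0 <= S * n.+1%:R^-1 by rewrite mulr_ge0 // ltW.
have a4 : 0 <= S * `|mu| by rewrite mulr_ge0 // ltW.
by move: (n.+2%:R^-1) (n.+1%:R^-1) a1 a3 => *; lra.
Qed.

(** The remaining errors are products of two quantities of order [1 / n] or [mu], or come from [q]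
    or from summation by parts. Hence the squares in the bound: over [n] up to [T / |mu|] the terms
    [mu ^+ 2] add up to [T * |mu|] only. *)
Lemma resonant_step mu y n : solves y b (2 * Re z0 + mu) ->
  res_c * (n.+1%:R^-1 + `|mu|) <= 1 / 2 ->
  [/\ normc (frame z0 y n - res_G mu y n) <=
        res_c * (n.+1%:R^-1 + `|mu|) * normc (frame z0 y n),
      normc (frame z0 y n) <= 2 * normc (res_G mu y n) &
      normc (res_G mu y n.+1 - res_G mu y n -
        (res_lin mu * res_G mu y n + res_conj n * conjc (res_G mu y n))) <=
      res_C * ((n.+1%:R * n.+2%:R)^-1 + mu ^+ 2 + `|q n.+1|) * normc (res_G mu y n)].
Proof.
move=> ysol small.
have c0 : 0 <= res_c.
  by rewrite /res_c mulr_ge0 ?invr_ge0 ?(ltW d_gt0)// addr_ge0 ?(ltW S_gt0)// mulr_ge0 // ltW.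
have nn0 : 0 <= n.+1%:R^-1 :> R by rewrite invr_ge0.
have X0 : 0 <= Xn mu n by rewrite addr_ge0.
have S0 := ltW S_gt0; have b0 := ltW beta_gt0.
have D0 : 0 <= (n.+1%:R * n.+2%:R : R)^-1 by rewrite invr_ge0 mulr_ge0.
have bd0 : 0 <= 3 * beta / d by rewrite mulr_ge0 ?invr_ge0 ?(ltW d_gt0)// mulr_ge0.
have Xle : Xn mu n.+1 <= Xn mu n by rewrite lerD2r lef_pV2 ?posrE ?ltr0Sn// ler_nat.
have [] := averaging_step (res_step n ysol) (E_bound mu y n) (dF_bound n ysol)
  (AB_bound mu n) small (AB_bound mu n.+1) (lin_bound mu n).
- exact: (addr_ge0 (mulr_ge0 (normr_ge0 _) S0) (mulr_ge0 bd0 D0)).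
- by rewrite addr_ge0 // !mulr_ge0 // addr_ge0 // mulr_ge0.
move=> p1 [p2 p3]; split => //; apply: (le_trans p3).
rewrite ler_wpM2r ?normc_ge0 //.
have XX : Xn mu n ^+ 2 <= 4 * ((n.+1%:R * n.+2%:R)^-1 + mu ^+ 2).
  rewrite /Xn -(real_normK (num_real mu)).
  have : (n.+1%:R^-1 : R) ^+ 2 <= 2 * (n.+1%:R * n.+2%:R)^-1.
    have n2 : n.+1%:R^-1 <= 2 * n.+2%:R^-1 :> R.
      rewrite ler_pdivlMr ?ltr0Sn // mulrC ler_pdivrMr ?ltr0Sn //.
      by rewrite -natrM ler_nat mul2n -addnn addSn addnS !ltnS leq_addr.
    rewrite expr2 invfM mulrCA; exact: ler_wpM2l.
  have := sqr_ge0 (n.+1%:R^-1 - `|mu|).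
  by move: (n.+1%:R^-1) ((_ * _)^-1) => u v; nra.
have t1 : res_c * Xn mu n.+1 * ((4 * beta + S) * Xn mu n + `|q n.+1| * S) <=
   res_c * Xn mu n * ((4 * beta + S) * Xn mu n) + 1 / 2 * (`|q n.+1| * S).
  rewrite mulrDr; apply: lerD.
    by rewrite ler_wpM2r ?mulr_ge0 ?addr_ge0 ?mulr_ge0// ler_wpM2l.
  by rewrite ler_wpM2r ?mulr_ge0//; apply: le_trans small; rewrite ler_wpM2l.
have t2 : res_c * (5 * beta + 2 * S) * Xn mu n ^+ 2 <=
  res_c * (5 * beta + 2 * S) * (4 * ((n.+1%:R * n.+2%:R)^-1 + mu ^+ 2)).
  by rewrite ler_wpM2l // mulr_ge0 // addr_ge0 // mulr_ge0.
rewrite /res_C -/S.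
have u1 : 0 <= S * ((n.+1%:R * n.+2%:R)^-1 + mu ^+ 2) by rewrite mulr_ge0 // addr_ge0 // sqr_ge0.
have u2 : 0 <= beta / d * (mu ^+ 2 + `|q n.+1|).
  by rewrite mulr_ge0 ?mulr_ge0 ?invr_ge0 ?(ltW d_gt0)// addr_ge0 ?sqr_ge0.
have u3 : 0 <= res_c * (5 * beta + 2 * S) * `|q n.+1|.
  by rewrite mulr_ge0 // mulr_ge0 // addr_ge0 // mulr_ge0.
move: t1 t2 u1 u2 u3 D0.
move: ((n.+1%:R * n.+2%:R)^-1) (Xn mu n) (Xn mu n.+1) => D X X'.
move: (d^-1) `|q n.+1| (mu ^+ 2) res_c => dv p m c *.
lra.
Qed.

End resonant_frame.

(** * The Bessel-type model at the critical energy *)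

Section factorial_series.
Context {R : realType}.
Implicit Types (c : R^nat) (x y : R).

Definition psum c x : R := limn (pseries c x).

(** Stable under [pseries_diffs], so that one majorant, the exponential series, controls a power
    series together with all its derivatives. *)
Definition fact_bounded c := forall i, `|c i| <= i`!%:R^-1.

Lemma fact_bounded_diffs c : fact_bounded c -> fact_bounded (pseries_diffs c).
Proof.
move=> h i; rewrite /pseries_diffs normrM normr_nat.
have := h i.+1; rewrite factS natrM invfM => /(ler_wpM2l (ler0n R i.+1)).
by rewrite mulrA mulfV ?mul1r// pnatr_eq0.
Qed.

Lemma fact_bounded_term c x n : fact_bounded c ->
  `|c n * x ^+ n| <= exp_coeff `|x| n.
Proof. by move=> h; rewrite exp_coeffE normrM normrX ler_wpM2r ?exprn_ge0// h. Qed.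

Lemma fact_bounded_cvg c x : fact_bounded c -> cvgn (pseries c x).
Proof.
move=> h; apply: (@normed_cvg R R^o).
apply: (@series_le_cvg _ _ (exp_coeff `|x|)).
- by move=> n; exact: normr_ge0.
- by move=> n; exact: exp_coeff_ge0.
- by move=> n; exact: fact_bounded_term.
- exact: is_cvg_series_exp_coeff.
Qed.

Lemma cvg_psum c x : fact_bounded c -> pseries c x @ \oo --> psum c x.
Proof. by move=> h; exact: fact_bounded_cvg. Qed.

Lemma fact_bounded_le c x : fact_bounded c -> `|psum c x| <= expR `|x|.
Proof.
move=> h.
have ncv : cvgn [normed (pseries c x)].
  apply: (@series_le_cvg _ _ (exp_coeff `|x|)).
  - by move=> n; exact: normr_ge0.
  - by move=> n; exact: exp_coeff_ge0.
  - by move=> n; exact: fact_bounded_term.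
  - exact: is_cvg_series_exp_coeff.
apply: (le_trans (@lim_series_norm _ R^o _ ncv)).
apply: lim_series_le => //; first exact: is_cvg_series_exp_coeff.
by move=> n; exact: fact_bounded_term.
Qed.

Lemma is_derive_psum c x : fact_bounded c ->
  is_derive x (1 : R) (psum c) (psum (pseries_diffs c) x).
Proof.
move=> h; have h1 := fact_bounded_diffs h; have h2 := fact_bounded_diffs h1.
apply: (@pseries_snd_diffs _ c (`|x| + 1)); try exact: fact_bounded_cvg.
by rewrite [ltRHS]ger0_norm ?addr_ge0// ltrDl.
Qed.

Lemma psum_lipschitz c T x y : fact_bounded c -> `|x| <= T -> `|y| <= T ->
  `|psum c x - psum c y| <= expR T * `|x - y|.
Proof.
move=> h; wlog xy : x y / y <= x.
  move=> H xT yT; have [yx|/ltW xy] := leP y x; first exact: H.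
  by rewrite distrC (distrC x); exact: H.
move=> xT yT.
have [||z zxy ->] := @MVT_segment R (psum c) (psum (pseries_diffs c)) y x xy.
- by move=> z _; exact: is_derive_psum.
- apply: continuous_subspaceT => z; apply: differentiable_continuous.
  by apply/derivable1_diffP; have [] := is_derive_psum z h.
rewrite normrM ler_wpM2r//.
apply: (le_trans (fact_bounded_le z (fact_bounded_diffs h))).
rewrite ler_expR; move: zxy; rewrite in_itv /= => /andP[yz zx].
by move: xT yT; rewrite !ler_norml; lra.
Qed.

(** The mean value theorem is used twice, for the series and for its derivative. The expansion is
    about [x] and not [y] because [model_step] evaluates the differential equation at the later of
    the two points. *)
Lemma psum_taylor c T x y : fact_bounded c -> `|x| <= T -> `|y| <= T ->
  `|psum c x - psum c y - (x - y) * psum (pseries_diffs c) x|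
    <= expR T * (x - y) ^+ 2.
Proof.
move=> h xT yT; have h1 := fact_bounded_diffs h.
have [z zT zxy] : exists2 z, `|z| <= T /\ `|z - x| <= `|x - y| &
    psum c x - psum c y = psum (pseries_diffs c) z * (x - y).
  have cont : forall a b : R, {within `[a, b], continuous (psum c)}.
    move=> a b; apply: continuous_subspaceT => z; apply: differentiable_continuous.
    by apply/derivable1_diffP; have [] := is_derive_psum z h.
  have [yx|/ltW xy] := leP y x.
    have [||z] := @MVT_segment R (psum c) (psum (pseries_diffs c)) y x yx.
    - by move=> z _; exact: is_derive_psum.
    - exact: cont.
    rewrite in_itv /= => /andP[yz zx] ->; exists z => //.
    by move: xT yT; rewrite (ger0_norm (_ : 0 <= x - y)) ?subr_ge0// !ler_norml; lra.
  have [||z] := @MVT_segment R (psum c) (psum (pseries_diffs c)) x y xy.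
  - by move=> z _; exact: is_derive_psum.
  - exact: cont.
  rewrite in_itv /= => /andP[yz zx] e; exists z; last by rewrite -opprB e; ring.
  by move: xT yT; rewrite (ler0_norm (_ : x - y <= 0)) ?subr_le0// !ler_norml; lra.
rewrite zxy -(mulrC (x - y)) -mulrBr normrM.
have [zT1 zx] := zT.
have := psum_lipschitz h1 zT1 xT.
rewrite -[(x - y) ^+ 2]real_normK ?num_real// => le1.
rewrite expr2 mulrCA ler_wpM2l//; apply: (le_trans le1).
by rewrite ler_wpM2l// expR_ge0.
Qed.

End factorial_series.

Section bessel.
Context {R : realType}.
Variable beta : R.
Hypothesis beta_gt0 : 0 < beta.

(* Taylor coefficients of the even solution U, U 0 = 1, of the Bessel-type
   equation t U'' + 2 beta U' + t U / 4 = 0. *)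
Fixpoint bessel_coef (j : nat) : R :=
  match j with
  | 0 => 1
  | k.+1 => match k with
            | 0 => 0
            | i.+1 => - bessel_coef i / (4 * (i.+2%:R * (i.+1%:R + 2 * beta)))
            end
  end.

Lemma bessel_coef_rec i : 4 * (i.+2%:R * (i.+1%:R + 2 * beta)) * bessel_coef i.+2 =
  - bessel_coef i.
Proof.
rewrite /= mulrC mulfVK // !mulf_neq0 ?pnatr_eq0//.
by rewrite gt_eqF // addr_gt0 ?ltr0Sn// mulr_gt0.
Qed.

Lemma bessel_coef_bounded : fact_bounded bessel_coef.
Proof.
move=> i; suff [] : `|bessel_coef i| <= i`!%:R^-1 /\ `|bessel_coef i.+1| <= i.+1`!%:R^-1 by [].
elim: i => [|i [IH1 IH2]]; first by rewrite /= normr1 normr0 !invr1.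
split => //; rewrite [bessel_coef _]/= normrM normrN normfV.
rewrite 2!factS mulnA natrM invfM mulrC.
apply: ler_pM; rewrite ?invr_ge0 ?normr_ge0//.
have p : 0 < i.+1%:R + 2 * beta by rewrite addr_gt0 ?ltr0Sn// mulr_gt0.
rewrite lef_pV2 ?posrE ?normr_gt0 ?ltr0n ?muln_gt0//; last first.
  by rewrite !mulf_neq0 ?pnatr_eq0 ?gt_eqF.
rewrite gtr0_norm ?mulr_gt0 ?ltr0Sn// natrM.
have a1 : i.+2%:R * i.+1%:R <= i.+2%:R * (i.+1%:R + 2 * beta) :> R.
  by rewrite ler_wpM2l// lerDl mulr_ge0// ltW.
have a2 : 0 <= i.+2%:R * i.+1%:R :> R by rewrite mulr_ge0.
by apply: (le_trans a1); rewrite ler_peMl ?ler1n// mulr_ge0// ltW.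
Qed.

Let a := bessel_coef.
Let a1 := pseries_diffs a.
Let a2 := pseries_diffs a1.

Let ba : fact_bounded a. Proof. exact: bessel_coef_bounded. Qed.
Let ba1 : fact_bounded a1. Proof. exact: fact_bounded_diffs. Qed.
Let ba2 : fact_bounded a2. Proof. exact: fact_bounded_diffs. Qed.

Lemma bessel_ode t : t * psum a2 t + 2 * beta * psum a1 t + t / 4 * psum a t = 0.
Proof.
(* The middle sum runs one term further: its constant term vanishes because [bessel_coef 1 = 0], and
   after the shift all three sums are in the powers [t ^+ i.+1]. *)
have part n : t * pseries a2 t n + 2 * beta * pseries a1 t n.+1 + t / 4 * pseries a t n = 0.
  rewrite /pseries /series /= big_nat_recl // [X in 2 * beta * (X + _)](_ : _ = 0); last first.
    by rewrite /a1 /pseries_diffs /= mulr0 mul0r.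
  rewrite add0r !mulr_sumr -!big_split /= big1 // => i _.
  have := bessel_coef_rec i; rewrite -/a /a2 /a1 /pseries_diffs => e.
  rewrite -/a.
  have -> : a i = - (4 * (i.+2%:R * (i.+1%:R + 2 * beta)) * a i.+2) by rewrite e opprK.
  by rewrite exprS; field.
have c0 : (fun n => t * pseries a2 t n + 2 * beta * pseries a1 t n.+1 + t / 4 * pseries a t n)
    @ \oo --> t * psum a2 t + 2 * beta * psum a1 t + t / 4 * psum a t.
  apply: cvgD; first apply: cvgD.
  - by apply: cvgM; [exact: cvg_cst|exact: cvg_psum].
  - apply: cvgM; [exact: cvg_cst|].
    by have := @cvg_psum _ _ t ba1; rewrite -cvg_shiftS.
  - by apply: cvgM; [exact: cvg_cst|exact: cvg_psum].
have e0 : (fun n => t * pseries a2 t n + 2 * beta * pseries a1 t n.+1 + t / 4 * pseries a t n)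
   = cst 0 by apply/funext => n; rewrite part.
rewrite e0 in c0.
by move/(cvg_lim (@norm_hausdorff _ R)): c0; rewrite lim_cst //; exact: norm_hausdorff.
Qed.

(* Z = U - 2 i U', which turns the equation for U into [besselZ_ode] *)
Definition besselZ t : R[i] := psum a t +i* (- (2 * psum a1 t)).
Definition besselZ' t : R[i] := psum a1 t +i* (- (2 * psum a2 t)).

Lemma psum0 c : psum c 0 = c 0 :> R.
Proof.
rewrite /psum; apply: lim_near_cst => //.
near=> n; have n0 : (0 < n)%N by near: n; exact: nbhs_infty_gt.
rewrite /pseries /series /= -(prednK n0) big_nat_recl // expr0 mulr1 big1 ?addr0//.
by move=> i _; rewrite expr0n mulr0.
Unshelve. all: by end_near. Qed.

Lemma besselZ0 : besselZ 0 = 1.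
Proof. by rewrite /besselZ !psum0 /a1 /pseries_diffs /= mulr0 mulr0 oppr0. Qed.

(** Equivalently, for [t > 0], [t^beta Z(t)] solves [G' = (i / 2) G + (beta / t) conj G], the
    continuous counterpart of the averaged recursion in the variable [t = n ep]. *)
Lemma besselZ_ode t : t%:C * besselZ' t =
  'i%C * (t / 2)%:C * besselZ t - beta%:C * (besselZ t - conjc (besselZ t)).
Proof.
have e := bessel_ode t.
rewrite /besselZ /besselZ'; simpc; congr (_ +i* _); first by field.
have -> : t * (2 * psum a2 t) = 2 * (t * psum a2 t) by ring.
have -> : t * psum a2 t = - (2 * beta * psum a1 t) - t / 4 * psum a t by lra.
by field.
Qed.

Let nbound (x y C : R) : `|x| <= C -> `|y| <= C -> normc (x +i* (- (2 * y))) <= 3 * C.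
Proof.
move=> xC yC; apply: (le_trans (normc_le_ReIm _)).
by rewrite /= normrN normrM normr_nat; lra.
Qed.

Lemma besselZ_bound T t : `|t| <= T -> normc (besselZ t) <= 3 * expR T.
Proof.
move=> tT; apply: nbound; apply: (le_trans (fact_bounded_le _ _)) => //; by rewrite ler_expR.
Qed.

Lemma besselZ_lipschitz T x y : `|x| <= T -> `|y| <= T ->
  normc (besselZ x - besselZ y) <= 3 * expR T * `|x - y|.
Proof.
move=> xT yT; rewrite /besselZ -mulrA.
have -> : (psum a x +i* (- (2 * psum a1 x))) - (psum a y +i* (- (2 * psum a1 y))) =
  (psum a x - psum a y) +i* (- (2 * (psum a1 x - psum a1 y))) :> R[i].
  by simpc; congr (_ +i* _); ring.
by apply: nbound; exact: psum_lipschitz.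
Qed.

Lemma besselZ_taylor T x y : `|x| <= T -> `|y| <= T ->
  normc (besselZ x - besselZ y - (x - y)%:C * besselZ' x) <= 3 * expR T * (x - y) ^+ 2.
Proof.
move=> xT yT; rewrite /besselZ /besselZ' -mulrA.
have -> : (psum a x +i* (- (2 * psum a1 x))) - (psum a y +i* (- (2 * psum a1 y)))
    - (x - y)%:C * (psum a1 x +i* (- (2 * psum a2 x))) =
  (psum a x - psum a y - (x - y) * psum a1 x) +i*
  (- (2 * (psum a1 x - psum a1 y - (x - y) * psum a2 x))) :> R[i].
  by simpc; congr (_ +i* _); ring.
by apply: nbound; exact: psum_taylor.
Qed.

(** The squared modulus of [besselZ t]. *)
Let N t := psum a t ^+ 2 + (2 * psum a1 t) ^+ 2.

Let dN t : is_derive t (1 : R) N (2 * psum a t * psum a1 t + 8 * psum a1 t * psum a2 t).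
Proof.
have d0 := is_derive_psum t ba; have d1 := is_derive_psum t ba1.
rewrite (_ : N = psum a ^+ 2 + 4 \*: (psum a1 ^+ 2)); last first.
  by apply/funext => x; rewrite /N !fctE /= /GRing.scale /= /GRing.exp /=; ring.
apply: is_derive_eq; rewrite /GRing.scale /= !expr1; ring.
Qed.

Let tdN t : t * (2 * psum a t * psum a1 t + 8 * psum a1 t * psum a2 t) =
  - 16 * beta * psum a1 t ^+ 2.
Proof.
have e := bessel_ode t.
have -> : t * (2 * psum a t * psum a1 t + 8 * psum a1 t * psum a2 t) =
  8 * psum a1 t * (t * psum a2 t + 2 * beta * psum a1 t + t / 4 * psum a t)
  - 16 * beta * psum a1 t ^+ 2 by field.
by rewrite e; ring.
Qed.

Let dexpN (L t : R) : is_derive t (1 : R) (fun t => expR (L * t) * N t)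
  (expR (L * t) * (L * N t + (2 * psum a t * psum a1 t + 8 * psum a1 t * psum a2 t))).
Proof.
have d := dN t.
have e : is_derive t (1 : R) (fun t => expR (L * t)) (L * expR (L * t)).
  have l : is_derive t (1 : R) (fun t => L * t) L.
    rewrite (_ : (fun t => L * t) = L \*: id)//.
    by apply: is_derive_eq; rewrite /GRing.scale /= mulr1.
  have := is_derive1_comp (is_derive_expR (L * t)) l.
  by rewrite /comp /= => h; apply: is_derive_eq; rewrite mulrC.
have -> : (fun t => expR (L * t) * N t) = (fun t => expR (L * t)) * N by [].
by apply: is_derive_eq; rewrite /GRing.scale /=; ring.
Qed.

Let N_ge0 t : 0 <= N t. Proof. by rewrite addr_ge0 ?sqr_ge0. Qed.

Let N_near0 : exists2 t0, 0 < t0 & forall t, `|t| <= t0 -> 0 < N t.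
Proof.
have c : N x @[x --> (0 : R)] --> N 0.
  apply: differentiable_continuous; apply/derivable1_diffP; by have [] := dN 0.
have N0 : 0 < N 0.
  by rewrite /N !psum0 /a1 /pseries_diffs /= mulr0 mulr0 expr0n addr0 expr1n.
have : \forall t \near (0 : R), 0 < N t by exact: (cvgr_gt _ c _ N0).
move=> /nbhs_normP[e /= e0 he]; exists (e / 2); first by rewrite divr_gt0.
move=> t te; apply: he; rewrite /= sub0r normrN (le_lt_trans te)//.
by rewrite ltr_pdivrMr// ltr_pMr// ltr1n.
Qed.

(** By [tdN], [t N' = - 16 beta U'^2 >= - 4 beta N], so [N] decays at most like a power of [|t|].
    With [L = 4 * beta / t0], therefore, [expR (L * t) * N t] does not decrease for [t >= t0] and
    [expR (- L * t) * N t] does not increase for [t <= - t0]; positivity near 0 propagates. *)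
Lemma besselZ_neq0 t : besselZ t != 0.
Proof.
suff h : 0 < N t.
  apply: contraTneq h => /eqP; rewrite /besselZ eq_complex /= oppr_eq0.
  by move=> /andP[/eqP z1 /eqP z2]; rewrite /N z1 z2 expr0n addr0 ltxx.
have [t0 t00 h0] := N_near0.
have [|tt0] := leP `|t| t0; first exact: h0.
pose L := 4 * beta / t0.
have L0 : 0 < L by rewrite /L divr_gt0 // mulr_gt0.
have cont (K x y : R) : {within `[x, y], continuous (fun t => expR (K * t) * N t)}.
  apply: continuous_subspaceT => z; apply: differentiable_continuous.
  by apply/derivable1_diffP; have [] := dexpN K z.
have key (s : R) : t0 <= `|s| -> 0 <= s * (s * (L * N s)) -
    `|s| * (16 * beta * psum a1 s ^+ 2).
  move=> hs.
  have -> : s * (s * (L * N s)) = `|s| * (`|s| * L * N s).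
    by rewrite !mulrA -!expr2 real_normK ?num_real.
  rewrite -mulrBr mulr_ge0// subr_ge0.
  apply: (@le_trans _ _ (4 * beta * N s)).
    have -> : 4 * beta * N s = 4 * beta * psum a s ^+ 2 + 16 * beta * psum a1 s ^+ 2.
      by rewrite /N; ring.
    by rewrite lerDr mulr_ge0 ?sqr_ge0// mulr_ge0// ltW.
  rewrite ler_wpM2r // /L mulrCA ler_peMr ?mulr_ge0 ?(ltW beta_gt0)//.
  by rewrite ler_pdivlMr// mul1r.
have [t_ge|t_lt] := leP 0 t.
  rewrite ger0_norm // in tt0.
  have [s] := @MVT_segment R _ _ t0 t (ltW tt0) (fun z _ => dexpN L z) (cont L _ _).
  rewrite in_itv /= => /andP[s1 s2] e.
  have s0 : 0 < s by apply: lt_le_trans s1.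
  have k := key s; rewrite ger0_norm ?(ltW s0)// in k; have {}k := k s1.
  have N0 := h0 t0; rewrite ger0_norm ?(ltW t00)// in N0; have {}N0 := N0 (lexx _).
  have p1 := mulr_gt0 (expR_gt0 (L * t0)) N0.
  have ge : 0 <= L * N s + (2 * psum a s * psum a1 s + 8 * psum a1 s * psum a2 s).
    rewrite -(pmulr_rge0 _ s0) mulrDr tdN -(pmulr_rge0 _ s0).
    by have -> : s * (s * (L * N s) + - 16 * beta * psum a1 s ^+ 2) =
       s * (s * (L * N s)) - s * (16 * beta * psum a1 s ^+ 2) by ring.
  have p2 : 0 < expR (L * t) * N t.
    apply: (lt_le_trans p1); rewrite -subr_ge0 e mulr_ge0 ?mulr_ge0 ?expR_ge0//.
    by rewrite subr_ge0 ltW.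
  by rewrite pmulr_rgt0 ?expR_gt0 in p2.
rewrite ltr0_norm // in tt0.
have tt1 : t <= - t0 by lra.
have [s] := @MVT_segment R _ _ t (- t0) tt1 (fun z _ => dexpN (- L) z) (cont (- L) _ _).
rewrite in_itv /= => /andP[s1 s2] e.
have s0 : s < 0 by lra.
have k := key s; rewrite ltr0_norm // in k.
have {}k : 0 <= s * (s * (L * N s)) - - s * (16 * beta * psum a1 s ^+ 2).
  by apply: k; lra.
have N0 := h0 (- t0); rewrite normrN ger0_norm ?(ltW t00)// in N0; have {}N0 := N0 (lexx _).
have p1 := mulr_gt0 (expR_gt0 (- L * - t0)) N0.
have le : - L * N s + (2 * psum a s * psum a1 s + 8 * psum a1 s * psum a2 s) <= 0.
  rewrite -(nmulr_rge0 _ s0) mulrDr tdN -(nmulr_rle0 _ s0).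
  have -> : s * (s * (- L * N s) + - 16 * beta * psum a1 s ^+ 2) =
     - (s * (s * (L * N s)) - - s * (16 * beta * psum a1 s ^+ 2)) by ring.
  by rewrite oppr_le0.
have p2 : 0 < expR (- L * t) * N t.
  apply: (lt_le_trans p1); rewrite -subr_le0 e mulr_le0_ge0 ?mulr_ge0_le0 ?expR_ge0//.
  by rewrite subr_ge0.
by rewrite pmulr_rgt0 ?expR_gt0 in p2.
Qed.

End bessel.

(** * Power growth and the approximate solution of the averaged recursion *)

Section growth.
Context {R : realType}.
Variable beta : R.
Hypothesis beta_gt0 : 0 < beta.

(** The real solution, started at 1, of [G' = G + beta / (n + 2) * conj G]. Dividing by it, rather
    than by [n^beta], removes the growth without an error term. *)
Definition growth n : R := \prod_(0 <= j < n) (1 + beta / j.+2%:R).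

Lemma growthS n : growth n.+1 = growth n * (1 + beta / n.+2%:R).
Proof. by rewrite /growth big_nat_recr. Qed.

Lemma growth_factor n : 1 <= 1 + beta / n.+2%:R.
Proof. by rewrite lerDl divr_ge0 // ltW. Qed.

Lemma growth_ge1 n : 1 <= growth n.
Proof.
elim: n => [|n IH]; first by rewrite /growth big_geq.
by rewrite growthS -[leLHS]mulr1 ler_pM// growth_factor.
Qed.

Lemma growth_gt0 n : 0 < growth n.
Proof. exact: lt_le_trans (growth_ge1 n). Qed.

Lemma ln1D_ge (x : R) : 0 <= x -> x / (1 + x) <= ln (1 + x).
Proof.
move=> x0; have x1 : 0 < 1 + x by rewrite ltr_pwDl.
have := @le_ln1Dx R (- (x / (1 + x))) _.
have -> : 1 - x / (1 + x) = (1 + x)^-1 by field; rewrite gt_eqF.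
rewrite lnV ?posrE// lerN2; apply.
by rewrite ltrN2 ltr_pdivrMr// mul1r ltrDr.
Qed.

(** The logarithm [u n] of the quotient is nonincreasing because [ln (1 + beta / (n + 2)) <= beta /
    (n + 2) <= beta * ln (1 + 1 / (n + 1))], and it is bounded below because its decrements are at
    most a constant times [1 / ((n + 1) (n + 2))]. *)
Lemma growth_power : exists2 W : R, 0 < W &
  growth n / n.+1%:R `^ beta @[n --> \oo] --> W.
Proof.
pose u n : R := ln (growth n) - beta * ln n.+1%:R.
pose D n : R := (n.+1%:R * n.+2%:R)^-1.
have b0 := ltW beta_gt0.
have kk n : n.+2%:R / n.+1%:R = 1 + n.+1%:R^-1 :> R.
  by rewrite -(addn1 n.+1) natrD mulrDl mulfV ?pnatr_eq0// mul1r.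
have uS n : u n.+1 - u n = ln (1 + beta / n.+2%:R) - beta * ln (1 + n.+1%:R^-1).
  rewrite /u growthS lnM ?posrE ?growth_gt0 ?(lt_le_trans _ (growth_factor n))//.
  by rewrite -kk ln_div ?posrE ?ltr0Sn//; ring.
have DE n : n.+1%:R^-1 = n.+2%:R^-1 + D n :> R.
  have n1 : n.+1%:R != 0 :> R by rewrite pnatr_eq0.
  have n2 : n.+1%:R + 1 != 0 :> R by rewrite -(natrD _ _ 1) addn1 pnatr_eq0.
  by rewrite /D -(addn1 n.+1) natrD; move: (n.+1%:R) n1 n2 => x *; field; apply/andP.
have low n : - (beta ^+ 2 + beta) * D n <= u n.+1 - u n.
  rewrite uS.
  have k1 : beta / n.+2%:R - beta ^+ 2 * D n <= ln (1 + beta / n.+2%:R).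
    have x0 : 0 <= beta / n.+2%:R by rewrite divr_ge0.
    apply: le_trans (ln1D_ge x0).
    have xD : (beta / n.+2%:R) ^+ 2 <= beta ^+ 2 * D n.
      rewrite exprMn ler_wpM2l ?sqr_ge0// expr2 -invfM lef_pV2 ?posrE ?mulr_gt0 ?ltr0Sn//.
      by rewrite ler_pM2r ?ltr0Sn// ler_nat.
    move: (beta / n.+2%:R) x0 xD => x x0 xD.
    apply: (@le_trans _ _ (x - x ^+ 2)); first by lra.
    rewrite ler_pdivlMr ?ltr_pwDl//.
    have : 0 <= x * (x * x) by rewrite !mulr_ge0.
    by lra.
  have k2 : beta * ln (1 + n.+1%:R^-1) <= beta * n.+1%:R^-1.
    by rewrite ler_wpM2l// le_ln1Dx // (@lt_le_trans _ _ 0) ?ltrN10 ?invr_ge0.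
  have k3 : beta * n.+1%:R^-1 = beta * n.+2%:R^-1 + beta * D n by rewrite DE mulrDr.
  have k4 : beta * ln (1 + n.+1%:R^-1) <= beta * n.+2%:R^-1 + beta * D n by rewrite -k3.
  by move: k1 k4; move: (D n) (n.+2%:R^-1) (ln _) (beta * ln _) => d k L1 L2; lra.
have high n : u n.+1 - u n <= 0.
  rewrite uS subr_le0.
  have p0 : 0 <= beta / n.+2%:R by rewrite divr_ge0.
  have : ln (1 + beta / n.+2%:R) <= beta / n.+2%:R.
    by rewrite le_ln1Dx // (lt_le_trans _ p0) ?ltrN10.
  move=> h; apply: (le_trans h); rewrite ler_wpM2l//.
  have q0 : 0 <= n.+1%:R^-1 :> R by rewrite invr_ge0.
  apply: le_trans (ln1D_ge q0); rewrite -kk invf_div mulrA mulVf ?pnatr_eq0//.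
  by rewrite mul1r.
have lb n : u 0 - (beta ^+ 2 + beta) * \sum_(0 <= j < n) D j <= u n.
  elim: n => [|n IH]; first by rewrite big_geq // mulr0 subr0.
  by rewrite big_nat_recr //=; have := low n; lra.
have cu : cvgn u.
  apply: nonincreasing_is_cvgn.
    by apply/nonincreasing_seqP => n; rewrite -subr_le0.
  exists (u 0 - (beta ^+ 2 + beta)) => _ [n _ <-].
  apply: le_trans (lb n); rewrite lerD2l lerN2 -[leRHS]mulr1 ler_wpM2l ?addr_ge0 ?sqr_ge0//.
  by apply: (le_trans (sum_inv_le 0 n)); rewrite invr1.
exists (expR (limn u)); first exact: expR_gt0.
have -> : (fun n => growth n / n.+1%:R `^ beta) = expR \o u.
  apply/funext => n; rewrite /= /u expRB lnK ?posrE ?growth_gt0//.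
  by rewrite /powR pnatr_eq0.
by apply: continuous_cvg => //; exact: continuous_expR.
Qed.

Lemma growth_unbounded (A : R) : exists N, forall n, (N <= n)%N -> A <= growth n.
Proof.
have [W W0 cW] := growth_power.
have [N _ hN] : \forall n \near \oo, W / 2 < growth n / n.+1%:R `^ beta.
  by apply: (cvgr_gt _ cW); rewrite ltr_pdivrMr// ltr_pMr// ltr1n.
pose B := Num.max 1 (A / (W / 2)); have B1 : 1 <= B by rewrite le_max lexx.
pose M := Num.truncn (B `^ beta^-1).
exists (maxn N M) => n; rewrite geq_max => /andP[Nn Mn].
have := hN n Nn; rewrite /= ltr_pdivlMr ?powR_gt0 ?ltr0Sn// => /ltW; apply: le_trans.
have W2 : 0 < W / 2 by rewrite divr_gt0.
rewrite -ler_pdivrMl// mulrC; apply: (@le_trans _ _ B); first by rewrite le_max lexx orbT.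
have -> : B = (B `^ beta^-1) `^ beta.
  by rewrite -powRrM mulVf ?gt_eqF// powRr1// (le_trans _ B1).
apply: ge0_ler_powR; rewrite ?nnegrE ?powR_ge0 ?(ltW beta_gt0)//.
apply: (@le_trans _ _ M.+1%:R); last by rewrite ler_nat.
exact/ltW/truncnS_gt.
Qed.

End growth.

Section model.
Context {R : realType}.
Variable beta : R.
Hypothesis beta_gt0 : 0 < beta.
Local Notation w := (growth beta).

(** Increment of the averaged recursion after rotation by [conjc kappa], with [ep = - mu / Im z0].
    Because of the conjugation it is linear over the reals only. *)
Definition res_flow (ep : R) n (z : R[i]) : R[i] :=
  'i%C * (ep / 2)%:C * z + (beta / n.+2%:R)%:C * conjc z.

Definition model (ep : R) n : R[i] := (w n)%:C * besselZ beta (n.+1%:R * ep).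

Lemma normc_posreal (x : R) (z : R[i]) : 0 <= x -> normc (x%:C * z) = x * normc z.
Proof. by move=> x0; rewrite normcM normc_real ger0_norm. Qed.

Lemma model_bound ep T n : n.+1%:R * `|ep| <= T -> normc (model ep n) <= w n * (3 * expR T).
Proof.
move=> h; rewrite normc_posreal ?(ltW (growth_gt0 _ _))// ler_pM2l ?growth_gt0//.
by apply: besselZ_bound; rewrite // normrM normr_nat.
Qed.

(** At the later point [x = (n + 2) ep] the differential equation divided by [n + 2] gives
    [ep Z'(x)] exactly, and its term [- beta / (n + 2) * Z x] cancels the growth factor. What is
    left is the Taylor remainder and [Z x - Z y] multiplied by [ep / 2] or [beta / (n + 2)], all of
    second order. *)
Lemma model_step ep T n : n.+2%:R * `|ep| <= T ->
  normc (model ep n.+1 - model ep n - res_flow ep n (model ep n)) <=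
  w n * (3 * expR T * (2 + beta) * ((n.+1%:R * n.+2%:R)^-1 + ep ^+ 2)).
Proof.
move=> hT.
set x := n.+2%:R * ep; set y := n.+1%:R * ep.
have xT : `|x| <= T by rewrite normrM normr_nat.
have yT : `|y| <= T.
  by rewrite normrM normr_nat; apply: le_trans hT; rewrite ler_wpM2r// ler_nat.
have xy : x - y = ep by rewrite /x /y -mulrBl -natrB// subSnn mul1r.
have lip := besselZ_lipschitz beta_gt0 xT yT; have tay := besselZ_taylor beta_gt0 xT yT.
rewrite xy in lip tay.
have n2 : (n.+2%:R : R)%:C != 0 by exact: natc_neq0.
have ode := besselZ_ode beta_gt0 x.
set Z := besselZ beta in lip tay ode *; set Z' := besselZ' beta in tay ode.
have ode2 : ep%:C * Z' x = 'i%C * (ep / 2)%:C * Z x - (beta / n.+2%:R)%:C * (Z x - conjc (Z x)).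
  apply: (mulfI n2); rewrite mulrA -realcM -/x ode [RHS]mulrBr; congr (_ - _).
    rewrite /x !realcM !mulrA; congr (_ * _ * _); ring.
  by rewrite mulrA -(@realcM R) mulrCA mulfV ?pnatr_eq0// mulr1.
have -> : model ep n.+1 - model ep n - res_flow ep n (model ep n) =
  (w n)%:C * ((Z x - Z y - ep%:C * Z' x) + 'i%C * (ep / 2)%:C * (Z x - Z y)
    + (beta / n.+2%:R)%:C * conjc (Z x - Z y)).
  rewrite /model /res_flow growthS (@realcM R) (@realcD R) -/x -/y ode2 conjcM conjc_real conjcB.
  by rewrite -/Z; ring.
rewrite normc_posreal ?(ltW (growth_gt0 _ _))// ler_pM2l ?growth_gt0//.
apply: (le_trans (le_normcD _ _)).
have a1 := le_normcD (Z x - Z y - ep%:C * Z' x) ('i%C * (ep / 2)%:C * (Z x - Z y)).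
have a2 : normc ('i%C * (ep / 2)%:C * (Z x - Z y)) <= `|ep| / 2 * (3 * expR T * `|ep|).
  rewrite normcM (normcM 'i%C) normc_i mul1r normc_real normrM normfV normr_nat.
  by rewrite ler_wpM2l.
have a3 : normc ((beta / n.+2%:R)%:C * conjc (Z x - Z y)) <= beta * n.+2%:R^-1 * (3 * expR T * `|ep|).
  have b0 : 0 <= beta / n.+2%:R by rewrite divr_ge0 // ltW.
  by rewrite normc_posreal // normc_conj ler_wpM2l.
have E0 : 0 <= expR T := expR_ge0 T.
have b0 := ltW beta_gt0.
have D0 : 0 <= (n.+1%:R * n.+2%:R : R)^-1 by rewrite invr_ge0 mulr_ge0.
have k2 : (n.+2%:R^-1 : R) ^+ 2 <= (n.+1%:R * n.+2%:R)^-1.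
  by rewrite expr2 -invfM lef_pV2 ?posrE ?mulr_gt0 ?ltr0Sn// ler_pM2r ?ltr0Sn// ler_nat.
have am : n.+2%:R^-1 * `|ep| <= ((n.+1%:R * n.+2%:R)^-1 + ep ^+ 2) / 2.
  have := sqr_ge0 (n.+2%:R^-1 - `|ep|); rewrite sqrrB real_normK ?num_real//.
  move: (n.+2%:R^-1) ((n.+1%:R * n.+2%:R)^-1) (ep ^+ 2) `|ep| k2 => k D e a k2 h.
  by lra.
have ee : `|ep| * `|ep| = ep ^+ 2 by rewrite -expr2 real_normK ?num_real.
have m1 : beta * expR T * (n.+2%:R^-1 * `|ep|) <=
   beta * expR T * (((n.+1%:R * n.+2%:R)^-1 + ep ^+ 2) / 2).
  by rewrite ler_wpM2l // mulr_ge0.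
have m2 : 0 <= expR T * (n.+1%:R * n.+2%:R)^-1 by rewrite mulr_ge0.
have m3 : 0 <= expR T * ep ^+ 2 by rewrite mulr_ge0 ?sqr_ge0.
have m4 : 0 <= beta * (expR T * (n.+1%:R * n.+2%:R)^-1) by rewrite mulr_ge0.
have m5 : 0 <= beta * (expR T * ep ^+ 2) by rewrite mulr_ge0.
have a2' : normc ('i%C * (ep / 2)%:C * (Z x - Z y)) <= 3 / 2 * (expR T * ep ^+ 2).
  by rewrite -ee; apply: (le_trans a2); rewrite le_eqVlt; apply/orP; left; apply/eqP; field.
move: a1 a2' a3 tay m1 m2 m3 m4 m5; clear.
move: (n.+2%:R^-1) ((n.+1%:R * n.+2%:R)^-1) (ep ^+ 2) `|ep| (expR T) => k D e a E.
by move: (normc _) (normc _) (normc _) (normc _) => *; lra.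
Qed.

End model.

Section comparison.
Context {R : realType}.
Variable beta : R.
Hypothesis beta_gt0 : 0 < beta.
Local Notation w := (growth beta).

(** The detuning acts through [1 + i ep / 2], whose second summand is orthogonal to the first, so
    the modulus changes only at order [ep ^+ 2]. A term of order [ep] would not be negligible over
    [T / |ep|] steps. *)
Lemma res_flow_bound (ep : R) n z :
  normc (z + res_flow beta ep n z) <= (1 + beta / n.+2%:R + ep ^+ 2) * normc z.
Proof.
rewrite /res_flow addrA.
have -> : z + 'i%C * (ep / 2)%:C * z = (1 +i* (ep / 2)) * z.
  rewrite -[z in z + _]mul1r -mulrDl; congr (_ * _).
  by simpc; congr (_ +i* _).
apply: (le_trans (le_normcD _ _)).
have b0 : 0 <= beta / n.+2%:R by rewrite divr_ge0 // ltW.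
rewrite normcM (normc_posreal _ b0) normc_conj.
have : normc (1 +i* (ep / 2) : R[i]) <= 1 + ep ^+ 2.
  rewrite -ler_sqr ?nnegrE ?normc_ge0 ?addr_ge0 ?sqr_ge0// sqr_normcE /=.
  by have := sqr_ge0 ep; have := sqr_ge0 (ep ^+ 2); nra.
move=> h; rewrite -mulrDl ler_wpM2r ?normc_ge0//.
by rewrite [leRHS]addrAC lerD2r.
Qed.

Definition comp_err (ep : R) (p : nat -> R) j : R :=
  (j.+1%:R * j.+2%:R)^-1 + ep ^+ 2 + p j.

Lemma comp_err_ge0 ep p j : (forall j, 0 <= p j) -> 0 <= comp_err ep p j.
Proof. by move=> p0; rewrite /comp_err !addr_ge0 ?sqr_ge0 ?invr_ge0 ?mulr_ge0. Qed.

(** The difference from [K] times the model obeys the recursion up to the error of [h] and the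
    defect of the model. Dividing by [growth] removes the factor [1 + beta / (n + 2)], and
    [gronwall_affine] applies to the quotient. [K] is real because [res_flow] commutes with real
    factors only. *)
Lemma model_comparison (h : nat -> R[i]) (ep T K c : R) (p : nat -> R) (N M : nat) :
  (forall j, 0 <= p j) -> 0 <= c -> M.+1%:R * `|ep| <= T ->
  (forall n, (N <= n < M)%N ->
    normc (h n.+1 - h n - res_flow beta ep n (h n)) <= c * comp_err ep p n * normc (h n)) ->
  let d n := normc (h n - K%:C * model beta ep n) / w n in
  let C := `|K| * (3 * expR T) * (3 + beta) in
  forall n, (N <= n <= M)%N ->
  d n + C <= (d N + C) * expR ((1 + c) * \sum_(N <= j < n) comp_err ep p j).
Proof.
move=> p0 c0 hT hstep d C n Nn.
have b0 := ltW beta_gt0.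
have C0 : 0 <= C by rewrite /C !mulr_ge0 ?expR_ge0 ?addr_ge0.
have e0 j : 0 <= comp_err ep p j by exact: comp_err_ge0.
rewrite mulr_sumr.
apply: (@gronwall_affine _ d (fun j => (1 + c) * comp_err ep p j) N M C _ _ C0 _ n Nn).
- by move=> j; exact: (mulr_ge0 (addr_ge0 ler01 c0) (e0 j)).
- by move=> j; rewrite /d divr_ge0 ?normc_ge0 ?(ltW (growth_gt0 beta_gt0 _)).
move=> j /andP[Nj jM].
have jT : j.+2%:R * `|ep| <= T.
  by apply: le_trans hT; rewrite ler_wpM2r// ler_nat ltnS.
have jT1 : j.+1%:R * `|ep| <= T.
  by apply: le_trans jT; rewrite ler_wpM2r// ler_nat.
have hs := hstep j; rewrite Nj jM /= in hs; have {}hs := hs isT.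
have ms := model_step beta_gt0 jT.
have mb := model_bound beta_gt0 jT1.
set x := h j in hs *; set m := model beta ep j in ms mb *.
set m' := model beta ep j.+1 in ms *; set x' := h j.+1 in hs *.
rewrite /d -/m -/m' -/x -/x'.
set E := comp_err ep p j in hs *.
have E0 : 0 <= E by exact: e0.
have -> : x' - K%:C * m' = ((x - K%:C * m) + res_flow beta ep j (x - K%:C * m))
  + (x' - x - res_flow beta ep j x) - K%:C * (m' - m - res_flow beta ep j m).
  by rewrite /res_flow conjcB conjcM conjc_real; ring.
have w0 := growth_gt0 beta_gt0 j.
have g1 := growth_factor beta_gt0 j.
have a1 := le_normcB ((x - K%:C * m) + res_flow beta ep j (x - K%:C * m)
  + (x' - x - res_flow beta ep j x)) (K%:C * (m' - m - res_flow beta ep j m)).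
have a2 := le_normcD ((x - K%:C * m) + res_flow beta ep j (x - K%:C * m))
   (x' - x - res_flow beta ep j x).
have a3 := res_flow_bound ep j (x - K%:C * m).
have a4 : normc (K%:C * (m' - m - res_flow beta ep j m)) <=
   `|K| * (w j * (3 * expR T * (2 + beta) * E)).
  rewrite normcM normc_real ler_wpM2l//; apply: (le_trans ms).
  rewrite ler_wpM2l ?(ltW w0)// ler_wpM2l ?mulr_ge0 ?expR_ge0 ?addr_ge0//.
  by rewrite /E /comp_err lerDl.
have a5 : normc x <= normc (x - K%:C * m) + `|K| * (w j * (3 * expR T)).
  have := le_normcD (x - K%:C * m) (K%:C * m); rewrite subrK => /le_trans; apply.
  by rewrite lerD2l normcM normc_real ler_wpM2l.
have a6 : normc (x' - x - res_flow beta ep j x) <=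
  c * E * (normc (x - K%:C * m) + `|K| * (w j * (3 * expR T))).
  by apply: (le_trans hs); rewrite ler_wpM2l // mulr_ge0.
have dw : normc (x - K%:C * m) = d j * w j by rewrite /d -/m -/x mulfVK // gt_eqF.
have d0 : 0 <= d j by rewrite divr_ge0 ?normc_ge0// ltW.
rewrite -/(d j) growthS ler_pdivrMr ?mulr_gt0 ?(lt_le_trans _ g1)//.
rewrite dw in a3 a6.
have eE : ep ^+ 2 <= E.
  by rewrite /E /comp_err -addrA addrCA lerDl addr_ge0 ?p0// invr_ge0 mulr_ge0.
have q0 : 0 <= `|K| * (3 * expR T) by rewrite mulr_ge0 // mulr_ge0 ?expR_ge0.
apply: (le_trans a1); apply: (@le_trans _ _ ((1 + beta / j.+2%:R + E) * (d j * w j)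
  + c * E * (d j * w j + `|K| * (w j * (3 * expR T)))
  + `|K| * (w j * (3 * expR T * (2 + beta) * E)))).
  apply: lerD => //; apply: (le_trans a2); apply: lerD => //; apply: (le_trans a3).
  by apply: ler_wpM2r; [rewrite mulr_ge0 // ltW | rewrite lerD2l].
rewrite /C.
have -> : (1 + beta / j.+2%:R + E) * (d j * w j)
  + c * E * (d j * w j + `|K| * (w j * (3 * expR T)))
  + `|K| * (w j * (3 * expR T * (2 + beta) * E)) =
  ((1 + beta / j.+2%:R) * d j + (1 + c) * E * d j +
   `|K| * (3 * expR T) * (c + (2 + beta)) * E) * w j by ring.
rewrite [leRHS]mulrCA [leRHS]mulrC ler_pM2r//.
move: (1 + beta / j.+2%:R) g1 (`|K| * (3 * expR T)) q0 (d j) d0 => g g1 q q0 x0 x00.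
have u1 : (1 + c) * E * x0 <= g * ((1 + c) * E * x0).
  by rewrite ler_peMl// !mulr_ge0// addr_ge0.
have u2 : q * (3 + beta) * ((1 + c) * E) <= g * (q * (3 + beta) * ((1 + c) * E)).
  by rewrite ler_peMl// !mulr_ge0// addr_ge0.
have u3 : q * (c + (2 + beta)) * E <= q * (3 + beta) * ((1 + c) * E).
  have -> : q * (3 + beta) * ((1 + c) * E) = q * ((3 + beta) * (1 + c)) * E by ring.
  rewrite ler_wpM2r// ler_wpM2l//.
  by have := mulr_ge0 b0 c0; lra.
by lra.
Qed.

End comparison.

(** * The averaged recursion at zero detuning *)

Section zero_energy.
Context {R : realType}.
Variable beta : R.
Hypothesis beta_gt0 : 0 < beta.
Local Notation w := (growth beta).
Variables (h : nat -> R[i]) (e S : nat -> R) (N : nat).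
Hypothesis e_ge0 : forall n, 0 <= e n.
Hypothesis eS : forall m n, \sum_(m <= j < n) e j <= S m.
Hypothesis S0 : forall eta : R, 0 < eta -> exists n0, forall n, (n0 <= n)%N -> S n <= eta.
Hypothesis hstep : forall n, (N <= n)%N ->
  normc (h n.+1 - h n - (beta / n.+2%:R)%:C * conjc (h n)) <= e n * normc (h n).

Lemma growth_ndecr m n : (m <= n)%N -> w m <= w n.
Proof.
move=> mn; rewrite -(subnKC mn); elim: (n - m)%N => [|k IH]; first by rewrite addn0.
rewrite addnS growthS (le_trans IH)// ler_peMr ?growth_factor//.
exact: ltW (growth_gt0 beta_gt0 _).
Qed.

Let w0 n : 0 < w n. Proof. exact: growth_gt0. Qed.

Let S_ge0 n : 0 <= S n.
Proof. by apply: le_trans (eS n n); rewrite big_geq. Qed.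

Let A := normc (h N) / w N * expR (S N).

Let A_ge0 : 0 <= A.
Proof. by rewrite mulr_ge0 ?expR_ge0// divr_ge0 ?normc_ge0 ?(ltW (w0 _)). Qed.

Let amp n : (N <= n)%N -> normc (h n) <= A * w n.
Proof.
move=> Nn; rewrite -ler_pdivrMr//.
have gr := @gronwall_affine _ (fun n => normc (h n) / w n) e N n 0 e_ge0
  (fun j => divr_ge0 (normc_ge0 _) (ltW (w0 j))) (lexx _).
have := gr _ n; rewrite Nn leqnn !addr0 => H; apply: (le_trans (H _ isT)); last first.
  by rewrite ler_wpM2l ?ler_expR// divr_ge0 ?normc_ge0 ?(ltW (w0 _)).
move=> j /andP[Nj _]; rewrite mul0r addr0.
have g1 := growth_factor beta_gt0 j.
rewrite growthS ler_pdivrMr ?mulr_gt0 ?(lt_le_trans _ g1)//.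
have -> : (1 + e j) * (normc (h j) / w j) * (w j * (1 + beta / j.+2%:R)) =
  (1 + e j) * normc (h j) * (1 + beta / j.+2%:R).
  by move: (1 + e j) (normc _) (1 + beta / _) => x y z; field; rewrite gt_eqF.
have hs := hstep Nj.
have b0 : 0 <= beta / j.+2%:R by rewrite divr_ge0 // ltW.
have k1 := le_normcD (h j.+1 - h j - (beta / j.+2%:R)%:C * conjc (h j))
  (h j + (beta / j.+2%:R)%:C * conjc (h j)).
have k2 := le_normcD (h j) ((beta / j.+2%:R)%:C * conjc (h j)).
rewrite normc_posreal // normc_conj in k2.
have -> : h j.+1 = h j.+1 - h j - (beta / j.+2%:R)%:C * conjc (h j) +
  (h j + (beta / j.+2%:R)%:C * conjc (h j)) by ring.
have k3 : 0 <= e j * normc (h j) * (beta / j.+2%:R).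
  exact: (mulr_ge0 (mulr_ge0 (e_ge0 j) (normc_ge0 _)) b0).
move: k1 k2 k3 hs; move: (beta / _) (normc (h j)) => b H1; move: (normc _) (normc _) (normc _).
by move=> *; lra.
Qed.

(** Conjugation separates the coordinates: the real part is multiplied by [1 + beta / (n + 2)] and
    the imaginary part by [1 - beta / (n + 2)], which does not expand once [beta <= n + 2]. *)
Let ReIm n : (N <= n)%N ->
  `|Re (h n.+1) / w n.+1 - Re (h n) / w n| <= A * e n /\
  (beta <= n.+2%:R -> `|Im (h n.+1)| <= `|Im (h n)| + A * e n * w n).
Proof.
move=> Nn; have hs := hstep Nn.
set r := h n.+1 - h n - _ in hs.
have hE : h n.+1 = h n + (beta / n.+2%:R)%:C * conjc (h n) + r by rewrite /r; ring.
have rE : Re (h n.+1) = (1 + beta / n.+2%:R) * Re (h n) + Re r.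
  by rewrite hE; case: (h n) => x y; case: (r) => x' y' /=; ring.
have iE : Im (h n.+1) = (1 - beta / n.+2%:R) * Im (h n) + Im r.
  by rewrite hE; case: (h n) => x y; case: (r) => x' y' /=; ring.
have rb : normc r <= A * e n * w n.
  by apply: (le_trans hs); rewrite -mulrA mulrCA ler_wpM2l// amp.
have g1 := growth_factor beta_gt0 n; have g0 := lt_le_trans (ltr01 : 0 < 1 :> R) g1.
split.
  rewrite rE growthS.
  have -> : ((1 + beta / n.+2%:R) * Re (h n) + Re r) / (w n * (1 + beta / n.+2%:R)) -
     Re (h n) / w n = Re r / (w n * (1 + beta / n.+2%:R)).
    by move: (1 + _) g0 => g g0; field; rewrite !gt_eqF.
  rewrite normrM normfV (gtr0_norm (mulr_gt0 (w0 n) g0)) ler_pdivrMr ?mulr_gt0//.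
  apply: (le_trans (normcRe _)); apply: (le_trans rb).
  apply: (ler_wpM2l (mulr_ge0 A_ge0 (e_ge0 n))); rewrite ler_peMr//; exact: ltW.
move=> bn; rewrite iE; apply: (le_trans (ler_normD _ _)); apply: lerD; last first.
  by apply: le_trans rb; exact: normcIm.
rewrite normrM ler_piMl// ler_norml.
have : beta / n.+2%:R <= 1 by rewrite ler_pdivrMr ?ltr0Sn// mul1r.
have : 0 <= beta / n.+2%:R by rewrite divr_ge0 // ltW.
by move: (beta / _) => x x0 x1; apply/andP; split; lra.
Qed.

(** The growing direction is the real one, so [h n / w n] has a real limit [K]. The first clause is
    quantitative so that [K] can be shown positive for a solution with suitable data at [N]. *)
Lemma zero_energy_limit : exists2 K : R,
  `|K - Re (h N) / w N| <= normc (h N) / w N * expR (S N) * S N &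
  forall eta, 0 < eta -> exists n0, forall n, (n0 <= n)%N ->
    normc (h n - (K * w n)%:C) / w n <= eta.
Proof.
pose u n := Re (h (N + n)%N) / w (N + n)%N.
pose E n := \sum_(N <= j < N + n) e j.
have uS n : `|u n.+1 - u n| <= A * e (N + n)%N.
  by rewrite /u addnS; exact: (ReIm (leq_addr n N)).1.
have ES n : E n.+1 = E n + e (N + n)%N by rewrite /E addnS big_nat_recr ?leq_addr.
have Eb n : E n <= S N by exact: eS.
have uE n m : `|u (n + m)%N - u n| <= A * (E (n + m)%N - E n).
  elim: m => [|m IH]; first by rewrite addn0 !subrr normr0 mulr0.
  rewrite addnS ES.
  have := ler_normD (u (n + m).+1 - u (n + m)%N) (u (n + m)%N - u n).
  rewrite addrA subrK => /le_trans; apply.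
  by have := uS (n + m)%N; lra.
have cE : cvgn E.
  apply: nondecreasing_is_cvgn.
    by apply/nondecreasing_seqP => n; rewrite ES lerDl.
  by exists (S N) => _ [n _ <-].
(* The increments of [u] are dominated by those of [A * E], so [u + A * E] is monotone; subtracting
   the convergent [A * E] gives convergence of [u]. *)
have cv : cvgn (fun n => u n + A * E n).
  apply: nondecreasing_is_cvgn.
    apply/nondecreasing_seqP => n; rewrite ES.
    by have := uS n; rewrite ler_norml; lra.
  exists (`|u 0| + A * S N + A * S N) => _ [n _ <-].
  have := uE 0 n; rewrite add0n => h1.
  have h2 := ler_norm (u n - u 0); have h3 := ler_norm (u 0).
  have h4 : A * E n <= A * S N by rewrite ler_wpM2l.
  have h5 : 0 <= A * E 0 by rewrite mulr_ge0 // sumr_ge0.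
  by lra.
have cu : cvgn u.
  have -> : u = (fun n => u n + A * E n) - (fun n => A * E n).
    by apply/funext => n; rewrite !fctE; ring.
  apply: is_cvgB => //; apply: is_cvgM => //; exact: is_cvg_cst.
exists (limn u).
  have c1 : `|u n - u 0| @[n --> \oo] --> `|limn u - u 0|.
    by apply: cvg_norm; apply: cvgB => //; exact: cvg_cst.
  rewrite [X in `|_ - X|](_ : _ = u 0); last by rewrite /u addn0.
  rewrite -(cvg_lim (@norm_hausdorff _ R) c1).
  apply: limr_le; first by apply: cvgP c1.
  near=> n; have := uE 0 n; rewrite add0n => /le_trans; apply.
  rewrite -/A ler_wpM2l//; apply: (le_trans _ (Eb n)); rewrite gerBl.
  exact: sumr_ge0.
move=> eta eta0.
have A1 : 0 < A + 1 by rewrite ltr_pwDr.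
have [n1 hn1] := S0 (divr_gt0 (divr_gt0 eta0 (ltr0Sn R 2)) A1).
have [n2 _ hn2] : \forall n \near \oo, `|limn u - u n| < eta / 3.
  by move/cvgrPdist_lt : cu; apply; rewrite divr_gt0.
(* Beyond [M] the imaginary part no longer expands and the tail sum of [e] is small; it is therefore
   at most a constant plus a small multiple of [w n], and [w] is unbounded. *)
pose M := maxn (maxn N n1) (Num.truncn beta).+1.
have NM : (N <= M)%N by rewrite /M !leq_max leqnn.
have n1M : (n1 <= M)%N by rewrite /M !leq_max leqnn orbT.
have bM n : (M <= n)%N -> beta <= n.+2%:R.
  move=> Mn; apply: (@le_trans _ _ (Num.truncn beta).+1%:R); first exact/ltW/truncnS_gt.
  rewrite ler_nat; apply: (@leq_trans M); first by rewrite /M leq_max leqnn orbT.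
  by apply: (leq_trans Mn); rewrite -addn2 leq_addr.
have imb n : `|Im (h (M + n)%N)| <= `|Im (h M)| + A * (\sum_(M <= j < M + n) e j) * w (M + n)%N.
  elim: n => [|n IH]; first by rewrite addn0 big_geq // mulr0 mul0r addr0.
  have [_ k] := ReIm (leq_trans NM (leq_addr n M)).
  have {}k := k (bM _ (leq_addr n M)).
  rewrite addnS big_nat_recr ?leq_addr //=; apply: (le_trans k).
  have wle : w (M + n)%N <= w (M + n).+1 by apply: growth_ndecr.
  have s0 : 0 <= \sum_(M <= j < M + n) e j by apply: sumr_ge0.
  have t1 : A * (\sum_(M <= j < M + n) e j) * w (M + n)%N <=
     A * (\sum_(M <= j < M + n) e j) * w (M + n).+1 by rewrite ler_wpM2l // mulr_ge0.
  have t2 : A * e (M + n)%N * w (M + n)%N <= A * e (M + n)%N * w (M + n).+1.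
    by rewrite ler_wpM2l // mulr_ge0.
  by lra.
clearbody M.
have [n3 hn3] := growth_unbounded beta_gt0 (`|Im (h M)| / (eta / 3)).
exists (maxn (maxn M n3) (N + n2)) => n; rewrite !geq_max => /andP[/andP[Mn n3n] n2n].
rewrite ler_pdivrMr//; apply: (le_trans (normc_le_ReIm _)).
have -> : Re (h n - (limn u * w n)%:C) = Re (h n) - limn u * w n.
  by case: (h n) => x y.
have -> : Im (h n - (limn u * w n)%:C) = Im (h n).
  by case: (h n) => x y /=; rewrite subr0.
have i1 : `|Im (h n)| <= 2 / 3 * eta * w n.
  have := imb (n - M)%N; rewrite subnKC // => /le_trans; apply.
  have := hn3 n n3n; rewrite ler_pdivrMr ?divr_gt0// => k1.
  have k2 : A * \sum_(M <= j < n) e j <= eta / 3.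
    have k3 : \sum_(M <= j < n) e j <= eta / 3 / (A + 1) by apply: (le_trans (eS _ _)); exact: hn1.
    apply: (@le_trans _ _ (A * (eta / 3 / (A + 1)))); first by rewrite ler_wpM2l.
    rewrite mulrCA ler_piMr ?divr_ge0 ?(ltW eta0)// ler_pdivrMr// mul1r lerDl//.
  have k4 := w0 n.
  have k5 : A * (\sum_(M <= j < n) e j) * w n <= eta / 3 * w n by rewrite ler_wpM2r // ltW.
  by lra.
have r1 : `|Re (h n) - limn u * w n| <= eta / 3 * w n.
  have Nn := leq_trans NM Mn.
  have := hn2 (n - N)%N; rewrite /= leq_subRL// => /(_ n2n).
  rewrite /u subnKC // => /ltW k.
  have -> : Re (h n) - limn u * w n = - (limn u - Re (h n) / w n) * w n.
    by field; rewrite gt_eqF.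
  by rewrite normrM normrN (gtr0_norm (w0 n)) ler_wpM2r// ltW.
by lra.
Unshelve. all: by end_near. Qed.

End zero_energy.

(** * Amplitude of the solutions near the critical energy *)

Section near_frame.
Context {R : realType}.
Variable z0 : R[i].
Hypothesis z0_unit : z0 * conjc z0 = 1.
Hypothesis z0_im : Im z0 != 0.
Hypothesis z0_re : Re z0 != 0.

Let ReIm1 : Re z0 ^+ 2 + Im z0 ^+ 2 = 1.
Proof. by rewrite -sqr_normcE (normc_unit z0_unit) expr1n. Qed.

Let dist1 : 0 < normc (1 - z0 ^+ 2).
Proof.
rewrite lt_def normc_ge0 andbT; apply/negP => /eqP/eq0_normc/eqP.
rewrite subr_eq0; case: (z0) z0_im z0_re => x t /= t0 x0.
rewrite eq_complex /= => /andP[_ /eqP]; apply/eqP; rewrite eq_sym.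
by rewrite (mulrC t) -mulr2n mulrn_eq0 /= mulf_neq0.
Qed.

Let dist2 : 0 < normc (1 - z0 ^+ 2 * z0 ^+ 2).
Proof.
rewrite lt_def normc_ge0 andbT; apply/negP => /eqP/eq0_normc/eqP.
rewrite subr_eq0; case: (z0) z0_im z0_re ReIm1 => x t /= t0 x0 xt.
rewrite eq_complex /= => /andP[/eqP h _].
have : x ^+ 2 * t ^+ 2 = 0 by nra.
by apply/eqP; rewrite mulf_neq0 ?expf_neq0.
Qed.

(** On the unit circle, [Re z0] and [Im z0] are both nonzero exactly when [z0 ^+ 4 != 1]; so the
    frequencies other than the resonant one keep away from 1. *)
Lemma res_dist : exists2 d : R, 0 < d & forall u, u \in [:: z0 ^+ 2; conjc z0 ^+ 2;
    conjc z0 ^+ 2 * conjc z0 ^+ 2] -> d <= normc (1 - conjc u).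
Proof.
exists (Num.min (normc (1 - z0 ^+ 2)) (normc (1 - z0 ^+ 2 * z0 ^+ 2))).
  by rewrite lt_min dist1 dist2.
move=> u; rewrite !inE => /or3P[] /eqP ->.
- have -> : 1 - conjc (z0 ^+ 2) = conjc (1 - z0 ^+ 2) by rewrite conjcB conjc1.
  by rewrite normc_conj ge_min lexx.
- by rewrite conjcX conjcK ge_min lexx.
- by rewrite conjcM conjcX conjcK ge_min lexx orbT.
Qed.

(** [ze] is the unit number with real part [Re z0 + mu / 2] on the same side of the real axis as
    [z0], hence close to [z0]. The resonant distance factors as [|z0 - ze| * |z0 + ze|], at least
    [|mu| / 2] times [|Im z0|] by the real part of the first and the imaginary part of the second.
    The other three distances are bounded below, and [r] is small enough for [|Im z0| / 2 * |mu|]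
    not to exceed them. *)
Lemma near_frame : exists2 r : R, 0 < r & forall mu, 0 < `|mu| < r ->
  exists ze : R[i], [/\ ze * conjc ze = 1, 2 * Re z0 + mu = 2 * Re ze,
    `|Im z0| / 2 <= `|Im ze|,
    forall u, u \in [:: z0 ^+ 2; conjc z0 ^+ 2;
      z0 ^+ 2 * conjc ze ^+ 2; conjc z0 ^+ 2 * conjc ze ^+ 2] ->
    `|Im z0| / 2 * `|mu| <= normc (1 - conjc u) & `|2 * Re z0 + mu| <= 2].
Proof.
set s := `|Im z0|; have s_gt0 : 0 < s by rewrite normr_gt0.
pose d1 := normc (1 - z0 ^+ 2); pose d2 := normc (1 - z0 ^+ 2 * z0 ^+ 2).
have s1 : s <= 1.
  rewrite -ler_sqr ?nnegrE ?(ltW s_gt0)// real_normK ?num_real// expr1n -ReIm1.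
  by rewrite lerDr sqr_ge0.
pose r := Num.min (Num.min (s ^+ 2 / 4) d1) (s * d2 / 8).
have r0 : 0 < r.
  by rewrite /r !lt_min dist1 !divr_gt0 ?mulr_gt0 ?exprn_gt0 ?dist2.
exists r => // mu /andP[mu0]; rewrite /r !lt_min => /andP[/andP[mu1 mu2] mu3].
pose c := Re z0 + mu / 2.
have cs : (1 - c ^+ 2) - Im z0 ^+ 2 = - mu * (Re z0 + mu / 4).
  have -> : Im z0 ^+ 2 = 1 - Re z0 ^+ 2 by move: ReIm1; lra.
  by rewrite /c; field.
have re1 : `|Re z0| <= 1.
  rewrite -ler_sqr ?nnegrE// real_normK ?num_real// expr1n -ReIm1.
  by rewrite lerDl sqr_ge0.
have mle : `|mu| <= 1 / 4.
  by apply: (le_trans (ltW mu1)); rewrite ler_pM2r ?invr_gt0// exprn_ile1 ?s1 ?(ltW s_gt0).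
have csb : `|(1 - c ^+ 2) - Im z0 ^+ 2| <= 2 * `|mu|.
  rewrite cs normrM normrN mulrC ler_wpM2r//.
  apply: (le_trans (ler_normD _ _)); rewrite normrM normfV normr_nat; lra.
have sE : s ^+ 2 = Im z0 ^+ 2 by rewrite real_normK ?num_real.
have c0 : 0 < 1 - c ^+ 2.
  by move: csb; rewrite ler_norml -sE => /andP[]; have := exprn_gt0 2 s_gt0; lra.
pose t := Num.sg (Im z0) * Num.sqrt (1 - c ^+ 2).
have tE : t ^+ 2 = 1 - c ^+ 2.
  by rewrite /t exprMn sqr_sg z0_im mul1r sqr_sqrtr// ltW.
have tabs : `|t| = Num.sqrt (1 - c ^+ 2).
  by rewrite /t normrM normr_sg z0_im mul1r ger0_norm ?sqrtr_ge0.
have sum_abs : s <= `|t + Im z0|.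
  have -> : t + Im z0 = Num.sg (Im z0) * (Num.sqrt (1 - c ^+ 2) + s).
    by rewrite mulrDr /t /s -numEsg.
  rewrite normrM normr_sg z0_im mul1r ger0_norm ?addr_ge0 ?sqrtr_ge0 ?(ltW s_gt0)//.
  by rewrite lerDr sqrtr_ge0.
have tdiff : s * `|t - Im z0| <= 2 * `|mu|.
  apply: le_trans csb; rewrite -tE subr_sqr normrM [leRHS]mulrC.
  by rewrite ler_wpM2r.
exists (c +i* t); split.
- by simpc; rewrite -!expr2 tE; congr (_ +i* _); ring.
- by rewrite /= /c; field.
- have h1 : `|t - Im z0| <= s / 2.
    rewrite -(ler_pM2l s_gt0); apply: (le_trans tdiff); move: (ltW mu1); lra.
  have := ler_normB t (t - Im z0); rewrite opprB addrC subrK -/s /=; lra.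
- have zb : s * normc (c +i* t - z0) <= s * (`|mu| / 2) + 2 * `|mu|.
    apply: (@le_trans _ _ (s * (`|mu| / 2 + `|t - Im z0|))).
      rewrite ler_pM2l//; apply: (le_trans (normc_le_ReIm _)).
      have -> : Re (c +i* t - z0) = mu / 2 by rewrite /c; case: (z0) => x y /=; ring.
      have -> : Im (c +i* t - z0) = t - Im z0 by case: (z0) => x y /=.
      by rewrite normrM normfV normr_nat.
    by rewrite mulrDr lerD2l.
  have zu : normc (c +i* t) = 1.
    apply/eqP; rewrite -sqrp_eq1 ?normc_ge0// sqr_normcE /= tE; apply/eqP; ring.
  have z0u := normc_unit z0_unit.
  have a1 : s / 2 * `|mu| <= d1 by nra.
  move=> u; rewrite !inE => /or4P[] /eqP ->.
  + have -> : 1 - conjc (z0 ^+ 2) = conjc (1 - z0 ^+ 2) by rewrite conjcB conjc1.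
    by rewrite normc_conj.
  + by rewrite conjcX conjcK.
  + rewrite conjcM !conjcX conjcK.
    have -> : 1 - conjc z0 ^+ 2 * (c +i* t) ^+ 2 =
       conjc z0 ^+ 2 * ((z0 - (c +i* t)) * (z0 + (c +i* t))).
      have e : conjc z0 ^+ 2 * z0 ^+ 2 = 1 by rewrite -exprMn mulrC z0_unit expr1n.
      by rewrite -[in LHS]e; ring.
    rewrite normcM (normcM (z0 - _)) normcX normc_conj z0u expr1n mul1r.
    have -> : s / 2 * `|mu| = `|mu| / 2 * s by ring.
    apply: ler_pM; rewrite ?divr_ge0 ?(ltW s_gt0)//.
    * apply: le_trans (normcRe _).
      have -> : Re (z0 - (c +i* t)) = - (mu / 2) by rewrite /c; case: (z0) => x y /=; ring.
      by rewrite normrN normrM normfV normr_nat.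
    * apply: le_trans (normcIm _).
      by have -> : Im (z0 + (c +i* t)) = t + Im z0 by case: (z0) => x y /=; rewrite addrC.
  + rewrite conjcM !conjcX !conjcK.
    have e : 1 - z0 ^+ 2 * z0 ^+ 2 = (1 - z0 ^+ 2 * (c +i* t) ^+ 2) +
       z0 ^+ 2 * ((c +i* t - z0) * (c +i* t + z0)) by ring.
    have := le_normcD (1 - z0 ^+ 2 * (c +i* t) ^+ 2) (z0 ^+ 2 * ((c +i* t - z0) * (c +i* t + z0))).
    rewrite -e -/d2 (normcM (z0 ^+ 2)) (normcM (_ - z0)) normcX z0u expr1n mul1r.
    have zs : normc (c +i* t + z0) <= 2.
      by apply: (le_trans (le_normcD _ _)); rewrite zu z0u.
    have d20 : 0 < d2 by exact: dist2.
    have z1 : normc (c +i* t - z0) <= 5 / 16 * d2.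
      rewrite -(ler_pM2l s_gt0); apply: (le_trans zb).
      have : s * (`|mu| / 2) <= `|mu| / 2 by rewrite ler_piMl// divr_ge0.
      by move: (ltW mu3); rewrite -/d2; lra.
    have z2 : normc (c +i* t - z0) * normc (c +i* t + z0) <= 5 / 16 * d2 * 2.
      by apply: ler_pM; rewrite ?normc_ge0.
    have z3 : s / 2 * `|mu| <= 1 / 16 * d2.
      have : s * `|mu| <= `|mu| by rewrite ler_piMl.
      have : s * d2 <= d2 by rewrite ler_piMl// ltW.
      by move: (ltW mu3); rewrite -/d2; lra.
    move: z2 z3; move: (normc (1 - z0 ^+ 2 * _)) (normc _ * normc _) => X Y; lra.
- have -> : 2 * Re z0 + mu = 2 * c by rewrite /c; field.
  rewrite normrM normr_nat ger_pMr//.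
  by rewrite -ler_sqr ?nnegrE// real_normK ?num_real// expr1n; lra.
Qed.

End near_frame.

Section amplitude.
Context {R : realType}.
Variables (z0 kappa : R[i]) (beta : R) (q Q : nat -> R).
Hypothesis z0_unit : z0 * conjc z0 = 1.
Hypothesis kappa_unit : kappa * conjc kappa = 1.
Hypothesis z0_im : Im z0 != 0.
Hypothesis z0_re : Re z0 != 0.
Hypothesis beta_gt0 : 0 < beta.
Hypothesis qQ : forall N n, \sum_(N <= j < n) `|q j.+1| <= Q N.
Hypothesis Q0 : forall eta : R, 0 < eta -> exists n0, forall n, (n0 <= n)%N -> Q n <= eta.
Variable y : R -> nat -> R.
Hypothesis ysol : forall mu, solves (y mu) (resonant_potential z0 kappa beta q) (2 * Re z0 + mu).
Hypothesis y_neq0 : forall mu n, (y mu n != 0) || (y mu n.+1 != 0).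
Hypothesis y_cont : forall n, continuous (fun mu => y mu n).

Definition energy mu n : R :=
  y mu n.+1 ^+ 2 - (2 * Re z0 + mu) * y mu n.+1 * y mu n + y mu n ^+ 2.

Definition amp mu n : R := Num.sqrt (energy mu n).

Lemma amp_ge0 mu n : 0 <= amp mu n. Proof. exact: sqrtr_ge0. Qed.

Lemma amp_frame ze mu n : ze * conjc ze = 1 -> 2 * Re z0 + mu = 2 * Re ze ->
  amp mu n = normc (frame ze (y mu) n).
Proof.
move=> zu zr; rewrite /amp /energy zr -frame_energy// sqrtr_sqr ger0_norm//.
exact: normc_ge0.
Qed.

Lemma amp_gt0 ze mu n : ze * conjc ze = 1 -> 2 * Re z0 + mu = 2 * Re ze ->
  Im ze != 0 -> 0 < amp mu n.
Proof.
move=> zu zr zi; rewrite (amp_frame n zu zr) lt_def normc_ge0 andbT.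
apply/negP => /eqP/eq0_normc/eqP; rewrite /frame mulf_eq0 expf_eq0 /=.
have -> : (conjc ze == 0) = false.
  apply/negP => /eqP e; move: zu; rewrite e mulr0 => /eqP; by rewrite eq_sym oner_eq0.
rewrite orbF subr_eq0 => /eqP e.
have e2 : y mu n = 0.
  have : Im (y mu n.+1)%:C = Im (conjc ze * (y mu n)%:C) by rewrite e.
  case: (ze) zi => a b /= b0; rewrite mulr0 add0r => /esym/eqP.
  by rewrite mulf_eq0 oppr_eq0 (negbTE b0) /= => /eqP.
have e1 : y mu n.+1 = 0.
  by apply/eqP; rewrite -(@realc_eq0 R) e e2 mulr0.
by have := y_neq0 mu n; rewrite e1 e2 eqxx.
Qed.

Let Q_ge0 n : 0 <= Q n.
Proof. by apply: le_trans (qQ n n); rewrite big_geq. Qed.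

(** [frame_tail] in the frame of [near_frame], whose modulus is [amp], with [d] proportional to
    [|mu|]. What matters is that [C] does not depend on [mu]. *)
Lemma amp_tail : exists r C : R, [/\ 0 < r, 0 < C & forall mu, 0 < `|mu| < r ->
  (forall n, 0 < amp mu n) /\
  forall N n, (N <= n)%N -> C * ((`|mu| * N.+1%:R)^-1 + Q N) <= 1 / 2 ->
    `|amp mu n - amp mu N| <= C * ((`|mu| * N.+1%:R)^-1 + Q N) * amp mu N].
Proof.
have [r r0 H] := near_frame z0_unit z0_im z0_re.
set s := `|Im z0| in H; have s0 : 0 < s by rewrite normr_gt0.
have s1 : s <= 1.
  apply: (le_trans (normcIm z0)); by rewrite (normc_unit z0_unit).
have s2 : 0 < s / 2 by rewrite divr_gt0.
have C10 : 0 < tail_const z0 beta (s / 2).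
  have a0 : 0 <= amplitude z0 beta (s / 2).
    by rewrite /amplitude -/s divr_ge0 ?mulr_ge0 ?(ltW s0) ?(ltW beta_gt0) ?(ltW s2).
  rewrite /tail_const; apply: ltr_wpDl; last by rewrite divr_gt0.
  by move: (amplitude _ _ _) a0 => A a0; have := sqr_ge0 A; lra.
pose C := 7 * tail_const z0 beta (s / 2) * (s / 2)^-1.
exists r, C; split => //; first by rewrite /C !mulr_gt0 ?invr_gt0.
move=> mu mur; have /andP[mu0 _] := mur.
have [ze [zu zr zi zd _]] := H mu mur.
have zi0 : Im ze != 0 by rewrite -normr_gt0 (lt_le_trans _ zi).
split; first by move=> n; exact: amp_gt0 zu zr zi0.
move=> N n Nn small.
rewrite !(amp_frame _ zu zr).
have d0 : 0 < s / 2 * `|mu| by rewrite mulr_gt0.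
have le1 : tail_const z0 beta (s / 2) * ((s / 2 * `|mu| * N.+1%:R)^-1 + Q N) <=
  tail_const z0 beta (s / 2) * ((s / 2)^-1 * ((`|mu| * N.+1%:R)^-1 + Q N)).
  rewrite ler_pM2l// mulrDr -invfM mulrA lerD2l ler_peMl//.
  by rewrite invf_div ler_pdivlMr// mul1r; lra.
have m0 : 0 <= tail_const z0 beta (s / 2) * ((s / 2)^-1 * ((`|mu| * N.+1%:R)^-1 + Q N)).
  rewrite mulr_ge0 ?(ltW C10)// mulr_ge0 ?invr_ge0 ?(ltW s2)//.
  by rewrite addr_ge0// invr_ge0 mulr_ge0.
have CE : C * ((`|mu| * N.+1%:R)^-1 + Q N) =
  7 * (tail_const z0 beta (s / 2) * ((s / 2)^-1 * ((`|mu| * N.+1%:R)^-1 + Q N))).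
  by rewrite /C !mulrA.
rewrite CE in small *.
have := frame_tail z0_unit kappa_unit beta_gt0 qQ zu s2 zi d0 zd zr (ysol mu) Nn.
move=> /(_ _) ft; have {}ft := ft (le_trans le1 _).
have sm : tail_const z0 beta (s / 2) * ((s / 2)^-1 * ((`|mu| * N.+1%:R)^-1 + Q N)) <= 1 / 2.
  by move: small m0; move: (tail_const _ _ _ * _) => X; lra.
have {}ft := ft sm.
apply: (le_trans (normc_dist _ _)); apply: (le_trans ft).
by rewrite ler_wpM2r ?normc_ge0// -mulrA ler_pM2l.
Qed.

Lemma amp_cont n : continuous (fun mu => amp mu n).
Proof.
move=> mu; rewrite /amp; apply: continuous_comp; last exact: sqrt_continuous.
rewrite /energy; apply: cvgD; first apply: cvgB.
- by apply: (@continuous_comp _ _ _ (fun mu => y mu n.+1) (fun t => t ^+ 2));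
    [exact: y_cont|exact: exprn_continuous].
- apply: cvgM; last exact: y_cont.
  apply: cvgM; last exact: y_cont.
  by apply: cvgD; [exact: cvg_cst|exact: cvg_id].
- by apply: (@continuous_comp _ _ _ (fun mu => y mu n) (fun t => t ^+ 2));
    [exact: y_cont|exact: exprn_continuous].
Qed.

(** The Cauchy property comes from [amp_tail]. In the last clause energy and index vary together:
    this is the locally uniform convergence required by the density formula. The bounds of
    [amp_tail] are uniform for [|x| >= |mu| / 2], so continuity in the energy is used at one fixed
    large index [N] only. *)
Lemma amp_limit : exists2 r : R, 0 < r & exists a : R -> R,
  forall mu, 0 < `|mu| < r -> 0 < a mu /\
  (forall eta, 0 < eta -> exists n0, forall n, (n0 <= n)%N -> `|amp mu n - a mu| <= eta) /\
  forall eta, 0 < eta -> exists2 d, 0 < d & exists n0, forall x n, `|x - mu| < d ->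
    (n0 <= n)%N -> `|amp x n - a mu| <= eta.
Proof.
have [r [C [r0 C0 H]]] := amp_tail.
exists r => //.
pose X (mu : R) N := C * ((`|mu| * N.+1%:R)^-1 + Q N).
have Xsmall (m eta : R) : 0 < m -> 0 < eta -> exists n0, forall n, (n0 <= n)%N ->
    forall mu : R, m <= `|mu| -> X mu n <= eta.
  move=> m0 eta0.
  have e2 : 0 < eta / C / 2 by rewrite !divr_gt0.
  have [n1 h1] := Q0 e2.
  pose n2 := Num.truncn (m * (eta / C / 2))^-1.
  exists (maxn n1 n2) => n; rewrite geq_max => /andP[n1n n2n] mu mmu.
  rewrite /X -ler_pdivlMl// [leRHS]mulrC [leRHS]splitr; apply: lerD; last exact: h1.
  have p : 0 < m * (eta / C / 2) by rewrite mulr_gt0.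
  have q1 : (m * (eta / C / 2))^-1 <= n.+1%:R.
    apply: (@le_trans _ _ n2.+1%:R); last by rewrite ler_nat.
    exact/ltW/truncnS_gt.
  rewrite invf_ple; [|by rewrite posrE mulr_gt0// (lt_le_trans m0)|by rewrite posrE !divr_gt0].
  apply: (@le_trans _ _ (m * (m * (eta / C / 2))^-1)).
    by rewrite -{1}[m]invrK -[X in _ <= X]invfM mulKf // gt_eqF.
  by apply: ler_pM => //; rewrite ?invr_ge0 ltW.
have cauchy mu : 0 < `|mu| < r -> forall eta, 0 < eta -> exists N, forall n m,
    (N <= n)%N -> (N <= m)%N -> `|amp mu n - amp mu m| <= eta.
  move=> mur eta eta0; have [ampp tl] := H mu mur; have /andP[mu0 _] := mur.
  have [N1 h1] := Xsmall `|mu| (1 / 2) mu0 (divr_gt0 ltr01 (ltr0Sn R 1)).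
  have ampb n : (N1 <= n)%N -> amp mu n <= 2 * amp mu N1.
    move=> Nn; have := tl N1 n Nn (h1 N1 (leqnn _) mu (lexx _)).
    have h2 := h1 N1 (leqnn _) mu (lexx _); rewrite -/(X mu N1) ler_norml.
    have : X mu N1 * amp mu N1 <= 1 / 2 * amp mu N1 by rewrite ler_wpM2r// ltW.
    by have := ampp N1; lra.
  have B0 : 0 < 4 * amp mu N1 by rewrite mulr_gt0.
  have [N2 h2] := Xsmall `|mu| (eta / (4 * amp mu N1)) mu0 (divr_gt0 eta0 B0).
  exists (maxn N1 N2) => n m Nn Nm.
  set N := maxn N1 N2 in Nn Nm.
  have k n' : (N <= n')%N -> `|amp mu n' - amp mu N| <= eta / 2.
    move=> Nn'; have x1 := h1 N (leq_maxl _ _) mu (lexx _).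
    have := tl N n' Nn' x1 => /le_trans; apply.
    apply: (@le_trans _ _ (eta / (4 * amp mu N1) * (2 * amp mu N1))).
      apply: ler_pM; rewrite ?amp_ge0 ?ampb ?leq_maxl//.
      - by rewrite mulr_ge0 ?(ltW C0)// addr_ge0// invr_ge0 mulr_ge0.
      - by apply: h2; rewrite ?leq_maxr.
    rewrite le_eqVlt; apply/orP; left; apply/eqP; field.
    by rewrite gt_eqF.
  have := ler_normB (amp mu n - amp mu N) (amp mu m - amp mu N).
  rewrite opprB addrA subrK => /le_trans; apply.
  by have := k n Nn; have := k m Nm; lra.
have lim_ex mu : 0 < `|mu| < r -> exists a, forall eta, 0 < eta -> exists N, forall n,
    (N <= n)%N -> `|amp mu n - a| <= eta.
  move=> mur; have cv : cvgn (amp mu).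
    apply: cauchy_cvg; apply/cauchy_ballP => eta eta0; near_simpl.
    have [N hN] := cauchy mu mur (eta / 2) (divr_gt0 eta0 (ltr0Sn R 1)).
    exists ([set n | N <= n]%N, [set n | N <= n]%N); first by split; exists N.
    move=> [n m] [/= Nn Nm]; rewrite /ball /=.
    by apply: (le_lt_trans (hN n m Nn Nm)); rewrite ltr_pdivrMr// ltr_pMr// ltr1n.
  exists (limn (amp mu)) => eta eta0.
  have [N _ hN] : \forall n \near \oo, `|limn (amp mu) - amp mu n| < eta.
    by move/cvgrPdist_lt : cv; apply.
  by exists N => n Nn; rewrite distrC; apply: ltW; exact: hN.
have [a ha] : exists a : R -> R, forall mu, 0 < `|mu| < r -> forall eta, 0 < eta ->
    exists N, forall n, (N <= n)%N -> `|amp mu n - a mu| <= eta.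
  pose P (mu a : R) := 0 < `|mu| < r -> forall eta, 0 < eta ->
    exists N, forall n, (N <= n)%N -> `|amp mu n - a| <= eta.
  have /choice[a ha] : forall mu, exists a, P mu a.
    (* Outside the punctured neighbourhood the value 0 is a dummy. *)
    move=> mu; have [mur|nmur] := pselect (0 < `|mu| < r); last by exists 0; rewrite /P => /nmur.
    by have [a ha] := lim_ex mu mur; exists a; rewrite /P.
  by exists a.
exists a => mu mur; have [ampp tl] := H mu mur; have /andP[mu0 mu_r] := mur.
split; [|split; first exact: ha].
  have [N1 h1] := Xsmall `|mu| (1 / 2) mu0 (divr_gt0 ltr01 (ltr0Sn R 1)).
  have p4 : 0 < amp mu N1 / 4 by rewrite divr_gt0.
  have [N2 h2] := ha mu mur (amp mu N1 / 4) p4.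
  have k2 := h2 (maxn N1 N2) (leq_maxr _ _).
  have k1 := tl N1 (maxn N1 N2) (leq_maxl _ _) (h1 N1 (leqnn _) mu (lexx _)).
  have h3 := h1 N1 (leqnn _) mu (lexx _).
  have k3 : X mu N1 * amp mu N1 <= 1 / 2 * amp mu N1 by rewrite ler_wpM2r// ltW.
  move: k1 k2; rewrite -/(X mu N1) !ler_norml => /andP[k1 _] /andP[_ k2].
  by have := ampp N1; lra.
move=> eta eta0.
have m2 : 0 < `|mu| / 2 by rewrite divr_gt0.
have [N0 h0] := Xsmall (`|mu| / 2) (1 / 2) m2 (divr_gt0 ltr01 (ltr0Sn R 1)).
have [M hM] := ha mu mur 1 ltr01.
have ap : 0 <= a mu + 2.
  have := hM M (leqnn _); rewrite ler_norml => /andP[_ k].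
  by have := amp_ge0 mu M; lra.
have B0 : 0 < 4 * (a mu + 3) by lra.
have [N1 h1] := Xsmall (`|mu| / 2) (eta / (4 * (a mu + 3))) m2 (divr_gt0 eta0 B0).
have e4 : 0 < eta / 4 by rewrite divr_gt0.
have [N2 h2] := ha mu mur (eta / 4) e4.
pose N := maxn (maxn N0 N1) (maxn N2 M).
have N0N : (N0 <= N)%N by rewrite /N !leq_max leqnn.
have N1N : (N1 <= N)%N by rewrite /N !leq_max leqnn orbT.
have N2N : (N2 <= N)%N by rewrite /N !leq_max leqnn !orbT.
have MN : (M <= N)%N by rewrite /N !leq_max leqnn !orbT.
have [d d0 hd] : exists2 d, 0 < d & forall x, `|x - mu| < d ->
    `|amp x N - amp mu N| <= Num.min 1 (eta / 4).
  have e1 : 0 < Num.min 1 (eta / 4) by rewrite lt_min ltr01.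
  have := @amp_cont N mu => /cvgrPdist_lt /(_ _ e1) /nbhs_normP[d /= d0 hd].
  exists d => // x xd; rewrite distrC; apply/ltW/hd.
  by rewrite /= distrC.
exists (Num.min d (Num.min (`|mu| / 2) (r - `|mu|))).
  by rewrite !lt_min d0 m2 subr_gt0.
exists N => x n; rewrite !lt_min => /andP[xd /andP[xm xr]] Nn.
have x1 : `|mu| / 2 <= `|x|.
  have := ler_normB x (x - mu); rewrite opprB addrC subrK; lra.
have xr2 : 0 < `|x| < r.
  rewrite (lt_le_trans m2)//=.
  have := ler_normD (x - mu) mu; rewrite subrK; lra.
have [_ tlx] := H x xr2.
have s1 := h0 N N0N x x1.
have k1 := tlx N n Nn s1.
have k2 := hd x xd; have k3 := h2 N N2N; have k4 := hM N MN.
move: k2; rewrite le_min => /andP[k2 k5].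
have bx : amp x N <= a mu + 2.
  by move: k2 k4; rewrite !ler_norml => /andP[_ k2] /andP[_ k4]; lra.
have k6 : X x N * amp x N <= eta / 4.
  apply: (@le_trans _ _ (eta / (4 * (a mu + 3)) * (a mu + 3))).
    apply: ler_pM; rewrite ?amp_ge0//.
    - by rewrite mulr_ge0 ?(ltW C0)// addr_ge0// invr_ge0 mulr_ge0.
    - exact: h1.
    - by lra.
  rewrite le_eqVlt; apply/orP; left; apply/eqP; field.
  by rewrite gt_eqF //; lra.
have -> : amp x n - a mu = (amp x n - amp x N) + (amp x N - amp mu N) + (amp mu N - a mu) by ring.
apply: (le_trans (ler_normD _ _)); have := ler_normD (amp x n - amp x N) (amp x N - amp mu N).
by move: k1; rewrite -/(X x N); lra.
Unshelve. all: by end_near. Qed.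

End amplitude.

(** * Matching the averaged frame with the model *)

Section resonant_limit.
Context {R : realType}.
Variables (z0 kappa : R[i]) (beta d : R) (q Q : nat -> R).
Hypothesis z0_unit : z0 * conjc z0 = 1.
Hypothesis kappa_unit : kappa * conjc kappa = 1.
Hypothesis z0_im : Im z0 != 0.
Hypothesis beta_gt0 : 0 < beta.
Hypothesis qQ : forall N n, \sum_(N <= j < n) `|q j.+1| <= Q N.
Hypothesis Q0 : forall eta : R, 0 < eta -> exists n0, forall n, (n0 <= n)%N -> Q n <= eta.
Hypothesis d_gt0 : 0 < d.
Hypothesis dist0 : forall u, u \in [:: z0 ^+ 2; conjc z0 ^+ 2;
    conjc z0 ^+ 2 * conjc z0 ^+ 2] -> d <= normc (1 - conjc u).

Local Notation b := (resonant_potential z0 kappa beta q).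
Local Notation w := (growth beta).
Local Notation c0 := (res_c z0 beta d).
Local Notation cC := (res_C z0 beta d).
Local Notation err ep := (comp_err ep (fun j => `|q j.+1|)).

(** Rotation by [conjc kappa] turns the coefficient [kappa ^+ 2 * beta / n] of the conjugate into
    the real number [beta / n]. *)
Definition red (mu : R) (y : nat -> R) n : R[i] := conjc kappa * res_G z0 kappa beta mu y n.

Lemma normc_red mu y n : normc (red mu y n) = normc (res_G z0 kappa beta mu y n).
Proof. by rewrite normcM normc_conj (normc_unit kappa_unit) mul1r. Qed.

Lemma res_c_ge0 : 0 <= c0.
Proof.
rewrite /res_c divr_ge0 ?(ltW d_gt0)// addr_ge0 ?invr_ge0//.
by rewrite mulr_ge0 // ltW.
Qed.

Lemma res_C_ge0 : 0 <= cC.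
Proof.
have s0 : 0 <= `|Im z0|^-1 by rewrite invr_ge0.
have b0 := ltW beta_gt0; have d0 : 0 <= d^-1 by rewrite invr_ge0 ltW.
have := mulr_ge0 b0 d0; have := mulr_ge0 res_c_ge0 s0; have := mulr_ge0 res_c_ge0 b0.
by rewrite /res_C; lra.
Qed.

Lemma red_step mu y n : solves y b (2 * Re z0 + mu) ->
  c0 * (n.+1%:R^-1 + `|mu|) <= 1 / 2 ->
  normc (red mu y n.+1 - red mu y n - res_flow beta (- mu / Im z0) n (red mu y n)) <=
  cC * err (- mu / Im z0) n * normc (red mu y n).
Proof.
move=> ysol small.
have [_ _] := resonant_step z0_unit kappa_unit z0_im beta_gt0 d_gt0 dist0 ysol small.
set G := res_G z0 kappa beta mu y n; set G' := res_G z0 kappa beta mu y n.+1.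
have -> : red mu y n.+1 - red mu y n - res_flow beta (- mu / Im z0) n (red mu y n) =
  conjc kappa * (G' - G - (res_lin z0 mu * G + res_conj kappa beta n * conjc G)).
  rewrite /red -/G -/G' /res_flow /res_lin /res_conj conjcM conjcK.
  have -> : (- mu / Im z0 / 2)%:C = - (mu / (2 * Im z0))%:C :> R[i].
    by rewrite -[RHS](rmorphN (real_complex R)) /=; congr (_%:C); field.
  apply/eqP; rewrite -subr_eq0; apply/eqP.
  transitivity ((kappa * conjc kappa - 1) * kappa * (beta / n.+2%:R)%:C * conjc G).
    by ring.
  by rewrite kappa_unit subrr !mul0r.
rewrite !normcM normc_conj (normc_unit kappa_unit) !mul1r => h.
apply: (le_trans h); rewrite ler_wpM2r ?normc_ge0// ler_wpM2l ?res_C_ge0//.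
rewrite /comp_err lerD2r lerD2l exprMn sqrrN exprVn.
rewrite ler_peMr ?sqr_ge0// invf_ge1 ?exprn_even_gt0//.
have : `|Im z0| <= 1 by rewrite -(normc_unit z0_unit) normcIm.
by move=> h1; rewrite -[leLHS]real_normK ?num_real// exprn_ile1.
Qed.

(** The two quadratic forms differ by [mu * u * v], and the form [g] at the critical energy is
    positive definite as [|Re z0| < 1]: with [k] the reciprocal of [2 - |2 * Re z0|], one has
    [|u * v| <= k * g]. *)
Lemma energy_frame_dist : exists2 k : R, 0 < k & forall mu (u v : R), k * `|mu| <= 1 ->
  `|Num.sqrt (u ^+ 2 - (2 * Re z0 + mu) * u * v + v ^+ 2) -
    Num.sqrt (u ^+ 2 - 2 * Re z0 * u * v + v ^+ 2)| <=
  k * `|mu| * Num.sqrt (u ^+ 2 - 2 * Re z0 * u * v + v ^+ 2).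
Proof.
have re1 : `|2 * Re z0| < 2.
  rewrite normrM normr_nat gtr_pMr//.
  have h1 : Re z0 ^+ 2 + Im z0 ^+ 2 = 1.
    by rewrite -sqr_normcE (normc_unit z0_unit) expr1n.
  have h2 : 0 < Im z0 ^+ 2 by rewrite exprn_even_gt0.
  by rewrite -ltr_sqr ?nnegrE// real_normK ?num_real// expr1n; lra.
pose k := (2 - `|2 * Re z0|)^-1.
have k0 : 0 < k by rewrite invr_gt0 subr_gt0.
exists k => // mu u v kmu.
set g := u ^+ 2 - 2 * Re z0 * u * v + v ^+ 2.
have uv : `|u * v| <= k * g.
  rewrite [leRHS]mulrC /k ler_pdivlMr ?subr_gt0// /g.
  have h1 : 2 * `|u * v| <= u ^+ 2 + v ^+ 2.
    have := sqr_ge0 (`|u| - `|v|); rewrite sqrrB !real_normK ?num_real// normrM; lra.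
  have h2 : 2 * Re z0 * (u * v) <= `|2 * Re z0| * `|u * v|.
    by rewrite -normrM ler_norm.
  by rewrite -mulrA; lra.
have g0 : 0 <= g.
  by rewrite -(pmulr_rge0 _ k0); apply: le_trans uv.
have -> : u ^+ 2 - (2 * Re z0 + mu) * u * v + v ^+ 2 = g - mu * (u * v) by rewrite /g; ring.
have muv : `|mu * (u * v)| <= k * `|mu| * g.
  by rewrite normrM (mulrC k) -mulrA; apply: ler_wpM2l.
have e0 : 0 <= g - mu * (u * v).
  have := ler_norm (mu * (u * v)).
  have : k * `|mu| * g <= 1 * g by rewrite ler_wpM2r.
  by lra.
set f := Num.sqrt g; set a := Num.sqrt _.
have f0 : 0 <= f by exact: sqrtr_ge0.
have a0 : 0 <= a by exact: sqrtr_ge0.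
have fE : f ^+ 2 = g by rewrite sqr_sqrtr.
have aE : a ^+ 2 = g - mu * (u * v) by rewrite sqr_sqrtr.
have [f00|fn0] := eqVneq f 0.
  have gg : g = 0 by rewrite -fE f00 expr0n.
  have : mu * (u * v) = 0.
    by apply/eqP; rewrite -normr_le0; apply: (le_trans muv); rewrite gg mulr0.
  move=> m0; have : a ^+ 2 = 0 by rewrite aE gg m0 subr0.
  by move/eqP; rewrite sqrf_eq0 => /eqP ->; rewrite f00 subrr normr0 mulr0.
have fp : 0 < f by rewrite lt_def fn0.
rewrite -(ler_pM2r fp) (_ : k * `|mu| * f * f = k * `|mu| * g); last by rewrite -fE; ring.
apply: le_trans muv.
have -> : mu * (u * v) = (f - a) * (f + a) by rewrite -subr_sqr fE aE; ring.
rewrite normrM distrC ler_wpM2l// ger0_norm ?addr_ge0// lerDl//.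
Qed.

Variable y : R -> nat -> R.
Hypothesis ysol : forall mu, solves (y mu) b (2 * Re z0 + mu).
Hypothesis y_cont : forall n, continuous (fun mu => y mu n).

Lemma amp_red : exists2 k : R, 0 < k & forall mu n, k * `|mu| <= 1 ->
  c0 * (n.+1%:R^-1 + `|mu|) <= 1 / 2 ->
  `|amp z0 y mu n - normc (red mu (y mu) n)| <=
   2 * (k * `|mu| + c0 * (n.+1%:R^-1 + `|mu|)) * normc (red mu (y mu) n).
Proof.
have [k k0 H] := energy_frame_dist; exists k => // mu n kmu small.
have [h1 h2 _] := resonant_step z0_unit kappa_unit z0_im beta_gt0 d_gt0 dist0 (ysol mu) small.
rewrite normc_red.
have fE : normc (frame z0 (y mu) n) =
  Num.sqrt (y mu n.+1 ^+ 2 - 2 * Re z0 * y mu n.+1 * y mu n + y mu n ^+ 2).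
  by rewrite -frame_energy// sqrtr_sqr ger0_norm ?normc_ge0.
have h3 := H mu (y mu n.+1) (y mu n) kmu; rewrite -fE -/(energy z0 y mu n) -/(amp z0 y mu n) in h3.
set F := frame z0 (y mu) n in h1 h2 h3; set G := res_G _ _ _ _ _ _ in h1 h2 *.
have km0 : 0 <= k * `|mu| by rewrite mulr_ge0 // ltW.
have cx0 : 0 <= c0 * (n.+1%:R^-1 + `|mu|).
  by rewrite mulr_ge0 ?res_c_ge0// addr_ge0// invr_ge0.
have h4 : k * `|mu| * normc F <= k * `|mu| * (2 * normc G) by rewrite ler_wpM2l.
have h5 : c0 * (n.+1%:R^-1 + `|mu|) * normc F <= c0 * (n.+1%:R^-1 + `|mu|) * (2 * normc G).
  by rewrite ler_wpM2l.
have h6 := normc_dist F G.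
have := ler_normD (amp z0 y mu n - normc F) (normc F - normc G).
rewrite addrA subrK; move: h1 h3 h4 h5 h6.
by move: (c0 * _) (k * _) => X Y; lra.
Qed.

Lemma small_index (eta : R) : 0 < eta ->
  exists n0, forall n, (n0 <= n)%N -> n.+1%:R^-1 <= eta.
Proof.
move=> eta0; exists (Num.truncn eta^-1) => n n0.
rewrite invf_ple ?posrE// (@le_trans _ _ (Num.truncn eta^-1).+1%:R) ?ler_nat//.
exact/ltW/truncnS_gt.
Qed.

Lemma res_small : exists2 r : R, 0 < r & exists n0, forall (mu : R) n, `|mu| <= r -> (n0 <= n)%N ->
  c0 * (n.+1%:R^-1 + `|mu|) <= 1 / 2.
Proof.
have c1 : 0 < c0 + 1 by rewrite ltr_wpDl// res_c_ge0.
exists (1 / 4 / (c0 + 1)); first by rewrite !divr_gt0.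
have e0 : 0 < 1 / 4 / (c0 + 1) :> R by rewrite !divr_gt0.
have [n0 hn0] := small_index e0.
exists n0 => mu n mur /hn0 nn.
apply: (@le_trans _ _ (c0 * (1 / 4 / (c0 + 1) + 1 / 4 / (c0 + 1)))).
  by rewrite ler_wpM2l ?res_c_ge0// lerD.
have -> : c0 * (1 / 4 / (c0 + 1) + 1 / 4 / (c0 + 1)) = c0 / (c0 + 1) / 2 by field; rewrite gt_eqF.
rewrite ler_pM2r// ler_pdivrMr// mul1r lerDl//.
Qed.

Lemma red_cont n (eta : R) : 0 < eta -> exists2 r, 0 < r & forall mu, `|mu| < r ->
  normc (red mu (y mu) n - red 0 (y 0) n) <= eta.
Proof.
move=> eta0.
pose A := normc (res_A z0 kappa beta n) + normc (res_B z0 kappa beta 0 n) + 1.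
pose B := normc ((conjc z0 ^+ 2) ^+ n.+1 / (1 - z0 ^+ 2)) / `|2 * Im z0|.
have A0 : 0 < A by rewrite ltr_wpDl// addr_ge0 ?normc_ge0.
have B0 : 0 <= B by rewrite divr_ge0 ?normc_ge0.
set F0 := frame z0 (y 0) n.
have BB mu : res_B z0 kappa beta mu n - res_B z0 kappa beta 0 n =
  'i%C * (mu / (2 * Im z0))%:C * ((conjc z0 ^+ 2) ^+ n.+1 / (1 - z0 ^+ 2)).
  by rewrite /res_B mul0r; set U := _ / _; rewrite rmorph0; ring.
have nBB mu : normc (res_B z0 kappa beta mu n - res_B z0 kappa beta 0 n) = `|mu| * B.
  rewrite BB normcM (normcM 'i%C) normc_i mul1r normc_real normrM normfV /B.
  by rewrite -!mulrA; congr (_ * _); rewrite mulrC.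
have FF mu : normc (frame z0 (y mu) n - F0) <= `|y mu n.+1 - y 0 n.+1| + `|y mu n - y 0 n|.
  rewrite /F0 /frame -mulrBl normcM normcX normc_conj (normc_unit z0_unit) expr1n mulr1.
  have -> : (y mu n.+1)%:C - conjc z0 * (y mu n)%:C - ((y 0 n.+1)%:C - conjc z0 * (y 0 n)%:C) =
     (y mu n.+1 - y 0 n.+1)%:C - conjc z0 * (y mu n - y 0 n)%:C by rewrite !(@realcB R); ring.
  apply: (le_trans (le_normcB _ _)).
  by rewrite normcM normc_conj (normc_unit z0_unit) mul1r !normc_real.
have GG mu : normc (red mu (y mu) n - red 0 (y 0) n) <=
   (A + `|mu| * B) * normc (frame z0 (y mu) n - F0) + `|mu| * B * normc F0.
  rewrite /red -mulrBr normcM normc_conj (normc_unit kappa_unit) mul1r /res_G -/F0.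
  set f := frame z0 (y mu) n; set a := res_A z0 kappa beta n.
  set b0 := res_B z0 kappa beta 0 n; set bm := res_B z0 kappa beta mu n.
  have -> : f - a * f - bm * conjc f - (F0 - a * F0 - b0 * conjc F0) =
    (f - F0) - a * (f - F0) - (b0 + (bm - b0)) * conjc (f - F0) - (bm - b0) * conjc F0.
    by rewrite conjcB; ring.
  have k1 := le_normcB (f - F0 - a * (f - F0) - (b0 + (bm - b0)) * conjc (f - F0)) ((bm - b0) * conjc F0).
  have k2 := le_normcB (f - F0 - a * (f - F0)) ((b0 + (bm - b0)) * conjc (f - F0)).
  have k3 := le_normcB (f - F0) (a * (f - F0)).
  rewrite (normcM (bm - b0)) normc_conj /bm /b0 nBB -/b0 -/bm in k1.
  rewrite (normcM _ (conjc _)) normc_conj in k2; rewrite (normcM a) in k3.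
  have k4 : normc (b0 + (bm - b0)) <= normc b0 + `|mu| * B by rewrite -nBB le_normcD.
  have k5 : normc (b0 + (bm - b0)) * normc (f - F0) <= (normc b0 + `|mu| * B) * normc (f - F0).
    by rewrite ler_wpM2r ?normc_ge0.
  by apply: (le_trans k1); rewrite /A -/a -/b0; lra.
have c1 : (fun mu => (A + `|mu| * B) * (`|y mu n.+1 - y 0 n.+1| + `|y mu n - y 0 n|) +
    `|mu| * B * normc F0) mu @[mu --> (0 : R)] -->
    (A + `|0 : R| * B) * (`|y 0 n.+1 - y 0 n.+1| + `|y 0 n - y 0 n|) + `|0 : R| * B * normc F0.
  have cn : `|x| @[x --> (0 : R)] --> `|0 : R| by exact: norm_continuous.
  have cy m : `|y x m - y 0 m| @[x --> (0 : R)] --> `|y 0 m - y 0 m|.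
    by apply: cvg_norm; apply: cvgB; [exact: y_cont|exact: cvg_cst].
  apply: cvgD; last by apply: cvgM; [apply: cvgM => //; exact: cvg_cst|exact: cvg_cst].
  apply: cvgM; last by apply: cvgD; exact: cy.
  by apply: cvgD; [exact: cvg_cst|apply: cvgM => //; exact: cvg_cst].
move/cvgrPdist_lt : c1 => /(_ _ eta0) /nbhs_normP[r /= r0 hr].
exists r => // mu mur; apply: (le_trans (GG mu)).
have := hr mu; rewrite /= sub0r normrN => /(_ mur).
rewrite !subrr normr0 addr0 mulr0 !mul0r addr0 sub0r normrN => /ltW h.
apply: le_trans (le_trans (ler_norm _) h).
rewrite lerD2r ler_wpM2l// addr_ge0 ?(ltW A0)// mulr_ge0//.
Qed.

(** The index [N1] serves all solutions at once, and the error 1/4 is relative to the data at [N]: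
    this allows [growing_solution] to prescribe data at [N] and read off the sign of [K]. *)
Lemma zero_energy_solution : exists N1, forall N (u : nat -> R), (N1 <= N)%N ->
  solves u b (2 * Re z0) -> exists2 K : R,
    `|K - Re (red 0 u N) / w N| <= 1 / 4 * (normc (red 0 u N) / w N) &
    forall eta, 0 < eta -> exists n0, forall n, (n0 <= n)%N ->
      normc (red 0 u n - (K * w n)%:C) / w n <= eta.
Proof.
have [r r0 [N2 hN2]] := res_small.
pose e n := cC * err 0 n; pose S n := cC * (n.+1%:R^-1 + Q n).
have e0 n : 0 <= e n by rewrite mulr_ge0 ?res_C_ge0// comp_err_ge0.
have eS m n : \sum_(m <= j < n) e j <= S m.
  rewrite -mulr_sumr ler_wpM2l ?res_C_ge0// /comp_err expr0n /=.
  under eq_bigr do rewrite addr0.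
  by rewrite big_split lerD// sum_inv_le.
have S0 eta : 0 < eta -> exists n0, forall n, (n0 <= n)%N -> S n <= eta.
  move=> eta0; have c1 : 0 < cC + 1 by rewrite ltr_wpDl// res_C_ge0.
  have e1 : 0 < eta / (cC + 1) / 2 by rewrite !divr_gt0.
  have [n1 h1] := Q0 e1; have [n2 h2] := small_index e1.
  exists (maxn n1 n2) => n; rewrite geq_max => /andP[n1n n2n].
  apply: (@le_trans _ _ (cC * (eta / (cC + 1)))).
    by rewrite ler_wpM2l ?res_C_ge0// [leRHS]splitr lerD// ?h1// h2.
  by rewrite mulrCA ler_piMr ?(ltW eta0)// ler_pdivrMr// mul1r lerDl.
have e8 : 0 < 1 / 8 :> R by rewrite divr_gt0.
have [N3 hN3] := S0 _ e8.
exists (maxn N2 N3) => N u; rewrite geq_max => /andP[NN2 NN3] usol.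
have hstep n : (N <= n)%N -> normc (red 0 u n.+1 - red 0 u n -
    (beta / n.+2%:R)%:C * conjc (red 0 u n)) <= e n * normc (red 0 u n).
  move=> Nn; have us : solves u b (2 * Re z0 + 0) by rewrite addr0.
  have := red_step us (hN2 0 n _ (leq_trans NN2 Nn)); rewrite normr0 => /(_ (ltW r0)).
  rewrite /res_flow oppr0 mul0r mul0r.
  have -> : 'i%C * 0%:C * red 0 u n = 0 :> R[i] by rewrite mulr0 mul0r.
  by rewrite add0r.
have [K hK1 hK] := zero_energy_limit beta_gt0 e0 eS S0 hstep.
exists K => //; apply: (le_trans hK1).
have S8 := hN3 N NN3.
have Sp : 0 <= S N by apply: le_trans (eS N N); rewrite big_geq.
have ex : expR (S N) <= 2.
  have k1 := expR_ge1Dx (- S N); rewrite expRN in k1; have k2 := expR_gt0 (S N).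
  have : (1 - S N) * expR (S N) <= 1 by rewrite -ler_pdivlMr// mul1r.
  by move: (expR (S N)) k2 => E k2; nra.
have A0 : 0 <= normc (red 0 u N) / w N.
  by rewrite divr_ge0 ?normc_ge0// ltW // growth_gt0.
rewrite -mulrA [leRHS]mulrC; apply: ler_wpM2l => //.
by have := expR_ge0 (S N); move: (expR (S N)) ex => E; nra.
Qed.

End resonant_limit.

Lemma expR_le1D2x (R : realType) (x : R) : 0 <= x <= 1 / 2 -> expR x <= 1 + 2 * x.
Proof.
move=> /andP[x0 x1]; have := expR_ge1Dx (- x); rewrite expRN => h.
have e0 := expR_gt0 x.
have : (1 - x) * expR x <= 1 by rewrite -ler_pdivlMr// mul1r.
by move: (expR x) e0 => e e0 h2; nra.
Qed.

Section red_compare.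
Context {R : realType}.
Variables (z0 kappa : R[i]) (beta d : R) (q Q : nat -> R).
Hypothesis z0_unit : z0 * conjc z0 = 1.
Hypothesis kappa_unit : kappa * conjc kappa = 1.
Hypothesis z0_im : Im z0 != 0.
Hypothesis beta_gt0 : 0 < beta.
Hypothesis qQ : forall N n, \sum_(N <= j < n) `|q j.+1| <= Q N.
Hypothesis Q0 : forall eta : R, 0 < eta -> exists n0, forall n, (n0 <= n)%N -> Q n <= eta.
Hypothesis d_gt0 : 0 < d.
Hypothesis dist0 : forall u, u \in [:: z0 ^+ 2; conjc z0 ^+ 2;
    conjc z0 ^+ 2 * conjc z0 ^+ 2] -> d <= normc (1 - conjc u).
Variable y : R -> nat -> R.
Hypothesis ysol : forall mu,
  solves (y mu) (resonant_potential z0 kappa beta q) (2 * Re z0 + mu).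
Hypothesis y_cont : forall n, continuous (fun mu => y mu n).

Local Notation w := (growth beta).
Local Notation cC := (res_C z0 beta d).
Local Notation err ep := (comp_err ep (fun j => `|q j.+1|)).
Local Notation h mu n := (red z0 kappa beta mu (y mu) n).

(** The order of choices is the point. [N] makes the solution at [mu = 0] close to [K * w N] and the
    remaining error sums small; only then [mu] is taken so small that the data at [N] hardly change
    and [besselZ] at [N.+1%:R * ep] is close to [besselZ 0 = 1]. From [N] on, [model_comparison]
    applies. *)
Lemma red_compare (K : R) :
  (forall eta, 0 < eta -> exists n0, forall n, (n0 <= n)%N ->
    normc (h 0 n - (K * w n)%:C) / w n <= eta) ->
  forall T eta : R, 0 < T -> 0 < eta -> exists2 del, 0 < del & exists N, forall (mu : R) n,
    `|mu| < del -> (N <= n)%N -> n.+1%:R * `|- mu / Im z0| <= T ->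
    `|normc (h mu n) / w n - `|K| * normc (besselZ beta (n.+1%:R * (- mu / Im z0)))| <= eta.
Proof.
move=> hK T eta T0 eta0.
have s0 : 0 < `|Im z0| by rewrite normr_gt0.
have CC0 := res_C_ge0 z0 beta_gt0 d_gt0.
set C := `|K| * (3 * expR T) * (3 + beta).
have C0 : 0 <= C by rewrite /C !mulr_ge0 ?expR_ge0// addr_ge0 // ltW.
have B0 : 0 < eta / 2 + C by rewrite ltr_pwDl// divr_gt0.
(* The exponent in [model_comparison] will be at most [theta], hence its exponential at most
   [1 + 2 * theta], and [2 * theta * (eta / 2 + C) <= eta / 2] leaves room for the initial error
   [eta / 2]. *)
pose theta := Num.min (1 / 2) (eta / 4 / (eta / 2 + C)).
have th0 : 0 < theta by rewrite lt_min !divr_gt0.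
have c1 : 0 < 1 + cC by rewrite ltr_pwDl.
pose t := theta / (1 + cC).
have t0 : 0 < t by rewrite divr_gt0.
have t3 : 0 < t / 3 by rewrite divr_gt0.
have e4 : 0 < eta / 4 by rewrite divr_gt0.
have e8 : 0 < eta / 8 by rewrite divr_gt0.
have [r r0 [N1 hN1]] := res_small z0 beta_gt0 d_gt0.
have [N2 hN2] := hK _ e4.
have [N3 hN3] := Q0 t3.
have [N4 hN4] := small_index t3.
pose N := maxn (maxn N1 N2) (maxn N3 N4).
have NN1 : (N1 <= N)%N by rewrite /N !leq_max leqnn.
have NN2 : (N2 <= N)%N by rewrite /N !leq_max leqnn !orbT.
have NN3 : (N3 <= N)%N by rewrite /N !leq_max leqnn !orbT.
have NN4 : (N4 <= N)%N by rewrite /N !leq_max leqnn !orbT.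
clearbody N.
have [r2 r20 hr2] := red_cont beta z0_unit kappa_unit y_cont N e8.
pose D := `|K| * (3 * expR T) * N.+1%:R.
have D0 : 0 <= D by rewrite /D !mulr_ge0 ?expR_ge0.
pose del := Num.min (Num.min r r2) (Num.min (t / 3 / T * `|Im z0|) (eta / 8 / (D + 1) * `|Im z0|)).
have D1 : 0 < D + 1 by rewrite ltr_wpDl.
exists del.
  rewrite /del !lt_min r0 r20 (mulr_gt0 (divr_gt0 t3 T0) s0).
  by rewrite (mulr_gt0 (divr_gt0 e8 D1) s0).
exists N => mu n; rewrite /del !lt_min => /andP[/andP[mu1 mu2] /andP[mu3 mu4]] Nn nT.
set ep := - mu / Im z0 in nT *.
have epE : `|ep| = `|mu| / `|Im z0| by rewrite /ep normrM normrN normfV.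
have ep3 : T * `|ep| <= t / 3.
  by rewrite epE mulrC -ler_pdivlMr// ler_pdivrMr// ltW.
have ep4 : D * `|ep| <= eta / 8.
  have : `|ep| <= eta / 8 / (D + 1) by rewrite epE ler_pdivrMr// ltW.
  move=> h1; apply: (@le_trans _ _ (D * (eta / 8 / (D + 1)))); first by rewrite ler_wpM2l.
  by rewrite mulrCA ler_piMr ?(ltW e8)// ler_pdivrMr// mul1r lerDl.
have w1 := growth_ge1 beta_gt0 N; have wN0 := growth_gt0 beta_gt0 N.
have NT : N.+1%:R * `|ep| <= T by apply: le_trans nT; rewrite ler_wpM2r// ler_nat.
have T0' := ltW T0.
pose dd n := normc (h mu n - K%:C * model beta ep n) / w n.
have dN : dd N <= eta / 2.
  rewrite /dd ler_pdivrMr//.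
  have -> : h mu N - K%:C * model beta ep N = (h mu N - h 0 N) + (h 0 N - (K * w N)%:C)
     - (K * w N)%:C * (besselZ beta (N.+1%:R * ep) - 1).
    by rewrite /model (@realcM R); ring.
  apply: (le_trans (le_normcB _ _)).
  have a1 := le_normcD (h mu N - h 0 N) (h 0 N - (K * w N)%:C).
  have a2 := hr2 mu mu2.
  have a3 := hN2 N NN2; rewrite ler_pdivrMr// in a3.
  have a4 : normc ((K * w N)%:C * (besselZ beta (N.+1%:R * ep) - 1)) <= eta / 8 * w N.
    rewrite normcM normc_real normrM (gtr0_norm wN0) -(besselZ0 beta).
    have := besselZ_lipschitz beta_gt0 (T := T) (x := N.+1%:R * ep) (y := 0).
    rewrite normr0 subr0 normrM normr_nat => /(_ NT T0') bl.
    apply: (@le_trans _ _ (`|K| * w N * (3 * expR T * (N.+1%:R * `|ep|)))).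
      by rewrite ler_wpM2l// mulr_ge0// ltW.
    have -> : `|K| * w N * (3 * expR T * (N.+1%:R * `|ep|)) = D * `|ep| * w N by rewrite /D; ring.
    by rewrite ler_pM2r.
  have a5 : eta / 8 <= eta / 8 * w N by rewrite ler_peMr// ltW.
  by lra.
have sumle : (1 + cC) * \sum_(N <= j < n) err ep j <= theta.
  rewrite mulrC -ler_pdivlMr// -/t /comp_err !big_split /=.
  have u1 := sum_inv_le (R := R) N n.
  have u2 := hN4 N NN4; have u3 := hN3 N NN3; have u4 := qQ N n.
  (* At most [T / |ep|] terms of size [ep ^+ 2] add up to at most [T * |ep|]. *)
  have u5 : \sum_(N <= j < n) ep ^+ 2 <= t / 3.
    rewrite sumr_const_nat -[ep ^+ 2 *+ _]mulr_natl; apply: le_trans ep3.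
    rewrite -(real_normK (num_real ep)) [`|ep| ^+ 2]expr2 mulrA; apply: ler_wpM2r => //.
    by apply: le_trans nT; rewrite ler_wpM2r// ler_nat (leq_trans (leq_subr _ _)).
  have -> : t = t / 3 + t / 3 + t / 3 by field.
  by apply: lerD; [apply: lerD; [exact: le_trans u1 u2|]|exact: le_trans u4 u3].
have mc := @model_comparison R beta beta_gt0 (fun n => h mu n) ep T K cC (fun j => `|q j.+1|) N n
  (fun j => normr_ge0 _) CC0 nT _ n.
have {}mc : dd n + C <= (dd N + C) * expR ((1 + cC) * \sum_(N <= j < n) err ep j).
  apply: mc; last by rewrite Nn leqnn.
  move=> j /andP[Nj jn].
  apply: (red_step z0_unit kappa_unit z0_im beta_gt0 d_gt0 dist0 (ysol mu)).
  by apply: hN1; [exact: ltW|exact: leq_trans NN1 Nj].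
have dd0 : 0 <= dd N by rewrite divr_ge0 ?normc_ge0// ltW.
have thb : theta <= 1 / 2 by rewrite ge_min lexx.
have thb2 : theta * (eta / 2 + C) <= eta / 4 by rewrite -ler_pdivlMr// ge_min lexx orbT.
have ex : expR ((1 + cC) * \sum_(N <= j < n) err ep j) <= 1 + 2 * theta.
  apply: (@le_trans _ _ (expR theta)); first by rewrite ler_expR.
  by apply: expR_le1D2x; rewrite thb ltW.
have dn : dd n <= eta.
  have := @ler_pM R (dd N + C) (eta / 2 + C) _ _ (addr_ge0 dd0 C0) (expR_ge0 _) _ ex.
  rewrite lerD2r => /(_ dN) k.
  have {}k := le_trans mc k.
  by move: k thb2; move: (dd n) (theta) (C) => a b c; lra.
apply: le_trans dn.
have wn0 := growth_gt0 beta_gt0 n.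
have -> : `|K| * normc (besselZ beta (n.+1%:R * ep)) = normc (K%:C * model beta ep n) / w n.
  rewrite normcM normc_real /model normc_posreal ?(ltW wn0)//.
  by field; rewrite gt_eqF.
rewrite -mulrBl normrM normfV (gtr0_norm wn0) /dd ler_pM2r ?invr_gt0//.
exact: normc_dist.
Qed.

End red_compare.

(** For each [x] the quantity [a] compared with [f] has a limit [X] of its own, depending on [x]
    (through the matching point [T]), so no candidate for the limit of [f] is at hand; a Cauchy
    argument supplies it. The case [x = 1 / 4] keeps [f] between two positive bounds. *)
Lemma cvg_of_relative_approximation (R : realType) (F : set_system R) (FF : ProperFilter F)
    (f : R -> R) :
  (forall x, 0 < x <= 1 / 4 -> exists2 X, 0 < X & forall eta, 0 < eta ->
     \forall t \near F, exists a, `|a - X| <= eta /\ `|f t - a| <= x * a) ->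
  exists2 L : R, 0 < L & f t @[t --> F] --> L.
Proof.
move=> H.
have x4 : 0 < (1 / 4 : R) <= 1 / 4 by rewrite lexx andbT divr_gt0.
have [X1 X10 h1] := H _ x4.
have e1 : 0 < X1 / 4 by rewrite divr_gt0.
have near1 : \forall t \near F, X1 / 2 <= f t <= 2 * X1.
  apply: filterS (h1 _ e1) => t [a []]; rewrite !ler_norml => /andP[? ?] /andP[? ?].
  by apply/andP; split; lra.
have cv : cvg (f t @[t --> F]).
  apply: cauchy_cvg; apply: cauchy_exP => eps eps0.
  pose x := Num.min (1 / 4) (eps / 2 / (4 * X1)).
  have x0 : 0 < x by rewrite lt_min !divr_gt0 ?mulr_gt0.
  have x4' : x <= 1 / 4 by rewrite ge_min lexx.
  have xe : x * (4 * X1) <= eps / 2.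
    by rewrite -ler_pdivlMr ?mulr_gt0// ge_min lexx orbT.
  have [X X0 hX] := H x (introT andP (conj x0 x4')).
  exists X.
  have e4 : 0 < eps / 4 by rewrite divr_gt0.
  apply: filterS2 (hX _ e4) near1 => t [a [aX fa]] /andP[f1 f2].
  rewrite /ball /=.
  have a0 : a <= 4 * X1.
    move: fa; rewrite ler_norml => /andP[k _].
    have [ap|an] := leP 0 a; last by lra.
    have : x * a <= 1 / 4 * a by rewrite ler_wpM2r.
    by lra.
  have xa : x * a <= eps / 2 by apply: le_trans xe; rewrite ler_pM2l.
  have k1 : `|X - a| <= eps / 4 by rewrite distrC.
  have k2 : `|a - f t| <= eps / 2 by rewrite distrC (le_trans fa).
  have := ler_normD (X - a) (a - f t); rewrite addrA subrK => /le_lt_trans; apply.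
  by lra.
exists (lim (f t @[t --> F])) => //.
apply: (@lt_le_trans _ _ (X1 / 2)); first by rewrite divr_gt0.
by apply: limr_ge => //; apply: filterS near1 => t /andP[].
Qed.

Section truncated_index.
Context {R : realType}.
Variable c : R.
Hypothesis c_gt0 : 0 < c.

(** The predecessor is taken because index [n] comes with the weight [n + 1]: for small [t], the
    product [(n + 1) t] is within [t] of [c]. *)
Definition trunc_index (t : R) : nat := (Num.truncn (c / t)).-1.

Lemma trunc_index_near N : \forall t \near (0 : R)^'+, (N <= trunc_index t)%N.
Proof.
near=> t; have t0 : 0 < t by near: t; exact: nbhs_right_gt.
have tc : t < c / N.+2%:R by near: t; apply: nbhs_right_lt; rewrite divr_gt0.
rewrite /trunc_index.
have : (N.+2 < (Num.truncn (c / t)).+1)%N.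
  rewrite -(ltr_nat R); apply: le_lt_trans (truncnS_gt _).
  by rewrite ler_pdivlMr// -ler_pdivlMl// mulrC ltW.
by case: (Num.truncn _) => // n; rewrite /= !ltnS => /ltnW.
Unshelve. all: by end_near. Qed.

Lemma trunc_index_bounds : \forall t \near (0 : R)^'+,
  c - t <= (trunc_index t).+1%:R * t <= c.
Proof.
near=> t; have t0 : 0 < t by near: t; exact: nbhs_right_gt.
have i0 : (0 <= trunc_index t)%N by [].
have tc : t < c by near: t; exact: nbhs_right_lt.
have m1 : (0 < Num.truncn (c / t))%N.
  by rewrite truncn_gt0 ler_pdivlMr// mul1r ltW.
rewrite /trunc_index prednK//; apply/andP; split.
  have := truncnS_gt (c / t); rewrite ltr_pdivrMr// -natr1 mulrDl mul1r => /ltW; lra.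
by rewrite -ler_pdivlMr// truncn_le divr_ge0 ?ltW.
Unshelve. all: by end_near. Qed.

Lemma cvg_trunc_index : (trunc_index t).+1%:R * t @[t --> (0 : R)^'+] --> c.
Proof.
apply/cvgrPdist_le => e e0; near=> t.
have : c - t <= (trunc_index t).+1%:R * t <= c by near: t; exact: trunc_index_bounds.
have : t < e by near: t; exact: nbhs_right_lt.
have : 0 < t by near: t; exact: nbhs_right_gt.
by move=> ? ? /andP[? ?]; rewrite ler_norml; apply/andP; split; lra.
Unshelve. all: by end_near. Qed.

End truncated_index.

(** * Power law of the amplitude on either side of the critical energy *)

Section amplitude_asymptotics.
Context {R : realType}.
Variables (z0 kappa : R[i]) (beta d : R) (q Q : nat -> R).
Hypothesis z0_unit : z0 * conjc z0 = 1.
Hypothesis kappa_unit : kappa * conjc kappa = 1.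
Hypothesis z0_im : Im z0 != 0.
Hypothesis z0_re : Re z0 != 0.
Hypothesis beta_gt0 : 0 < beta.
Hypothesis qQ : forall N n, \sum_(N <= j < n) `|q j.+1| <= Q N.
Hypothesis Q0 : forall eta : R, 0 < eta -> exists n0, forall n, (n0 <= n)%N -> Q n <= eta.
Hypothesis d_gt0 : 0 < d.
Hypothesis dist0 : forall u, u \in [:: z0 ^+ 2; conjc z0 ^+ 2;
    conjc z0 ^+ 2 * conjc z0 ^+ 2] -> d <= normc (1 - conjc u).
Variable y : R -> nat -> R.
Hypothesis ysol : forall mu,
  solves (y mu) (resonant_potential z0 kappa beta q) (2 * Re z0 + mu).
Hypothesis y_neq0 : forall mu n, (y mu n != 0) || (y mu n.+1 != 0).
Hypothesis y_cont : forall n, continuous (fun mu => y mu n).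
Variable K : R.
Hypothesis K_neq0 : K != 0.
Hypothesis hK : forall eta, 0 < eta -> exists n0, forall n, (n0 <= n)%N ->
    normc (red z0 kappa beta 0 (y 0) n - (K * growth beta n)%:C) / growth beta n <= eta.

Local Notation w := (growth beta).
Local Notation c0 := (res_c z0 beta d).
Local Notation h mu n := (red z0 kappa beta mu (y mu) n).
Local Notation am mu n := (amp z0 y mu n).

(** The product splits as [(amp / w) (w / (n + 1)^beta) ((n + 1) t)^beta] at an index with
    [(n + 1) t] close to [T * |Im z0|], that is, where the argument of [besselZ] has modulus close
    to [T]. The limit is positive because [besselZ] has no zero and [K != 0]; [sg] selects the side
    of the critical energy. *)
Lemma amp_along_index (sg T : R) : `|sg| = 1 -> 0 < T -> exists2 X : R, 0 < X &
  am (sg * t) (trunc_index (T * `|Im z0|) t) * t `^ beta @[t --> (0 : R)^'+] --> X.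
Proof.
move=> sg1 T0.
have s0 : 0 < `|Im z0| by rewrite normr_gt0.
set c := T * `|Im z0|; have cp : 0 < c by rewrite mulr_gt0.
pose n t := trunc_index c t.
have [W W0 cW] := growth_power beta_gt0.
pose tau := - (sg * T * Num.sg (Im z0)).
have sgn t : 0 < t -> `|sg * t| = t by move=> t0; rewrite normrM sg1 mul1r gtr0_norm.
have ImE : Im z0 = Num.sg (Im z0) * `|Im z0| by rewrite -numEsg.
have sz : Num.sg (Im z0) != 0 by rewrite sgr_eq0.
have sz2 : (Num.sg (Im z0))^-1 = Num.sg (Im z0).
  by apply: (mulfI sz); rewrite mulfV// -expr2 sqr_sg z0_im.
have argE t : (n t).+1%:R * (- (sg * t) / Im z0) =
    - (sg * Num.sg (Im z0)) * ((n t).+1%:R * t / `|Im z0|).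
  by rewrite [in LHS]ImE invfM sz2; ring.
have cidx : (n t).+1%:R * t / `|Im z0| @[t --> (0 : R)^'+] --> T.
  have -> : T = c / `|Im z0| by rewrite /c mulfK// gt_eqF.
  by apply: cvgM; [exact: cvg_trunc_index|exact: cvg_cst].
have absarg t : `|- (sg * Num.sg (Im z0)) * t| = `|t|.
  by rewrite normrM normrN normrM sg1 normr_sg z0_im !mul1r.
exists (`|K| * normc (besselZ beta tau) * W * c `^ beta).
  rewrite mulr_gt0 ?powR_gt0// mulr_gt0// mulr_gt0 ?normr_gt0//.
  rewrite lt_def normc_ge0 andbT; apply/negP => /eqP/eq0_normc/eqP.
  by apply/negP; exact: besselZ_neq0.
have f1 : w (n t) / (n t).+1%:R `^ beta @[t --> (0 : R)^'+] --> W.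
  apply/cvgrPdist_le => e e0.
  have [N _ hN] : \forall m \near \oo, `|W - w m / m.+1%:R `^ beta| <= e.
    by move/cvgrPdist_le : cW; apply.
  by apply: filterS (trunc_index_near cp N) => t; exact: hN.
have f2 : ((n t).+1%:R * t) `^ beta @[t --> (0 : R)^'+] --> c `^ beta.
  apply: (@continuous_cvg _ _ _ _ _ _ (fun x => x `^ beta)); last exact: cvg_trunc_index.
  apply: differentiable_continuous; apply/derivable1_diffP; apply: derivable_powR.
  by rewrite in_itv /= andbT.
have f3 : normc (h (sg * t) (n t)) / w (n t) @[t --> (0 : R)^'+] --> `|K| * normc (besselZ beta tau).
  apply/cvgrPdist_le => e e0.
  have e2 : 0 < e / 2 by rewrite divr_gt0.
  have [del del0 [N hN]] := red_compare z0_unit kappa_unit z0_im beta_gt0 qQ Q0 d_gt0 dist0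
    ysol y_cont hK T0 e2.
  have K1 : 0 < `|K| * (3 * expR T) + 1 by rewrite ltr_wpDl// !mulr_ge0 ?expR_ge0.
  have e3 : 0 < e / 2 / (`|K| * (3 * expR T) + 1) by rewrite divr_gt0.
  near=> t.
  have t0 : 0 < t by near: t; exact: nbhs_right_gt.
  have td : t < del by near: t; exact: nbhs_right_lt.
  have Nn : (N <= n t)%N by near: t; exact: trunc_index_near.
  have /andP[b1 b2] : c - t <= (n t).+1%:R * t <= c by near: t; exact: trunc_index_bounds.
  have cl : `|T - (n t).+1%:R * t / `|Im z0| | <= e / 2 / (`|K| * (3 * expR T) + 1).
    by near: t; move/cvgrPdist_le : cidx; apply.
  have v0 : 0 <= (n t).+1%:R * t / `|Im z0| by rewrite divr_ge0// mulr_ge0// ltW.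
  have vT : (n t).+1%:R * t / `|Im z0| <= T by rewrite ler_pdivrMr.
  have aT : (n t).+1%:R * `|- (sg * t) / Im z0| <= T.
    by rewrite normrM normrN sgn// normfV mulrA.
  have := hN (sg * t) (n t); rewrite sgn// => /(_ td Nn aT); rewrite argE => k1.
  have k2 : `| `|K| * normc (besselZ beta tau) -
      `|K| * normc (besselZ beta (- (sg * Num.sg (Im z0)) * ((n t).+1%:R * t / `|Im z0|)))| <= e / 2.
    rewrite -mulrBr normrM normr_id.
    apply: (@le_trans _ _ (`|K| * (3 * expR T * (e / 2 / (`|K| * (3 * expR T) + 1))))); last first.
      rewrite mulrA mulrCA ler_piMr ?(ltW e2)// ler_pdivrMr// mul1r lerDl//.
    rewrite ler_wpM2l//.
    have tauE : tau = - (sg * Num.sg (Im z0)) * T by rewrite /tau; ring.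
    have := besselZ_lipschitz beta_gt0 (T := T) (x := tau)
      (y := - (sg * Num.sg (Im z0)) * ((n t).+1%:R * t / `|Im z0|)).
    rewrite {1 3}tauE -mulrBr !absarg (gtr0_norm T0) (ger0_norm v0) => /(_ (lexx _) vT) bl.
    apply: (@le_trans _ _ (3 * expR T * `|T - (n t).+1%:R * t / `|Im z0| |)); last first.
      by rewrite ler_wpM2l// mulr_ge0// expR_ge0.
    apply: le_trans bl.
    exact: normc_dist.
  set A := `|K| * normc (besselZ beta tau) in k2 *; set B := `|K| * _ in k1 k2.
  have := ler_normD (A - B) (B - normc (h (sg * t) (n t)) / w (n t)).
  rewrite addrA subrK => /le_trans; apply; rewrite (distrC B); lra.
have f4 : am (sg * t) (n t) / w (n t) @[t --> (0 : R)^'+] --> `|K| * normc (besselZ beta tau).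
  have [k k0 hk] := amp_red z0_unit kappa_unit z0_im beta_gt0 d_gt0 dist0 ysol.
  have [r r0 [N0 hN0]] := res_small z0 beta_gt0 d_gt0.
  have g1 : (n t).+1%:R^-1 @[t --> (0 : R)^'+] --> (0 : R).
    apply/cvgrPdist_le => e e0; have [N hN] := small_index e0.
    apply: filterS (trunc_index_near cp N) => t /hN.
    by rewrite sub0r normrN ger0_norm ?invr_ge0.
  have g0 : t @[t --> (0 : R)^'+] --> (0 : R) by apply: cvg_within_filter; exact: cvg_id.
  have g2 : 2 * (k * t + c0 * ((n t).+1%:R^-1 + t)) * (normc (h (sg * t) (n t)) / w (n t))
     @[t --> (0 : R)^'+] -->
     2 * (k * 0 + c0 * (0 + 0)) * (`|K| * normc (besselZ beta tau)).
    apply: cvgM => //; apply: cvgM; first exact: cvg_cst.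
    apply: cvgD; first by apply: cvgM => //; exact: cvg_cst.
    by apply: cvgM; [exact: cvg_cst|exact: cvgD].
  rewrite addr0 !mulr0 addr0 mulr0 mul0r in g2.
  have g3 : am (sg * t) (n t) / w (n t) - normc (h (sg * t) (n t)) / w (n t)
     @[t --> (0 : R)^'+] --> (0 : R).
    apply/cvgrPdist_le => e e0; near=> t.
    have t0 : 0 < t by near: t; exact: nbhs_right_gt.
    have tr : t < r by near: t; exact: nbhs_right_lt.
    have tk : t < k^-1 by near: t; apply: nbhs_right_lt; rewrite invr_gt0.
    have Nn : (N0 <= n t)%N by near: t; exact: trunc_index_near.
    have := hk (sg * t) (n t); have := hN0 (sg * t) (n t); rewrite !sgn//.
    move=> /(_ (ltW tr) Nn) s1 s2; have {}s2 := s2 _ s1.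
    have ktm : k * t <= 1 by rewrite -ler_pdivlMl// mulr1 ltW.
    have {}s2 := s2 ktm.
    rewrite sub0r normrN -mulrBl normrM normfV (gtr0_norm (growth_gt0 beta_gt0 _)).
    apply: (@le_trans _ _ (2 * (k * t + c0 * ((n t).+1%:R^-1 + t)) *
        (normc (h (sg * t) (n t)) / w (n t)))).
      by rewrite mulrA ler_pM2r ?invr_gt0 ?growth_gt0.
    apply: (le_trans (ler_norm _)); rewrite -normrN -sub0r.
    by near: t; move/cvgrPdist_le : g2; apply.
  rewrite -[X in _ --> X]add0r.
  rewrite [X in X @ _](_ : _ = (fun t => am (sg * t) (n t) / w (n t) -
     normc (h (sg * t) (n t)) / w (n t)) \+ (fun t => normc (h (sg * t) (n t)) / w (n t))).
    exact: cvgD.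
  by apply/funext => t /=; rewrite subrK.
apply: cvg_trans (cvgM (cvgM f4 f1) f2); apply: near_eq_cvg; near=> t.
have t0 : 0 < t by near: t; exact: nbhs_right_gt.
rewrite /= -/(n t) powRM ?(ltW t0)//.
have p1 : (n t).+1%:R `^ beta != 0 by rewrite gt_eqF ?powR_gt0 ?ltr0Sn.
have w1 : w (n t) != 0 by rewrite gt_eqF ?growth_gt0.
by field; rewrite p1 w1.
Unshelve. all: by end_near. Qed.

Lemma amp_power_limit (a : R -> R) (r sg : R) : 0 < r -> `|sg| = 1 ->
  (forall mu, 0 < `|mu| < r -> forall eta, 0 < eta ->
    exists n0, forall n, (n0 <= n)%N -> `|am mu n - a mu| <= eta) ->
  exists2 L : R, 0 < L & a (sg * t) * t `^ beta @[t --> (0 : R)^'+] --> L.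
Proof.
move=> r0 sg1 ha.
have [r1 [C [r10 C0 tail]]] :=
  amp_tail z0_unit kappa_unit z0_im z0_re beta_gt0 qQ ysol y_neq0.
have s0 : 0 < `|Im z0| by rewrite normr_gt0.
apply: cvg_of_relative_approximation => x /andP[x0 x4].
(* At the matching index [(n + 1) t >= c / 2 = 2 * C / x], so the term [C / (t (n + 1))] of
   [amp_tail] is at most [x / 2]; [N5] keeps [C * Q n] below the other half. *)
pose T := 4 * C / (x * `|Im z0|).
have T0 : 0 < T by rewrite /T divr_gt0 ?mulr_gt0.
have xC : 0 < x / (2 * C) by rewrite divr_gt0 ?mulr_gt0.
have [N5 hN5] := Q0 xC.
have [X X0 cX] := amp_along_index sg1 T0.
exists X => // eta eta0.
set c := T * `|Im z0|; have cp : 0 < c by rewrite mulr_gt0.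
have cE : c = 4 * C / x by rewrite /c /T; field; rewrite !gt_eqF.
near=> t.
have t0 : 0 < t by near: t; exact: nbhs_right_gt.
have tr : t < r by near: t; exact: nbhs_right_lt.
have tr1 : t < r1 by near: t; exact: nbhs_right_lt.
have tc : t < c / 2 by near: t; apply: nbhs_right_lt; rewrite divr_gt0.
have Nn : (N5 <= trunc_index c t)%N by near: t; exact: trunc_index_near.
have /andP[b1 b2] : c - t <= (trunc_index c t).+1%:R * t <= c
  by near: t; exact: trunc_index_bounds.
have Aeta : `|X - am (sg * t) (trunc_index c t) * t `^ beta| <= eta.
  by near: t; move/cvgrPdist_le : cX; apply.
set n := trunc_index c t in Nn b1 b2 Aeta.
have sgt : `|sg * t| = t by rewrite normrM sg1 mul1r gtr0_norm.
exists (am (sg * t) n * t `^ beta); split.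
  by rewrite distrC.
have := tail (sg * t); rewrite sgt t0 tr1 => /(_ isT) [_ tl].
have small : C * ((t * n.+1%:R)^-1 + Q n) <= x.
  have k1 : (t * n.+1%:R)^-1 <= x / (2 * C).
    rewrite invf_ple; [|by rewrite posrE mulr_gt0|by rewrite posrE].
    rewrite invf_div [leRHS]mulrC; apply: le_trans b1.
    have -> : 2 * C / x = c / 2 by rewrite cE; field; rewrite gt_eqF.
    by move: tc; move: (c) => c'; lra.
  have -> : x = C * (x / (2 * C) + x / (2 * C)) by field; rewrite gt_eqF.
  by rewrite ler_pM2l// lerD// hN5.
have {}tl m : (n <= m)%N -> `|am (sg * t) m - am (sg * t) n| <= x * am (sg * t) n.
  move=> nm; apply: (le_trans (tl n m nm _)); first by apply: (le_trans small); lra.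
  by rewrite ler_wpM2r// amp_ge0.
rewrite mulrA -mulrBl normrM (ger0_norm (powR_ge0 _ _)) ler_wpM2r ?powR_ge0//.
apply/ler_addgt0Pr => e e0.
have := ha (sg * t); rewrite sgt t0 tr => /(_ isT e e0)[n0 hn0].
have h1 := hn0 (maxn n n0) (leq_maxr _ _).
have h2 := tl (maxn n n0) (leq_maxl _ _).
have := ler_normD (a (sg * t) - am (sg * t) (maxn n n0)) (am (sg * t) (maxn n n0) - am (sg * t) n).
rewrite addrA subrK => /le_trans; apply.
by rewrite distrC; lra.
Unshelve. all: by end_near. Qed.

End amplitude_asymptotics.

(** * Subordinacy at the critical energy *)

Lemma solves_prescribed (R : realType) (b : nat -> R) (la : R) N (u v : R) :
  exists y : nat -> R, [/\ solves y b la, y N = u & y N.+1 = v].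
Proof.
elim: N u v => [|N IH] u v; last first.
  have [y [ys y0 y1]] := IH ((la - b N.+1) * u - v) u.
  by exists y; split => //; rewrite ys y0 y1; ring.
pose st n (p : R * R) := (p.2, (la - b n.+1) * p.2 - p.1).
pose z := fix z n := if n is m.+1 then st m (z m) else (u, v).
by exists (fun n => (z n).1); split.
Qed.

Section subordinacy.
Context {R : realType}.
Variables (z0 kappa : R[i]) (beta d : R) (q Q : nat -> R).
Hypothesis z0_unit : z0 * conjc z0 = 1.
Hypothesis kappa_unit : kappa * conjc kappa = 1.
Hypothesis z0_im : Im z0 != 0.
Hypothesis beta_gt0 : 0 < beta.
Hypothesis qQ : forall N n, \sum_(N <= j < n) `|q j.+1| <= Q N.
Hypothesis Q0 : forall eta : R, 0 < eta -> exists n0, forall n, (n0 <= n)%N -> Q n <= eta.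
Hypothesis d_gt0 : 0 < d.
Hypothesis dist0 : forall u, u \in [:: z0 ^+ 2; conjc z0 ^+ 2;
    conjc z0 ^+ 2 * conjc z0 ^+ 2] -> d <= normc (1 - conjc u).

Local Notation w := (growth beta).
Local Notation c0 := (res_c z0 beta d).
Local Notation b := (resonant_potential z0 kappa beta q).
Local Notation h u n := (red z0 kappa beta 0 u n).

Definition has_growth (u : nat -> R) (K : R) := forall eta, 0 < eta ->
  exists n0, forall n, (n0 <= n)%N -> normc (h u n - (K * w n)%:C) / w n <= eta.

Let w0 n : 0 < w n. Proof. exact: growth_gt0. Qed.

Lemma frame_red_bounds : exists n0, forall n u, (n0 <= n)%N -> solves u b (2 * Re z0) ->
  [/\ normc (frame z0 u n) <= 2 * normc (h u n),
      normc (h u n) <= 2 * normc (frame z0 u n) &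
      normc (frame z0 u n - res_G z0 kappa beta 0 u n) <=
        c0 * n.+1%:R^-1 * normc (frame z0 u n)].
Proof.
have [r r0 [n0 hn]] := res_small z0 beta_gt0 d_gt0.
exists n0 => n u nn usol.
have us : solves u b (2 * Re z0 + 0) by rewrite addr0.
have small := hn 0 n _ nn; rewrite normr0 in small; have {}small := small (ltW r0).
have [h1 h2 _] := resonant_step z0_unit kappa_unit z0_im beta_gt0 d_gt0 dist0 us
  (etrans (congr1 (fun t => _ * (_ + t) <= _) (normr0 R)) small).
rewrite (normc_red _ _ kappa_unit); rewrite normr0 !addr0 in h1 small; split => //.
have := normc_lipschitz (res_G z0 kappa beta 0 u n) (frame z0 u n).
rewrite normcB => k.
have := ler_wpM2r (normc_ge0 (frame z0 u n)) small.
have := normc_ge0 (frame z0 u n).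
by move: h1 k; move: (c0 * _) (normc _) (normc _) (normc _) => *; lra.
Qed.

(** Data at a large [N] are prescribed so that the frame equals [kappa]; the reduced frame is then
    close to 1, the growing direction, and the quantitative clause of [zero_energy_solution] forces
    [K > 0]. *)
Lemma growing_solution : exists (u : nat -> R) (K : R),
  [/\ solves u b (2 * Re z0), 0 < K & has_growth u K].
Proof.
have [N1 hN1] := zero_energy_solution z0_unit kappa_unit z0_im beta_gt0 qQ Q0 d_gt0 dist0.
have [N2 hN2] := frame_red_bounds.
have c1 : 0 < c0 + 1 by rewrite ltr_wpDl// res_c_ge0.
have e8 : 0 < 1 / 8 / (c0 + 1) :> R by rewrite !divr_gt0.
have [N3 hN3] := small_index e8.
pose N := maxn N1 (maxn N2 N3).
have NN1 : (N1 <= N)%N by rewrite leq_maxl.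
have NN2 : (N2 <= N)%N by rewrite /N !leq_max leqnn orbT.
have NN3 : (N3 <= N)%N by rewrite /N !leq_max leqnn !orbT.
clearbody N.
(* [xi] undoes the rotation in [frame]; [vN] and [vN1] are the real solution of
   [vN1 - conjc z0 * vN = xi]. *)
pose xi := kappa * z0 ^+ N.+1.
pose vN := Im xi / Im z0; pose vN1 := Re xi + Re z0 * vN.
have [u [us u0 u1]] := solves_prescribed b (2 * Re z0) N vN vN1.
have FN : frame z0 u N = kappa.
  rewrite /frame u0 u1.
  have -> : vN1%:C - conjc z0 * vN%:C = xi.
    have gen (x : R[i]) : (Re x + Re z0 * (Im x / Im z0))%:C -
        conjc z0 * (Im x / Im z0)%:C = x.
      case: x => a c /=; case: (z0) z0_im => x t /= t0.
      by simpc; congr (_ +i* _); field.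
    exact: gen.
  by rewrite /xi -mulrA -exprMn z0_unit expr1n mulr1.
have [_ _] := hN2 N u NN2 us; rewrite FN (normc_unit kappa_unit) mulr1 => dG.
have h1 : normc (h u N - 1) <= 1 / 8.
  have -> : h u N - 1 = conjc kappa * (res_G z0 kappa beta 0 u N - kappa).
    by rewrite mulrBr (mulrC _ kappa) kappa_unit.
  rewrite normcM normc_conj (normc_unit kappa_unit) mul1r normcB.
  apply: (le_trans dG); apply: (@le_trans _ _ (c0 * (1 / 8 / (c0 + 1)))).
    by rewrite ler_wpM2l ?res_c_ge0// hN3.
  by rewrite mulrCA ler_piMr// ler_pdivrMr// mul1r lerDl.
have [K hK1 hK] := hN1 N u NN1 us.
exists u, K; split => //.
have r1 : 7 / 8 <= Re (h u N).
  have := le_trans (normcRe _) h1; rewrite ler_norml => /andP[k _].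
  by move: k; case: (h u N) => x t /=; lra.
have r2 : normc (h u N) <= 9 / 8.
  by have := normc_lipschitz (h u N) 1; rewrite normc1; lra.
have wN := w0 N.
have : 0 < K * w N.
  have k1 : `|K - Re (h u N) / w N| * w N <= 1 / 4 * normc (h u N).
    by rewrite -ler_pdivlMr// (le_trans hK1)// mulrA.
  have : - (`|K - Re (h u N) / w N| * w N) <= (K - Re (h u N) / w N) * w N.
    by rewrite -mulNr ler_pM2r// lerNl ler_normr lexx orbT.
  rewrite mulrBl divfK ?gt_eqF//; lra.
by rewrite pmulr_lgt0.
Qed.

Lemma frame_coord_bound u n :
  `|u n| <= `|Im z0|^-1 * normc (frame z0 u n) /\
  `|u n.+1| <= (1 + `|Im z0|^-1) * normc (frame z0 u n).
Proof.
have nF : normc (frame z0 u n) = normc ((u n.+1)%:C - conjc z0 * (u n)%:C).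
  by rewrite /frame normcM normcX normc_conj (normc_unit z0_unit) expr1n mulr1.
have s0 : 0 < `|Im z0| by rewrite normr_gt0.
have k1 : `|u n| <= `|Im z0|^-1 * normc (frame z0 u n).
  rewrite mulrC ler_pdivlMr// nF mulrC -normrM; apply: le_trans (normcIm _).
  by rewrite le_eqVlt; apply/orP; left; apply/eqP; congr (`|_|); case: (z0) => x t /=; ring.
split => //; rewrite mulrDl mul1r.
have := normc_lipschitz (u n.+1)%:C (conjc z0 * (u n)%:C).
rewrite (normcM (conjc z0)) normc_conj (normc_unit z0_unit) mul1r !normc_real -nF; lra.
Qed.

Lemma frame_coord_lower u n :
  normc (frame z0 u n) ^+ 2 <= 2 * (u n ^+ 2 + u n.+1 ^+ 2).
Proof.
have nF : normc (frame z0 u n) = normc ((u n.+1)%:C - conjc z0 * (u n)%:C).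
  by rewrite /frame normcM normcX normc_conj (normc_unit z0_unit) expr1n mulr1.
have := le_normcB (u n.+1)%:C (conjc z0 * (u n)%:C).
rewrite normcM normc_conj (normc_unit z0_unit) mul1r !normc_real -nF => h.
have : normc (frame z0 u n) ^+ 2 <= (`|u n.+1| + `|u n|) ^+ 2.
  by rewrite ler_sqr ?nnegrE ?normc_ge0// addr_ge0.
rewrite -[u n ^+ 2](real_normK (num_real _)) -[u n.+1 ^+ 2](real_normK (num_real _)).
by have := sqr_ge0 (`|u n.+1| - `|u n|); lra.
Qed.

(** The frame bounds [u n ^+ 2 + u n.+1 ^+ 2] from below but not a single value, so each
    [p n.+1 ^+ 2] is compared with a pair; the pairs overlap, which doubles [eta / 4]. The finitely
    many early terms of [p] are absorbed by the divergent sum of squares of [u]. *)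
Lemma square_sums_ratio (p u : nat -> R) (K eta : R) :
  solves p b (2 * Re z0) -> solves u b (2 * Re z0) -> has_growth p 0 ->
  has_growth u K -> 0 < K -> 0 < eta ->
  exists M0, forall M, (M0 <= M)%N ->
    0 < \sum_(0 <= n < M) u n ^+ 2 /\
    \sum_(0 <= n < M) p n ^+ 2 <= eta * \sum_(0 <= n < M) u n ^+ 2.
Proof.
move=> ps us hp hu K0 eta0.
have [N1 hN1] := frame_red_bounds.
have K2 : 0 < K / 2 by rewrite divr_gt0.
have [N2 hN2] := hu _ K2.
set s := `|Im z0|^-1; have s0 : 0 < s by rewrite invr_gt0 normr_gt0.
have uw n : (maxn N1 N2 <= n)%N -> K ^+ 2 / 32 * w n ^+ 2 <= u n ^+ 2 + u n.+1 ^+ 2.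
  rewrite geq_max => /andP[n1 n2].
  have [_ k1 _] := hN1 n u n1 us.
  have := hN2 n n2; rewrite ler_pdivrMr ?w0// => k2.
  have k3 := normc_lipschitz (K * w n)%:C (h u n); rewrite normcB normc_real in k3.
  rewrite gtr0_norm ?mulr_gt0// in k3.
  have k4 : K / 4 * w n <= normc (frame z0 u n) by lra.
  have k5 : (K / 4 * w n) ^+ 2 <= normc (frame z0 u n) ^+ 2.
    by rewrite ler_sqr ?nnegrE ?normc_ge0// mulr_ge0 ?(ltW (w0 n))// divr_ge0// ltW.
  by have := frame_coord_lower u n; lra.
(* Chosen so that [(2 * (1 + s)) ^+ 2 * del] equals [eta / 4 * (K ^+ 2 / 32)], that is, [eta / 4]
   times the constant in [uw]. *)
pose del := eta * (K ^+ 2 / 32) / 4 / (2 * (1 + s)) ^+ 2.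
have s2 : 0 < 2 * (1 + s) by rewrite mulr_gt0// addr_gt0.
have K32 : 0 < K ^+ 2 / 32 by rewrite divr_gt0// exprn_gt0.
have del0 : 0 < del.
  exact: (divr_gt0 (divr_gt0 (mulr_gt0 eta0 K32) (ltr0Sn R 3)) (exprn_gt0 2 s2)).
have sd0 : 0 < Num.sqrt del by rewrite sqrtr_gt0.
have [N3 hN3] := hp _ sd0.
pose N := maxn (maxn N1 N2) N3.
have pw n : (N <= n)%N -> p n.+1 ^+ 2 <= eta / 4 * (u n ^+ 2 + u n.+1 ^+ 2).
  rewrite /N geq_max => /andP[n12 n3].
  have [k1 _ _] := hN1 n p (leq_trans (leq_maxl _ _) n12) ps.
  have := hN3 n n3; rewrite mul0r subr0 ler_pdivrMr ?w0// => k2.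
  have [_ k3] := frame_coord_bound p n.
  have k4 : `|p n.+1| <= 2 * (1 + s) * (Num.sqrt del * w n).
    apply: (le_trans k3); rewrite -/s -mulrA mulrCA ler_pM2l ?addr_gt0//.
    by apply: (le_trans k1); rewrite ler_pM2l.
  have k5 : p n.+1 ^+ 2 <= (2 * (1 + s) * (Num.sqrt del * w n)) ^+ 2.
    rewrite -[leLHS]real_normK ?num_real// ler_sqr ?nnegrE//.
    by rewrite mulr_ge0 ?(ltW s2)// mulr_ge0 ?sqrtr_ge0// ltW.
  apply: (le_trans k5); rewrite !exprMn sqr_sqrtr ?(ltW del0)//.
  have -> : 2 ^+ 2 * (1 + s) ^+ 2 * (del * w n ^+ 2) = eta / 4 * (K ^+ 2 / 32 * w n ^+ 2).
    by rewrite /del; field; rewrite gt_eqF// addr_gt0.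
  by rewrite ler_wpM2l ?divr_ge0 ?(ltW eta0)// uw.
clearbody N.
pose A := \sum_(0 <= n < N.+1) p n ^+ 2.
(* The last square of [u] has entered one pair only, hence the correction
   [- eta / 4 * u (N + k) ^+ 2], which the next step uses up. *)
have P1 k : \sum_(0 <= n < N.+1 + k) p n ^+ 2 <= A + eta / 2 * \sum_(0 <= n < N.+1 + k) u n ^+ 2
  - eta / 4 * u (N + k)%N ^+ 2.
  elim: k => [|k IH].
    rewrite !addn0 -/A big_nat_recr //=.
    have : 0 <= \sum_(0 <= i < N) u i ^+ 2 by apply: sumr_ge0 => i _; exact: sqr_ge0.
    have := sqr_ge0 (u N); nra.
  rewrite !addnS [leLHS]big_nat_recr //= [X in eta / 2 * X]big_nat_recr //=.
  have := pw (N + k)%N (leq_addr _ _); rewrite addSn in IH *; lra.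
have sq0 k : 0 <= u k ^+ 2 by exact: sqr_ge0.
have Umono m n : (m <= n)%N -> \sum_(0 <= k < m) u k ^+ 2 <= \sum_(0 <= k < n) u k ^+ 2.
  move=> mn; rewrite -(subnKC mn); elim: (n - m)%N => [|k IH]; first by rewrite addn0.
  by rewrite addnS big_nat_recr //= (le_trans IH)// lerDl.
have U0 k : K ^+ 2 / 32 * k%:R <= \sum_(0 <= n < maxn N1 N2 + k.*2) u n ^+ 2.
  elim: k => [|k IH]; first by rewrite mulr0 sumr_ge0.
  rewrite doubleS !addnS !big_nat_recr //= -[k.+1%:R]natr1 mulrDr mulr1.
  have := uw (maxn N1 N2 + k.*2)%N (leq_addr _ _).
  have w1 : 1 <= w (maxn N1 N2 + k.*2)%N ^+ 2 by rewrite exprn_ege1// growth_ge1.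
  have := ler_wpM2l (ltW K32) w1; rewrite mulr1; lra.
have U1 : exists M1, forall M, (M1 <= M)%N -> A + 1 <= eta / 2 * \sum_(0 <= n < M) u n ^+ 2.
  pose k := (Num.truncn ((A + 1) / (eta / 2) / (K ^+ 2 / 32))).+1.
  exists (maxn N1 N2 + k.*2)%N => M /Umono Mle.
  rewrite [leRHS]mulrC -ler_pdivrMr ?divr_gt0//; apply: le_trans Mle; apply: le_trans (U0 k).
  by rewrite [leRHS]mulrC -ler_pdivrMr//; exact/ltW/truncnS_gt.
have [M1 hM1] := U1.
exists (maxn M1 N.+1) => M; rewrite geq_max => /andP[m1 m2].
have A0 : 0 <= A by apply: sumr_ge0 => i _; exact: sqr_ge0.
have k1 := hM1 M m1.
split; first by rewrite -(pmulr_rgt0 _ (divr_gt0 eta0 (ltr0Sn R 1))); lra.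
have := P1 (M - N.+1)%N; rewrite subnKC//.
have : 0 <= eta / 4 * u (N + (M - N.+1))%N ^+ 2 by rewrite mulr_ge0 ?sqr_ge0// divr_ge0// ltW.
lra.
Qed.

(** [p] and the growing solution [u] form a basis of the complex solutions: [v = s * p + t * u],
    where [t != 0] by independence. The square sums of [v] are at least [|t|^2 / 2] times those of
    [u] minus [|s|^2] times those of [p], and [square_sums_ratio] concludes. *)
Lemma subordinate_of_no_growth (p : nat -> R) : p 0 = 1 -> solves p b (2 * Re z0) ->
  has_growth p 0 -> subordinate b (2 * Re z0)%:C (fun n => (p n)%:C).
Proof.
move=> p0 ps hp.
have [u [K [us K0 hu]]] := growing_solution.
have ratio := fun eta => square_sums_ratio (eta := eta) ps us hp hu K0.
have realsol (v : nat -> R) : solves v b (2 * Re z0) ->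
    recurrence_solution b (2 * Re z0)%:C (fun n => (v n)%:C).
  move=> vs n /=; rewrite vs -(@realcM R) -(@realcD R) -(@realcM R) -(@realcD R).
  by congr (_%:C); ring.
split; [exact: realsol|by exists 0; rewrite p0 oner_neq0|move=> v vs indep].
(* A vanishing determinant would give [u = u 0 * p], so that the square sums of [u] are [u 0 ^+ 2]
   times those of [p]; the constant [(1 + u 0 ^+ 2)^-1 / 2] makes this contradict [ratio], whether
   or not [u 0] vanishes. *)
have det0 : u 1 - u 0 * p 1 != 0.
  apply/negP => /eqP det.
  have up n : u n = u 0 * p n /\ u n.+1 = u 0 * p n.+1.
    elim: n => [|n [IH1 IH2]]; first by rewrite p0 mulr1; split => //; lra.
    by split => //; rewrite us ps IH1 IH2; ring.
  have [M0 hM] := ratio ((1 + u 0 ^+ 2)^-1 / 2) ltac:(by rewrite divr_gt0// invr_gt0 ltr_pwDl// sqr_ge0).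
  have [S0 S1] := hM M0 (leqnn _).
  have e : \sum_(0 <= n < M0) u n ^+ 2 = u 0 ^+ 2 * \sum_(0 <= n < M0) p n ^+ 2.
    by rewrite mulr_sumr; apply: eq_bigr => i _; rewrite (up i).1 exprMn.
  move: S0 S1; rewrite e; move: (\sum_(_ <= _ < _) _) => P S0.
  have u00 : 0 <= u 0 ^+ 2 by exact: sqr_ge0.
  have t : (1 + u 0 ^+ 2)^-1 / 2 * (u 0 ^+ 2 * P) <= P / 2.
    have P0 : 0 <= P.
      rewrite leNgt; apply/negP => Pn; move: S0; rewrite ltNge mulr_ge0_le0// ltW//.
    rewrite -mulrA mulrCA [leRHS]mulrC ler_pM2l ?invr_gt0//.
    rewrite ler_pdivrMl ?ltr_pwDl// ler_wpM2r// lerDr//.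
  have Pp : 0 < P.
    rewrite lt_def; apply/andP; split; last by rewrite leNgt; apply/negP => Pn;
      move: S0; rewrite ltNge mulr_ge0_le0// ltW.
    by apply: contraTneq S0 => ->; rewrite mulr0 ltxx.
  by move=> S1; have := le_trans S1 t; lra.
pose t : R[i] := (v 1 - v 0 * (p 1)%:C) / (u 1 - u 0 * p 1)%:C.
pose s : R[i] := v 0 - t * (u 0)%:C.
have dC : (u 1 - u 0 * p 1)%:C != 0 :> R[i] by rewrite realc_eq0.
have vE n : v n = s * (p n)%:C + t * (u n)%:C /\ v n.+1 = s * (p n.+1)%:C + t * (u n.+1)%:C.
  elim: n => [|n [IH1 IH2]].
    split; first by rewrite /s p0 mulr1 subrK.
    rewrite /s.
    have -> : (v 0 - t * (u 0)%:C) * (p 1)%:C + t * (u 1)%:C =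
      v 0 * (p 1)%:C + t * (u 1 - u 0 * p 1)%:C by rewrite (@realcB R) (@realcM R); ring.
    by rewrite /t divfK// addrC subrK.
  split => //.
  have rp := realsol p ps n; have ru := realsol u us n; have rv := vs n.
  rewrite /= in rp ru rv.
  have e (x y z a : R[i]) : x + y + z = a -> z = a - x - y by move=> <-; ring.
  by rewrite (e _ _ _ _ rv) (e _ _ _ _ rp) (e _ _ _ _ ru) IH1 IH2; ring.
clearbody s t.
have t0 : t != 0.
  apply/negP => /eqP t0.
  have [] := indep s (-1).
    by move=> n; rewrite (vE n).1 t0 mul0r addr0 mulN1r subrr.
  by move=> _ /eqP; rewrite oppr_eq0 oner_eq0.
have nt : 0 < normc t ^+ 2.
  rewrite exprn_even_gt0 //=; apply: contra t0 => /eqP/eq0_normc ->; exact: eqxx.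
apply/cvgrPdist_le => eta eta0.
(* The second bound gives [|s|^2 * P <= |t|^2 / 4 * U], leaving [|t|^2 / 4 * U] below the square sum
   of [v]; the first turns the quotient into [eta]. *)
pose ep := Num.min (eta * normc t ^+ 2 / 4) (normc t ^+ 2 / 4 / (normc s ^+ 2 + 1)).
have s1 : 0 < normc s ^+ 2 + 1 by rewrite ltr_wpDl ?sqr_ge0.
have ep0 : 0 < ep by rewrite lt_min !divr_gt0// mulr_gt0.
have [M0 hM] := ratio ep ep0.
exists M0 => // M /= MM; have [U0 PU] := hM M MM.
have -> : \sum_(0 <= n < M) normc (p n)%:C ^+ 2 = \sum_(0 <= n < M) p n ^+ 2.
  by apply: eq_bigr => i _; rewrite normc_real real_normK ?num_real.
have P0 : 0 <= \sum_(0 <= n < M) p n ^+ 2 by apply: sumr_ge0 => i _; exact: sqr_ge0.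
have V : normc t ^+ 2 / 2 * \sum_(0 <= n < M) u n ^+ 2 - normc s ^+ 2 * \sum_(0 <= n < M) p n ^+ 2
   <= \sum_(0 <= n < M) normc (v n) ^+ 2.
  rewrite !mulr_sumr -sumrB; apply: ler_sum => i _; rewrite (vE i).1.
  have := normc_lipschitz (t * (u i)%:C) (s * (p i)%:C + t * (u i)%:C).
  have -> : t * (u i)%:C - (s * (p i)%:C + t * (u i)%:C) = - (s * (p i)%:C) by ring.
  rewrite normcN !normcM !normc_real -[u i ^+ 2]real_normK ?num_real// -[p i ^+ 2]real_normK ?num_real//.
  have := normc_ge0 (s * (p i)%:C + t * (u i)%:C).
  have := mulr_ge0 (normc_ge0 t) (normr_ge0 (u i)).
  have := mulr_ge0 (normc_ge0 s) (normr_ge0 (p i)).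
  rewrite -exprMn [_ / 2 * _]mulrAC -exprMn.
  move: (normc (s * (p i)%:C + t * (u i)%:C)) (normc t * `|u i|) (normc s * `|p i|) => e a c c0' a0 e0 h.
  have : a ^+ 2 <= (e + c) ^+ 2 by rewrite ler_sqr ?nnegrE// addr_ge0.
  by have := sqr_ge0 (e - c); nra.
have epb : ep * (normc s ^+ 2 + 1) <= normc t ^+ 2 / 4.
  by rewrite -ler_pdivlMr// ge_min lexx orbT.
have epe : ep <= eta * normc t ^+ 2 / 4 by rewrite ge_min lexx.
move: U0 PU P0 V; move: (\sum_(_ <= _ < _) u _ ^+ 2) (\sum_(_ <= _ < _) p _ ^+ 2)
  (\sum_(_ <= _ < _) normc _ ^+ 2) => U P W U0 PU P0 V.
have sP : normc s ^+ 2 * P <= normc t ^+ 2 / 4 * U.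
  apply: (@le_trans _ _ (normc s ^+ 2 * (ep * U))); first by rewrite ler_wpM2l ?sqr_ge0.
  rewrite mulrA ler_pM2r//; apply: le_trans epb; rewrite mulrC ler_wpM2l ?(ltW ep0)// lerDl//.
have WU : normc t ^+ 2 / 4 * U <= W by lra.
have W0 : 0 < W by apply: lt_le_trans WU; rewrite mulr_gt0// divr_gt0.
rewrite sub0r normrN ger0_norm ?divr_ge0 ?(ltW W0)// ler_pdivrMr//.
apply: (le_trans PU); apply: (@le_trans _ _ (eta * (normc t ^+ 2 / 4 * U))).
  by apply: le_trans (ler_wpM2r (ltW U0) epe) _; rewrite -!mulrA.
by rewrite ler_pM2l.
Qed.

End subordinacy.

(** * Moments of the energy polynomials and the semicircle law *)

Section chebyshev.
Context {R : realType}.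

(* [cheb k.+1] is the Chebyshev polynomial of the second kind in the variable
   x = 2 cos t, i.e. sin ((k+1) t) / sin t; [cheb 0 = 0]. *)
Fixpoint cheb (k : nat) : {poly R} :=
  match k with
  | 0 => 0
  | l.+1 => match l with
            | 0 => 1
            | m.+1 => 'X * cheb l - cheb m
            end
  end.

Lemma chebS k : cheb k.+2 = 'X * cheb k.+1 - cheb k.
Proof. by []. Qed.

Lemma cheb_sin k t : (cheb k).[2 * cos t] * sin t = sin (k%:R * t).
Proof.
suff [] : (cheb k).[2 * cos t] * sin t = sin (k%:R * t) /\
  (cheb k.+1).[2 * cos t] * sin t = sin (k.+1%:R * t) by [].
elim: k => [|k [IH1 IH2]]; first by rewrite /= horner0 hornerC !mul0r sin0 !mul1r.
split => //; rewrite chebS hornerD hornerN hornerM hornerX mulrDl mulNr -mulrA IH2 IH1.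
set A := k.+1%:R * t.
have -> : k.+2%:R * t = A + t by rewrite /A -natr1 mulrDl mul1r.
have -> : k%:R * t = A + - t by rewrite /A -natr1 mulrDl mul1r addrK.
by rewrite !sinD sinN cosN; ring.
Qed.

Lemma cheb_monic k : cheb k.+1 \is monic /\ size (cheb k.+1) = k.+1.
Proof.
suff [] : (cheb k.+1 \is monic /\ size (cheb k.+1) = k.+1) /\
  (cheb k.+2 \is monic /\ size (cheb k.+2) = k.+2) by [].
elim: k => [|k [[m1 s1] [m2 s2]]].
  rewrite /= subr0 mulr1 monic1 monicX size_poly1 size_polyX; by [].
split => //; rewrite chebS.
have sX : size ('X * cheb k.+2) = k.+3.
  by rewrite mulrC size_mulX ?monic_neq0// s2.
have lt : (size (- cheb k.+1)%R < size ('X * cheb k.+2)%R)%N.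
  by rewrite size_polyN s1 sX.
split; last by rewrite size_polyDl.
by rewrite monicE lead_coefDl// mulrC lead_coefMX (monicP m2).
Qed.

(** A monic sequence with one polynomial in each degree spans all polynomials. It is applied both to
    the Chebyshev and to the orthogonal polynomials. *)
Lemma monic_sequence_ind (e : nat -> {poly R}) (P : {poly R} -> Prop) :
  (forall n, e n \is monic /\ size (e n) = n.+1) ->
  P 0 -> (forall p q, P p -> P q -> P (p + q)) -> (forall (a : R) p, P p -> P (a *: p)) ->
  (forall k, P (e k)) -> forall q, P q.
Proof.
move=> he P0 PD PZ PC q; have [n] := ubnP (size q); elim: n q => // n IH q.
rewrite ltnS leq_eqVlt => /orP[/eqP sq|]; last by move=> h; apply: IH.
case: n sq IH => [|n] sq IH; first by move/eqP: sq; rewrite size_poly_eq0 => /eqP ->.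
have [mC sC] := he n.
have -> : q = (q - lead_coef q *: e n) + lead_coef q *: e n by rewrite subrK.
apply: PD; last exact: PZ.
apply: IH; rewrite ltnS; apply/leq_sizeP => j; rewrite leq_eqVlt => /orP[/eqP <-|nj].
  rewrite coefB coefZ lead_coefE sq /=.
  by move/monicP: mC; rewrite lead_coefE sC /= => ->; rewrite mulr1 subrr.
by rewrite coefB coefZ !nth_default ?mulr0 ?subrr ?sC ?sq.
Qed.

End chebyshev.

Section orthogonal_polynomials.
Context {R : realType}.
Variables (b : nat -> R) (L : {poly R} -> R).
Hypothesis LD : forall p q, L (p + q) = L p + L q.
Hypothesis LZ : forall (a : R) p, L (a *: p) = a * L p.
Local Notation p := (orthpoly b).
Hypothesis orth : forall m n, L (p m * p n) = (m == n)%:R.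
Hypothesis b0 : b n @[n --> \oo] --> (0 : R).

Lemma orthpolySS n : p n.+2 = ('X - (b n.+1)%:P) * p n.+1 - p n.
Proof. by []. Qed.

Lemma orthpolyX n : 'X * p n.+1 = p n.+2 + b n.+1 *: p n.+1 + p n.
Proof. by rewrite orthpolySS mulrBl mul_polyC; ring. Qed.

Let LN q : L (- q) = - L q.
Proof. by rewrite -scaleN1r LZ mulN1r. Qed.

(* the entry (i, j) of [cheb k] of the free Jacobi matrix on the integers *)
Let tau k i j : R := ((((i - j) + (j - i) < k) && odd (i + j + k))%N)%:R.

(** The Chebyshev recurrence, multiplication by the free matrix being the sum over two neighbours.
    Row [i.+1] is used so that the lower neighbour exists in [nat]; [tau] is invariant under a
    simultaneous shift of [i] and [j]. *)
Lemma tau_rec k i j :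
  tau k.+2 i.+1 j.+1 = tau k.+1 i.+2 j.+1 + tau k.+1 i j.+1 - tau k i.+1 j.+1.
Proof.
apply/eqP; rewrite eq_sym subr_eq -!natrD; apply/eqP; congr (_%:R).
rewrite !(addnS, addSn, oddS, negbK, subSS).
have [] := boolP (odd (i + j + k)) => e; rewrite ?(andbF, andbT)//.
lia.
Qed.

(** These are entries of [cheb k] of the Jacobi matrix around the index [N]. As [b] tends to 0 the
    recurrence for ['X * p n.+1] becomes the free one, and a two-step induction on [k] carries this
    to the limit. *)
Lemma cheb_moment_limit k i j :
  L (cheb k * p (N + i)%N * p (N + j)%N) @[N --> \oo] --> tau k i j.
Proof.
suff [] : (forall i j, L (cheb k * p (N + i)%N * p (N + j)%N) @[N --> \oo] --> tau k i j) /\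
  (forall i j, L (cheb k.+1 * p (N + i)%N * p (N + j)%N) @[N --> \oo] --> tau k.+1 i j) by [].
elim: k {i j} => [|k [IH1 IH2]].
  split=> i j.
    rewrite (_ : tau 0 i j = 0) ?/tau ?ltn0//.
    have L0 : L 0 = 0 by rewrite -(scale0r 0) LZ mul0r.
    under eq_fun do rewrite /= !mul0r L0.
    exact: cvg_cst.
  under eq_fun do rewrite /= mul1r orth eqn_add2l.
  rewrite (_ : tau 1 i j = (i == j)%:R); first exact: cvg_cst.
  rewrite /tau; congr (_%:R).
  by lia.
split=> // i j.
suff H : L (cheb k.+2 * p (N + i.+1)%N * p (N + j.+1)%N) @[N --> \oo] --> tau k.+2 i.+1 j.+1.
  rewrite -(cvg_shiftS (fun N => L (cheb k.+2 * p (N + i)%N * p (N + j)%N))).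
  have -> : tau k.+2 i j = tau k.+2 i.+1 j.+1 by rewrite /tau !subSS; congr (_%:R); lia.
  by under eq_fun do rewrite !addSnnS.
rewrite tau_rec.
have e N : L (cheb k.+2 * p (N + i.+1)%N * p (N + j.+1)%N) =
  L (cheb k.+1 * p (N + i.+2)%N * p (N + j.+1)%N) + L (cheb k.+1 * p (N + i)%N * p (N + j.+1)%N)
  - L (cheb k * p (N + i.+1)%N * p (N + j.+1)%N)
  + b (N + i.+1)%N * L (cheb k.+1 * p (N + i.+1)%N * p (N + j.+1)%N).
  rewrite -LZ -LN -!LD; congr (L _); rewrite chebS !addnS.
  have := orthpolyX (N + i); set X' := 'X; set A := p _.+2; set B := p _.+1; set C := p (N + i)%N.
  move=> e.
  transitivity (cheb k.+1 * (X' * B) * p (N + j).+1 - cheb k * B * p (N + j).+1); first ring.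
  by rewrite e -!mul_polyC; ring.
under eq_fun do rewrite e.
rewrite -[tau _ _ _ + _ - _]addr0; apply: cvgD.
  by apply: cvgB => //; apply: cvgD.
rewrite -(mul0r (tau k.+1 i.+1 j.+1)); apply: cvgM => //.
have := b0; rewrite -(cvg_shiftn i.+1); apply: cvg_trans.
by [].
Qed.

Definition energy_poly N : {poly R} := p N.+1 ^+ 2 - 'X * p N.+1 * p N + p N ^+ 2.

(** The middle term of the energy is rewritten by ['X * cheb k.+1 = cheb k.+2 + cheb k]. The four
    limiting entries then cancel unless [k = 0], which matches [semicircle_cheb]. *)
Lemma energy_moment_limit k :
  L (cheb k.+1 * energy_poly N) @[N --> \oo] --> ((k == 0)%:R : R).
Proof.
have e N : L (cheb k.+1 * energy_poly N) =
  L (cheb k.+1 * p (N + 1)%N * p (N + 1)%N) + L (cheb k.+1 * p (N + 0)%N * p (N + 0)%N)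
  - (L (cheb k.+2 * p (N + 1)%N * p (N + 0)%N) + L (cheb k * p (N + 1)%N * p (N + 0)%N)).
  rewrite -!LD -LN -LD; congr (L _); rewrite addn1 addn0 /energy_poly chebS; ring.
under eq_fun do rewrite e.
have -> : (k == 0)%:R = tau k.+1 1 1 + tau k.+1 0 0 - (tau k.+2 1 0 + tau k 1 0).
  apply/eqP; rewrite eq_sym subr_eq -!natrD; apply/eqP; congr (_%:R).
  by lia.
by apply: cvgB; apply: cvgD; exact: cheb_moment_limit.
Qed.

End orthogonal_polynomials.

Section polynomial_moments.
Context {R : realType}.
Variables (b : nat -> R) (rho : probability (measurableTypeR R) R).
Hypothesis on : orthonormal_system rho (fun n x => (orthpoly b n).[x]).
Local Notation p := (orthpoly b).

Lemma orthpoly_monic n : p n \is monic /\ size (p n) = n.+1.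
Proof.
suff [] : (p n \is monic /\ size (p n) = n.+1) /\
  (p n.+1 \is monic /\ size (p n.+1) = n.+2) by [].
elim: n => [|n [[m1 s1] [m2 s2]]].
  by rewrite /= monic1 size_poly1 monicXsubC size_XsubC.
split => //; rewrite orthpolySS.
have sX : size (('X - (b n.+1)%:P) * p n.+1) = n.+3.
  by rewrite size_monicM ?monicXsubC ?monic_neq0// size_XsubC s2.
have lt : (size (- p n)%R < size (('X - (b n.+1)%:P) * p n.+1)%R)%N.
  by rewrite size_polyN s1 sX.
split; last by rewrite size_polyDl.
by rewrite monicE lead_coefDl// -monicE monicMl// monicXsubC.
Qed.

Lemma poly_integrable q : rho.-integrable setT (EFin \o (fun x => q.[x])).
Proof.
have fin : rho setT \is a fin_num by exact: fin_num_measure.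
move: q; apply: (monic_sequence_ind orthpoly_monic).
- apply: (eq_integrable _ (cst 0%E)) => //; last exact: integrable0.
  by move=> x _ /=; rewrite horner0.
- move=> u v iu iv; have h := integrableD measurableT iu iv.
  by apply: eq_integrable h => // x _ /=; rewrite hornerD EFinD.
- move=> a u iu; have h := integrableZl measurableT a iu.
  by apply: eq_integrable h => // x _ /=; rewrite hornerZ EFinM.
- move=> k; apply/Lfun1_integrable; apply: (Lfun_subset12 fin); exact: (on.1 k).
Qed.

Definition moment (q : {poly R}) : R := \int[rho]_x q.[x].

Lemma momentD u v : moment (u + v) = moment u + moment v.
Proof.
rewrite -RintegralD//; [|exact: poly_integrable..].
by apply: eq_Rintegral => x _; rewrite hornerD.
Qed.

Lemma momentZ (a : R) u : moment (a *: u) = a * moment u.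
Proof.
rewrite -RintegralZl//; [|exact: poly_integrable].
by apply: eq_Rintegral => x _; rewrite hornerZ.
Qed.

Lemma moment_orth m n : moment (p m * p n) = (m == n)%:R.
Proof.
rewrite /moment /Rintegral; have := on.2 m n.
by under eq_integral do rewrite hornerM; move=> ->.
Qed.

(** Each factor ['X] replaces [p i] by at most two neighbours and the multiple [b i] of itself, so
    it costs at most a factor [2 + B]. *)
Lemma moment_bound B : (forall n, `|b n| <= B) ->
  forall k i j, `|moment ('X^k * p i * p j)| <= (2 + B) ^+ k.
Proof.
move=> bB k; elim: k => [|k IH] i j.
  by rewrite expr0 mul1r moment_orth normr_nat; case: eqP; rewrite /= ?lexx ?ler01.
have B0 : 0 <= B by apply: le_trans (bB 0%N); rewrite normr_ge0.
have M0 : 0 <= (2 + B) ^+ k by rewrite exprn_ge0// addr_ge0.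
case: i => [|i].
  have -> : 'X^(k.+1) * p 0%N * p j = 'X^k * p 1%N * p j + b 0%N *: ('X^k * p 0%N * p j).
    by rewrite -mul_polyC exprS /=; ring.
  rewrite momentD momentZ (le_trans (ler_normD _ _))// normrM exprS mulrDl.
  rewrite lerD//; last by rewrite ler_pM.
  by apply: le_trans (IH 1%N j) _; rewrite ler_peMl// ler1n.
have -> : 'X^(k.+1) * p i.+1 * p j =
    'X^k * p i.+2 * p j + b i.+1 *: ('X^k * p i.+1 * p j) + 'X^k * p i * p j.
  rewrite -!mul_polyC; transitivity ('X^k * ('X * p i.+1) * p j); first by rewrite exprS; ring.
  by rewrite orthpolyX -!mul_polyC; ring.
rewrite !momentD momentZ (le_trans (ler_normD _ _))// exprS mulrDl.
rewrite (_ : 2 * _ + _ = (2 + B) ^+ k + B * (2 + B) ^+ k + (2 + B) ^+ k); last by ring.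
rewrite lerD ?IH// (le_trans (ler_normD _ _))// lerD ?IH// normrM ler_pM//.
Qed.

(** Markov's inequality with high even powers: [rho S] times [A^(2k)] is at most [(2 + B)^(2k)] for
    all [k], and [A > 2 + B]. *)
Lemma tail_bound B A : (forall n, `|b n| <= B) -> 2 + B < A ->
  rho (~` (`[- A, A]%classic : set (measurableTypeR R))) = 0%E.
Proof.
move=> bB BA.
have B0 : 0 <= B by apply: le_trans (bB 0%N); rewrite normr_ge0.
have A0 : 0 < A by apply: le_lt_trans BA; rewrite addr_ge0.
set S := ~` _.
have mS : measurable S by apply: measurableC; exact: measurable_itv.
have inS x : S x -> A <= `|x|.
  by rewrite /S/= in_itv/= -ler_norml => /negP; rewrite -ltNge; exact: ltW.
have fS : rho S \is a fin_num by exact: fin_num_measure.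
have key k : fine (rho S) * (A ^+ 2) ^+ k <= ((2 + B) ^+ 2) ^+ k.
  rewrite mulrC -Rintegral_cst// -!exprM.
  apply: (@le_trans _ _ (\int[rho]_(x in S) ('X^(2 * k) : {poly R}).[x])).
    apply: le_Rintegral => //.
    - exact: finite_measure_integrable_cst.
    - by apply: (@integrableS _ _ _ _ setT) => //; exact: poly_integrable.
    - move=> x /inS Ax; rewrite hornerXn exprM [leRHS]exprM -[x ^+ 2]real_normK ?num_real//.
      by rewrite lerXn2r ?nnegrE ?exprn_ge0 ?(ltW A0)// lerXn2r ?nnegrE ?(ltW A0).
  apply: (@le_trans _ _ (moment ('X^(2 * k) * p 0 * p 0))); last first.
    exact: le_trans (ler_norm _) (moment_bound bB _ _ _).
  rewrite /moment /= !mulr1 Rintegral_mkcond; apply: le_Rintegral => //.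
  - rewrite -restrict_EFin; apply/(@integrable_restrict _ _ _ _ S mS setT measurableT) => //.
    by rewrite setTI; apply: (@integrableS _ _ _ _ setT) => //; exact: poly_integrable.
  - exact: poly_integrable.
  - move=> x _; rewrite patchE; case: ifP => // _; by rewrite hornerXn exprM exprn_ge0// sqr_ge0.
suff f0 : fine (rho S) = 0 by have := esym (fineK fS); rewrite f0; exact.
apply/eqP; rewrite eq_le [X in _ && X]fine_ge0 ?measure_ge0// andbT.
set r := ((2 + B) / A) ^+ 2.
have r0 : 0 <= r by rewrite sqr_ge0.
have r1 : r < 1.
  by rewrite /r expr_lt1 ?divr_ge0 ?addr_ge0// ?(ltW A0)// ltr_pdivrMr ?mul1r.
have cr : r ^+ k @[k --> \oo] --> 0 by apply: cvg_expr; rewrite ger0_norm.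
apply: (cvgr_to_ge cr); near=> n.
rewrite /r 2!expr_div_n ler_pdivlMr ?exprn_gt0//; exact: key.
Unshelve. all: by end_near. Qed.

End polynomial_moments.

Lemma sin_natpi (R : realType) n : sin (n%:R * pi : R) = 0.
Proof.
elim: n => [|n IH]; first by rewrite mul0r sin0.
by rewrite -natr1 mulrDl mul1r sinDpi IH oppr0.
Qed.

(** * The semicircle law in the angular variable *)

Section semicircle.
Context {R : realType}.
Local Notation leb := (@lebesgue_measure R).

Lemma integral_derivative (F f : R -> R) a b : a <= b -> continuous f ->
  (forall t : R, is_derive t 1 F (f t)) -> \int[leb]_(t in `[a, b]) f t = F b - F a.
Proof.
move=> ab cf dF.
have cF : continuous F by move=> t; exact/differentiable_continuous/derivable1_diffP/ex_derive.
move: ab; rewrite le_eqVlt => /predU1P[<-|ab]; first by rewrite set_itv1 Rintegral_set1 subrr.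
rewrite /Rintegral (@continuous_FTC2 _ f F)//.
- by apply: continuous_subspaceT.
- split; first by move=> x _; exact: ex_derive.
  + by apply: cvg_at_right_filter; exact: cF.
  + by apply: cvg_at_left_filter; exact: cF.
- by move=> x _; rewrite derive1E; exact: derive_val.
Qed.

(** Density of [t] on [[0, pi]] when [2 * cos t] has the semicircle law; in this variable it is
    smooth up to the endpoints. *)
Definition arc_density (t : R) := 2 / pi * sin t ^+ 2.

Definition arc_cdf (t : R) := (t - sin t * cos t) / pi.

Lemma continuous_arc_density : continuous arc_density.
Proof.
move=> t; apply: cvgM; first exact: cvg_cst.
by apply: cvgM; exact: continuous_sin.
Qed.

Lemma is_derive_arc_cdf (t : R) : is_derive t 1 arc_cdf (arc_density t).
Proof.
have h1 := is_deriveM (is_derive_sin t) (is_derive_cos t).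
have h := is_deriveM (is_deriveB (is_derive_id t 1) h1) (is_derive_cst (pi^-1 : R) t 1).
apply: (is_derive_eq h); rewrite /arc_density /GRing.scale /= !fctE.
rewrite mulr0 add0r.
have -> : 1 - (sin t * - sin t + cos t * cos t) = 2 * sin t ^+ 2.
  by transitivity (1 + sin t ^+ 2 - cos t ^+ 2); [ring|rewrite cos2sin2; ring].
by ring.
Qed.

(* the mean of [f] under the semicircle law, in the variable x = 2 cos t *)
Definition semicircle (f : R -> R) := \int[leb]_(t in `[0, pi]) (f (2 * cos t) * arc_density t).

Lemma continuous_semicircle (f : R -> R) : continuous f -> continuous (fun t => f (2 * cos t) * arc_density t).
Proof.
move=> cf t; apply: cvgM; last exact: continuous_arc_density.
apply: (@continuous_comp _ _ _ (fun t => 2 * cos t) f); last exact: cf.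
by apply: cvgM; [exact: cvg_cst|exact: continuous_cos].
Qed.

Lemma semicircle_integrable (f : R -> R) : continuous f ->
  leb.-integrable `[0, pi] (EFin \o (fun t => f (2 * cos t) * arc_density t)).
Proof.
move=> cf; apply: continuous_compact_integrable; first exact: segment_compact.
by apply: continuous_subspaceT; exact: continuous_semicircle.
Qed.

Lemma semicircleD (f g : R -> R) : continuous f -> continuous g ->
  semicircle (fun x => f x + g x) = semicircle f + semicircle g.
Proof.
move=> cf cg; rewrite /semicircle -RintegralD//; [|exact: semicircle_integrable..].
by apply: eq_Rintegral => t _; rewrite mulrDl.
Qed.

Lemma semicircleZ (a : R) (f : R -> R) : continuous f -> semicircle (fun x => a * f x) = a * semicircle f.
Proof.
move=> cf; rewrite /semicircle -RintegralZl//; [|exact: semicircle_integrable].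
by apply: eq_Rintegral => t _; rewrite mulrA.
Qed.

Lemma arc_density_ge0 t : 0 <= arc_density t.
Proof. by rewrite mulr_ge0 ?sqr_ge0// divr_ge0 ?pi_ge0. Qed.

Lemma le_semicircle (f g : R -> R) : continuous f -> continuous g ->
  (forall x, `|x| <= 2 -> f x <= g x) -> semicircle f <= semicircle g.
Proof.
move=> cf cg fg; apply: le_Rintegral => //; [exact: semicircle_integrable..|].
move=> t _; apply: ler_wpM2r; [exact: arc_density_ge0|apply: fg].
by rewrite normrM ger0_norm// ler_piMr// ler_norml cos_geN1 cos_le1.
Qed.

Lemma integral_arc_density a b : a <= b ->
  \int[leb]_(t in `[a, b]) arc_density t = arc_cdf b - arc_cdf a.
Proof.
by move=> ab; apply: integral_derivative => //; [exact: continuous_arc_density|exact: is_derive_arc_cdf].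
Qed.

(** By [cheb_sin] the integrand is a product of two sines, [(cos (k t) - cos ((k + 2) t)) / pi], and
    only a zero frequency contributes over [[0, pi]]. *)
Lemma semicircle_cheb k : semicircle (horner (cheb k.+1)) = (k == 0)%:R.
Proof.
pose S (j : nat) (t : R) : R := if j is 0 then t else sin (j%:R * t) / j%:R.
have dS j (t : R) : is_derive t 1 (S j) (cos (j%:R * t)).
  case: j => [|j] /=; first by rewrite mul0r cos0; exact: is_derive_id.
  have h1 := is_deriveM (is_derive_cst (j.+1%:R : R) t 1) (is_derive_id t 1).
  have h2 := is_derive1_comp (is_derive_sin (j.+1%:R * t)) h1.
  have h := is_deriveM h2 (is_derive_cst (j.+1%:R^-1 : R) t 1).
  apply: (is_derive_eq h); rewrite /GRing.scale /= !mulr0 add0r addr0 mulr1.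
  by rewrite mulrC mulfK // pnatr_eq0.
have S0 j : S j 0 = 0 by case: j => //= j; rewrite mulr0 sin0 mul0r.
have Sp j : S j pi = (j == 0%N)%:R * pi.
  by case: j => [|j] /=; rewrite ?mul1r// sin_natpi !mul0r.
have -> : semicircle (horner (cheb k.+1)) =
  \int[leb]_(t in `[0, pi]) ((cos (k%:R * t) - cos (k.+2%:R * t)) / pi).
  apply: eq_Rintegral => t _; rewrite /arc_density.
  have e := cheb_sin k.+1 t.
  transitivity (2 / pi * sin (k.+1%:R * t) * sin t); first by rewrite -e; ring.
  set A := k.+1%:R * t.
  have -> : k.+2%:R * t = A + t by rewrite /A -natr1 mulrDl mul1r.
  have -> : k%:R * t = A - t by rewrite /A -natr1 mulrDl mul1r addrK.
  by rewrite cosB cosD; ring.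
have dF (t : R) : is_derive t 1 (fun t => (S k t - S k.+2 t) / pi)
    ((cos (k%:R * t) - cos (k.+2%:R * t)) / pi).
  have h := is_deriveM (is_deriveB (dS k t) (dS k.+2 t)) (is_derive_cst (pi^-1 : R) t 1).
  by apply: (is_derive_eq h); rewrite /GRing.scale /= mulr0 add0r mulrC.
rewrite (integral_derivative _ _ dF) ?pi_ge0//.
  by rewrite !S0 !Sp /= mul0r !subr0 mul0r subr0 mulfK// gt_eqF// pi_gt0.
have cc (a : R) : continuous (fun t => cos (a * t)).
  move=> t; apply: (@continuous_comp _ _ _ (fun t => a * t) (@cos R)); last exact: continuous_cos.
  by apply: cvgM => //; exact: cvg_cst.
by move=> t; apply: cvgM; [apply: cvgB; exact: cc|exact: cvg_cst].
Qed.

End semicircle.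

(** * Weak convergence and the formula for the spectral density *)

Section absolute_value_approximation.
Context {R : realType}.
Implicit Types (f g : R -> R) (A : R).

(** The test functions used later are trapezoids, combinations of four functions [|x - c|], so
    approximating absolute values is enough. *)
Definition poly_approximable A f := forall eps : R, 0 < eps ->
  exists P : {poly R}, forall x, `|x| <= A -> `|f x - P.[x]| <= eps.

Lemma poly_approximableD A f g : poly_approximable A f -> poly_approximable A g ->
  poly_approximable A (fun x => f x + g x).
Proof.
move=> af ag eps e0; have e2 : 0 < eps / 2 by rewrite divr_gt0.
have [P hP] := af _ e2; have [Q hQ] := ag _ e2; exists (P + Q) => x xA.
rewrite hornerD opprD addrACA (splitr eps).
by apply: le_trans (ler_normD _ _) _; apply: lerD; [exact: hP|exact: hQ].
Qed.

Lemma poly_approximableZ A (a : R) f : poly_approximable A f ->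
  poly_approximable A (fun x => a * f x).
Proof.
move=> af eps e0; have a0 : 0 < `|a| + 1 by rewrite ltr_wpDl.
have [P hP] := af _ (divr_gt0 e0 a0); exists (a *: P) => x xA.
rewrite hornerZ -mulrBr normrM (le_trans (ler_wpM2l (normr_ge0 a) (hP x xA)))//.
by rewrite mulrCA ler_piMr ?(ltW e0)// ler_pdivrMr// mul1r lerDl.
Qed.

(* The iteration p |-> p + (x^2 - p^2) / 2 increases to |x| on [-1, 1]. *)
Fixpoint abs_poly (n : nat) : {poly R} :=
  if n is k.+1 then abs_poly k + 2^-1 *: ('X ^+ 2 - abs_poly k ^+ 2) else 0.

Lemma abs_poly_approx n x : `|x| <= 1 ->
  0 <= (abs_poly n).[x] <= `|x| /\ `|x| - (abs_poly n).[x] <= 2 / n.+2%:R.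
Proof.
move=> x1; have x0 := normr_ge0 x.
elim: n => [|n [/andP[p0 px] IH]].
  by rewrite /= horner0 lexx x0 subr0 divff ?pnatr_eq0.
rewrite /= !hornerE; set u := (abs_poly n).[x] in p0 px IH *.
have -> : x ^+ 2 = `|x| ^+ 2 by rewrite real_normK ?num_real.
set y := `|x| in x1 x0 px IH *.
split; first by apply/andP; split; nra.
pose m : R := n.+2%:R.
have m2 : 2 <= m by rewrite ler_nat.
rewrite -(natr1 n.+2) -/m.
have m0 : 0 < m by lra.
(* The new error is [(y - u) * (1 - (y + u) / 2)], and [u >= 0]. Since [d * (1 - d / 2)] increases
   on [[0, 1]], the bound [2 / m] passes to [2 * (m - 1) / m ^+ 2 <= 2 / (m + 1)]. *)
apply: (@le_trans _ _ ((y - u) * (1 - (y - u) / 2))); first by nra.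
apply: (@le_trans _ _ (2 / m * (1 - (2 / m) / 2))).
  have d1 : y - u <= 1 by lra.
  have i1 : 2 / m <= 1 by rewrite ler_pdivrMr ?mul1r.
  rewrite -/m in IH; set i := 2 / m in IH i1 *; nra.
rewrite (_ : _ * _ = 2 * (m - 1) / m ^+ 2); last by field; rewrite gt_eqF.
rewrite ler_pdivrMr ?exprn_gt0// mulrAC ler_pdivlMr; last by lra.
by nra.
Qed.

Lemma poly_approximable_abs A c : 0 < A -> poly_approximable A (fun x => `|x - c|).
Proof.
move=> A0 eps e0; set B := A + `|c|.
have B0 : 0 < B by rewrite ltr_wpDr.
have [n hn] : exists n : nat, 2 * B / n.+2%:R <= eps.
  exists (Num.truncn (2 * B / eps)).
  have := truncnS_gt (2 * B / eps); rewrite ltr_pdivrMr// => h.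
  rewrite ler_pdivrMr//; apply: le_trans (ltW h) _.
  by rewrite mulrC ler_pM2l// ler_nat.
exists (B *: (abs_poly n \Po (B^-1 *: ('X - c%:P)))) => x xA.
rewrite hornerZ horner_comp !hornerE.
set z := B^-1 * (x - c).
have z1 : `|z| <= 1.
  rewrite normrM gtr0_norm ?invr_gt0// mulrC ler_pdivrMr// mul1r.
  by rewrite (le_trans (ler_normB _ _))// lerD2r.
have -> : `|x - c| = B * `|z|.
  by rewrite normrM gtr0_norm ?invr_gt0// mulVKf// gt_eqF.
have [/andP[p0 px] h] := abs_poly_approx n z1.
rewrite -mulrBr ger0_norm; last by rewrite mulr_ge0 ?(ltW B0)// subr_ge0.
by rewrite (le_trans (ler_wpM2l (ltW B0) h))// mulrA [B * 2]mulrC.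
Qed.

End absolute_value_approximation.

Lemma semicircle_dist (R : realType) (f g : R -> R) (eps : R) : continuous f -> continuous g ->
  (forall x, `|x| <= 2 -> `|f x - g x| <= eps) -> `|semicircle f - semicircle g| <= eps.
Proof.
have key (u v : R -> R) : continuous u -> continuous v ->
    (forall x, `|x| <= 2 -> u x <= v x + eps) -> semicircle u <= semicircle v + eps.
  move=> cu cv uv.
  have c1 : continuous (horner (1 : {poly R})) by exact: continuous_horner.
  have ce : continuous (fun x : R => eps * (1 : {poly R}).[x]).
    by move=> x; apply: cvgM; [exact: cvg_cst|exact: c1].
  (* Total mass 1 is the case [k = 0] of [semicircle_cheb], the constant polynomial being
     [cheb 1]. *)
  rewrite (_ : eps = semicircle (fun x : R => eps * (1 : {poly R}).[x])); last first.
    by rewrite semicircleZ// (semicircle_cheb 0) mulr1.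
  rewrite -semicircleD//; apply: le_semicircle => //.
    by move=> x; apply: cvgD; [exact: cv|exact: ce].
  by move=> x x2; rewrite hornerC mulr1; exact: uv.
move=> cf cg fg.
have h1 : semicircle f <= semicircle g + eps.
  by apply: key => // x x2; have := fg x x2; rewrite ler_norml => /andP[_ h]; lra.
have h2 : semicircle g <= semicircle f + eps.
  by apply: key => // x x2; have := fg x x2; rewrite ler_norml => /andP[h _]; lra.
by rewrite ler_norml; apply/andP; split; lra.
Qed.

Section weak_limit.
Context {R : realType}.
Variables (b : nat -> R) (rho : probability (measurableTypeR R) R).
Hypothesis on : orthonormal_system rho (fun n x => (orthpoly b n).[x]).
Hypothesis b0 : b n @[n --> \oo] --> (0 : R).
Variables (B A : R).
Hypothesis bB : forall n, `|b n| <= B.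
Hypothesis BA : 2 + B < A.
Local Notation p := (orthpoly b).
Local Notation E := (energy_poly b).

Lemma moment_limit q : moment rho (q * E N) @[N --> \oo] --> semicircle (horner q).
Proof.
move: q; apply: (monic_sequence_ind cheb_monic).
- have -> : semicircle (horner (0 : {poly R})) = 0.
    rewrite -(mul0r (semicircle (horner (0 : {poly R})))) -semicircleZ; last exact: continuous_horner.
    by congr semicircle; apply/funext => x; rewrite mul0r horner0.
  under eq_fun do rewrite mul0r -(scale0r 0) (momentZ on) mul0r.
  exact: cvg_cst.
- move=> u v hu hv.
  have -> : semicircle (horner (u + v)) = semicircle (horner u) + semicircle (horner v).
    rewrite -semicircleD; [|exact: continuous_horner..].
    by congr semicircle; apply/funext => x; rewrite hornerD.
  by under eq_fun do rewrite mulrDl (momentD on); exact: cvgD.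
- move=> a u hu.
  have -> : semicircle (horner (a *: u)) = a * semicircle (horner u).
    rewrite -semicircleZ; [|exact: continuous_horner].
    by congr semicircle; apply/funext => x; rewrite hornerZ.
  under eq_fun do rewrite -scalerAl (momentZ on).
  by apply: cvgM => //; exact: cvg_cst.
- move=> k; rewrite semicircle_cheb; apply: energy_moment_limit => //.
  + exact: (momentD on).
  + exact: (momentZ on).
  + exact: (moment_orth on).
Qed.

Let D : set (measurableTypeR R) := `[- A, A]%classic.

Let mD : measurable D. Proof. exact: measurable_itv. Qed.

Lemma in_support x : D x = (`|x| <= A).
Proof. by rewrite /D /= in_itv /= ler_norml. Qed.

Lemma Rintegral_support (g : R -> R) : rho.-integrable setT (EFin \o g) ->
  \int[rho]_x g x = \int[rho]_(x in D) g x.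
Proof.
move=> ig; have /integrableP[mg _] := ig.
rewrite -[X in Rintegral _ X](setUv D) Rintegral_setU ?setUv//.
- rewrite [X in _ + X](_ : _ = 0) ?addr0// /Rintegral null_set_integral//.
  + exact: measurableC.
    by apply: (measurable_funS measurableT) => //.
  + exact: (tail_bound on bB BA).
- exact: measurableC.
- by apply/disj_setPCl.
Qed.

Lemma poly_integrable_support q : rho.-integrable D (EFin \o horner q).
Proof. by apply: (@integrableS _ _ _ _ setT) => //; exact: (poly_integrable on). Qed.

(** The energy may be negative outside [[-2, 2]], so it is dominated on the support by
    [(1 + A / 2) * (p N.+1 ^+ 2 + p N ^+ 2)]; by orthonormality the mean of this majorant is [2 + A]
    for every [N]. *)
Lemma moment_energy_bound (eps : R) N (g : R -> R) : 0 <= eps -> measurable_fun setT g ->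
  (forall x, `|x| <= A -> `|g x| <= eps) ->
  rho.-integrable D (EFin \o (fun x => g x * (E N).[x])) /\
  `|\int[rho]_(x in D) (g x * (E N).[x])| <= eps * (2 + A).
Proof.
move=> e0 mg ge.
pose maj := (eps * (1 + A / 2)) *: (p N.+1 * p N.+1 + p N * p N).
have bound x : D x -> `|g x * (E N).[x]| <= maj.[x].
  rewrite in_support => xA; rewrite normrM /maj hornerZ -mulrA.
  apply: ler_pM => //; first exact: ge.
  rewrite /energy_poly !hornerE.
  set u := (p N.+1).[x]; set v := (p N).[x].
  have := xA; rewrite ler_norml => /andP[x1 x2].
  have s1 : 0 <= (A + x) * (u + v) ^+ 2 + (A - x) * (u - v) ^+ 2.
    by rewrite addr_ge0// mulr_ge0 ?sqr_ge0//; lra.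
  have s2 : 0 <= (A - x) * (u + v) ^+ 2 + (A + x) * (u - v) ^+ 2.
    by rewrite addr_ge0// mulr_ge0 ?sqr_ge0//; lra.
  have u0 := sqr_ge0 u; have v0 := sqr_ge0 v.
  by rewrite ler_norml; apply/andP; split; lra.
have ii : rho.-integrable D (EFin \o (fun x => g x * (E N).[x])).
  apply: (le_integrable mD _ _ (poly_integrable_support maj)).
    apply/measurable_realfun.measurable_EFinP; apply: (measurable_funS measurableT) => //.
    apply: measurable_realfun.measurable_funM => //.
    exact: pi_irrational.measurable_poly.
  move=> x Dx; by rewrite /= lee_fin (le_trans (bound x Dx))// ler_norm.
split => //; apply: le_trans (le_normr_Rintegral mD ii) _.
apply: (@le_trans _ _ (\int[rho]_(x in D) maj.[x])).
  apply: le_Rintegral => //; [exact: integrable_norm|exact: poly_integrable_support].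
rewrite -Rintegral_support; last exact: (poly_integrable on).
rewrite -/(moment rho maj) /maj (momentZ on) (momentD on) !(moment_orth on) !eqxx.
rewrite -mulrA ler_wpM2l//. by rewrite mulr1n; lra.
Qed.

(** Polynomials are settled by [moment_limit]; replacing [f] by an approximating polynomial on the
    support costs an error uniform in [N] by [moment_energy_bound]. *)
Lemma weak_limit (f : R -> R) : continuous f -> poly_approximable A f ->
  \int[rho]_(x in D) (f x * (E N).[x]) @[N --> \oo] --> semicircle f.
Proof.
move=> cf af; apply/cvgrPdist_le => eta eta0.
have B0 : 0 <= B by apply: le_trans (bB 0%N); rewrite normr_ge0.
have A2 : 2 < A by apply: le_lt_trans BA; rewrite lerDl.
pose eps := eta / (2 * (3 + A)).
have e0 : 0 < eps by rewrite divr_gt0// mulr_gt0// addr_gt0// (lt_trans _ A2).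
have [P hP] := af _ e0.
have mf : measurable_fun setT f by exact: measurable_realfun.continuous_measurable_fun.
have mfP : measurable_fun setT (fun x => f x - P.[x]).
  by apply: measurable_realfun.measurable_funB => //; exact: pi_irrational.measurable_poly.
have cP : continuous (horner P) by exact: continuous_horner.
have arcP : `|semicircle f - semicircle (horner P)| <= eps.
  apply: semicircle_dist => // x x2; apply: hP; rewrite (le_trans x2)// ltW//.
have /cvgrPdist_le /(_ _ e0) [N0 _ hN0] := @moment_limit P.
exists N0 => // N /= N0N; have := hN0 N N0N => /= h.
have [ii ib] := moment_energy_bound N (ltW e0) mfP hP.
have -> : \int[rho]_(x in D) (f x * (E N).[x]) =
    \int[rho]_(x in D) ((f x - P.[x]) * (E N).[x]) + moment rho (P * E N).
  rewrite /moment Rintegral_support; last exact: (poly_integrable on).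
  rewrite -RintegralD//; last exact: poly_integrable_support.
  by apply: eq_Rintegral => x _; rewrite hornerM; ring.
set I := \int[rho]_(x in D) _ in ib *.
rewrite (_ : _ - _ = (semicircle f - semicircle (horner P)) - I +
  (semicircle (horner P) - moment rho (P * E N))); last by ring.
rewrite (le_trans (ler_normD _ _))// (@le_trans _ _ (eps + eps * (2 + A) + eps))//.
  by rewrite lerD// (le_trans (ler_normB _ _))// lerD.
have -> : eta = eps * (2 * (3 + A)) by rewrite /eps divfK// gt_eqF// mulr_gt0// addr_gt0// (lt_trans _ A2).
by move: e0 A2 => e0 A2; nra.
Qed.

End weak_limit.

Section trapezoid.
Context {R : realType}.
Implicit Types (u v k x : R).

Definition trapezoid u v k x : R :=
  (2 * k)^-1 * ((`|x - (u - k)| + -1 * `|x - u|) + (-1 * `|x - v| + `|x - (v + k)|)).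

Lemma trapezoid_continuous u v k : continuous (trapezoid u v k).
Proof.
have c (a : R) : continuous (fun x => `|x - a|).
  by move=> x; apply: cvg_norm; apply: cvgB => //; exact: cvg_cst.
move=> x; apply: cvgM; first exact: cvg_cst.
apply: cvgD; apply: cvgD => //; try exact: c.
  by apply: cvgM; [exact: cvg_cst|exact: c].
by apply: cvgM; [exact: cvg_cst|exact: c].
Qed.

Lemma trapezoid_approximable A u v k : 0 < A -> poly_approximable A (trapezoid u v k).
Proof.
move=> A0; apply: poly_approximableZ.
apply: poly_approximableD; apply: poly_approximableD; try exact: poly_approximable_abs.
  by apply: poly_approximableZ; exact: poly_approximable_abs.
by apply: poly_approximableZ; exact: poly_approximable_abs.
Qed.

Lemma trapezoid_bounds u v k x : 0 < k -> u <= v -> 0 <= trapezoid u v k x <= 1.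
Proof.
move=> k0 uv; rewrite /trapezoid mulrC.
rewrite ler_pdivrMr ?mulr_gt0// divr_ge0 ?mulr_ge0 ?(ltW k0)//= ?mul1r.
  by have [] := ger0P (x - (u - k)); have [] := ger0P (x - u); have [] := ger0P (x - v);
    have [] := ger0P (x - (v + k)); lra.
by have [] := ger0P (x - (u - k)); have [] := ger0P (x - u); have [] := ger0P (x - v);
    have [] := ger0P (x - (v + k)); lra.
Qed.

Lemma trapezoid1 u v k x : 0 < k -> u <= x <= v -> trapezoid u v k x = 1.
Proof.
move=> k0 /andP[ux xv]; rewrite /trapezoid.
rewrite [`|x - (u - k)|]ger0_norm; last lra.
rewrite [`|x - u|]ger0_norm; last lra.
rewrite [`|x - v|]ler0_norm; last lra.
rewrite [`|x - (v + k)|]ler0_norm; last lra.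
rewrite (_ : _ + _ = 2 * k); last by ring.
by rewrite mulVf// gt_eqF// mulr_gt0.
Qed.

Lemma trapezoid0 u v k x : 0 < k -> u <= v -> (x <= u - k) || (v + k <= x) ->
  trapezoid u v k x = 0.
Proof.
move=> k0 uv /orP[h|h]; rewrite /trapezoid.
  rewrite !ler0_norm; [|lra..].
  by rewrite (_ : _ + _ = 0) ?mulr0//; ring.
rewrite !ger0_norm; [|lra..].
by rewrite (_ : _ + _ = 0) ?mulr0//; ring.
Qed.

End trapezoid.

(** * Distribution functions of the semicircle law and of the spectral measure *)

Section arc_mass.
Context {R : realType}.
Local Notation leb := (@lebesgue_measure R).

(* the distribution function of the semicircle law, up to an additive constant *)
Definition semicircle_cdf (x : R) : R := - arc_cdf (acos (x / 2)).

Lemma half_itv (x : R) : -2 <= x <= 2 -> -1 <= x / 2 <= 1.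
Proof. by move=> /andP[? ?]; apply/andP; split; lra. Qed.

Lemma cos_arc (u v t : R) : -2 <= u <= 2 -> -2 <= v <= 2 -> 0 <= t <= pi ->
  (u <= 2 * cos t <= v) = (acos (v / 2) <= t <= acos (u / 2)).
Proof.
move=> hu hv ht.
have key (y : R) : -2 <= y <= 2 -> acos (y / 2) \in `[0, pi] /\ y = 2 * cos (acos (y / 2)).
  move=> /half_itv hy; split; first by rewrite in_itv/= acos_ge0 ?acos_lepi.
  by rewrite acosK ?in_itv//= mulrC divfK.
have [au eu] := key u hu; have [av ev] := key v hv.
rewrite {1}eu {1}ev !ler_pM2l//.
have tI : t \in `[0, pi] by rewrite in_itv.
rewrite andbC; congr (_ && _).
  by rewrite !leNgt ltr_cos.
by rewrite !leNgt ltr_cos.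
Qed.

Lemma semicircle_mass (u v : R) : -2 <= u -> u <= v -> v <= 2 ->
  \int[leb]_(t in `[acos (v / 2), acos (u / 2)]) arc_density t =
  semicircle_cdf v - semicircle_cdf u.
Proof.
move=> u2 uv v2; rewrite integral_arc_density; first by rewrite /semicircle_cdf opprK addrC.
have hu : -2 <= u <= 2 by rewrite u2 (le_trans uv).
have hv : -2 <= v <= 2 by rewrite v2 (le_trans u2).
have /half_itv hu2 := hu.
have h : 0 <= acos (u / 2) <= pi by rewrite acos_ge0 ?acos_lepi.
have := cos_arc hu hv h; rewrite acosK ?in_itv//= mulrC divfK// lexx uv /= lexx andbT.
by move=> <-.
Qed.

Lemma arc_density_integrable (a c : R) : leb.-integrable `[a, c] (EFin \o arc_density).
Proof.
apply: continuous_compact_integrable; first exact: segment_compact.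
by apply: continuous_subspaceT; exact: continuous_arc_density.
Qed.

Lemma sub_arc (u v : R) : -2 <= u -> u <= v -> v <= 2 ->
  `[acos (v / 2), acos (u / 2)]%classic `<=` `[0, pi]%classic.
Proof.
move=> u2 uv v2 t /=; rewrite !in_itv/= => /andP[h1 h2].
rewrite (le_trans _ h1) ?(le_trans h2)// ?acos_lepi ?acos_ge0//; apply: half_itv; lra.
Qed.

Lemma semicircle_massE (u v : R) : -2 <= u -> u <= v -> v <= 2 ->
  leb.-integrable `[0, pi] (EFin \o (arc_density \_ `[acos (v / 2), acos (u / 2)])) /\
  \int[leb]_(t in `[0, pi]) (arc_density \_ `[acos (v / 2), acos (u / 2)]) t =
  semicircle_cdf v - semicircle_cdf u.
Proof.
move=> u2 uv v2; have sub := sub_arc u2 uv v2; split.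
  rewrite -restrict_EFin.
  apply/(integrable_restrict leb (measurable_itv `[acos (v / 2), acos (u / 2)])
    (measurable_itv `[0, pi]) (EFin \o arc_density)).
  by rewrite setIidr//; exact: arc_density_integrable.
by rewrite -Rintegral_mkcondr setIidr// semicircle_mass.
Qed.

Lemma semicircle_le (f : R -> R) (u v : R) : continuous f -> -2 <= u -> u <= v -> v <= 2 ->
  (forall x, 0 <= f x <= 1) -> (forall x, ~~ (u <= x <= v) -> f x = 0) ->
  semicircle f <= semicircle_cdf v - semicircle_cdf u.
Proof.
move=> cf u2 uv v2 f01 f0.
have [ii <-] := semicircle_massE u2 uv v2.
apply: le_Rintegral => //; first exact: semicircle_integrable.
move=> t; rewrite /= in_itv /= => ht; rewrite patchE.
have hu : -2 <= u <= 2 by rewrite u2 (le_trans uv).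
have hv : -2 <= v <= 2 by rewrite v2 (le_trans u2).
have e := cos_arc hu hv ht.
have -> : (t \in `[acos (v / 2), acos (u / 2)]%classic) = (acos (v / 2) <= t <= acos (u / 2)).
  by rewrite mem_setE in_itv.
rewrite -e; case: ifPn => h.
  by have /andP[_ h1] := f01 (2 * cos t); rewrite ler_piMl// arc_density_ge0.
by rewrite (f0 _ h) mul0r.
Qed.

Lemma semicircle_ge (f : R -> R) (u v : R) : continuous f -> -2 <= u -> u <= v -> v <= 2 ->
  (forall x, 0 <= f x) -> (forall x, u <= x <= v -> f x = 1) ->
  semicircle_cdf v - semicircle_cdf u <= semicircle f.
Proof.
move=> cf u2 uv v2 f0 f1.
have [ii <-] := semicircle_massE u2 uv v2.
apply: le_Rintegral => //; first exact: semicircle_integrable.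
move=> t; rewrite /= in_itv /= => ht; rewrite patchE.
have hu : -2 <= u <= 2 by rewrite u2 (le_trans uv).
have hv : -2 <= v <= 2 by rewrite v2 (le_trans u2).
have e := cos_arc hu hv ht.
have -> : (t \in `[acos (v / 2), acos (u / 2)]%classic) = (acos (v / 2) <= t <= acos (u / 2)).
  by rewrite mem_setE in_itv.
rewrite -e; case: ifPn => h; last by rewrite mulr_ge0 ?arc_density_ge0.
by rewrite (f1 _ h) mul1r.
Qed.

Lemma is_derive_semicircle_cdf (x : R) : -2 < x < 2 ->
  is_derive x 1 semicircle_cdf (Num.sqrt (4 - x ^+ 2) / (2 * pi)).
Proof.
move=> /andP[x1 x2].
have hx : -1 < x / 2 < 1 by apply/andP; split; lra.
have h0 := is_deriveM (is_derive_id x 1) (is_derive_cst (2^-1 : R) x 1).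
have h1 := is_derive1_comp (is_derive1_acos hx :
  is_derive ((id * cst 2^-1 : R -> R) x) 1 _ _) h0.
have h2 := is_derive1_comp (is_derive_arc_cdf (acos (x / 2)) :
  is_derive ((acos \o (id * cst 2^-1 : R -> R)) x) 1 _ _) h1.
have h := is_deriveN h2.
apply: (is_derive_eq h); rewrite /GRing.scale /= mulr0 add0r mulr1.
have hx' : -1 <= x / 2 <= 1 by case/andP: hx => ? ?; rewrite !ltW.
rewrite /arc_density sin_acos//.
have q0 : 0 < 1 - (x / 2) ^+ 2 by case/andP: hx => ? ?; nra.
have -> : 4 - x ^+ 2 = 2 ^+ 2 * (1 - (x / 2) ^+ 2) by field.
rewrite sqrtrM ?sqr_ge0// sqrtr_sqr ger0_norm//.
set s := Num.sqrt _; have s0 : s != 0 by rewrite gt_eqF// sqrtr_gt0.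
have p0 : (pi : R) != 0 by rewrite gt_eqF ?pi_gt0.
by move: (pi : R) p0 => P p0; field; rewrite s0 p0.
Qed.

Lemma continuous_semicircle_cdf (x : R) : -2 < x < 2 -> {for x, continuous semicircle_cdf}.
Proof.
move=> /is_derive_semicircle_cdf h.
exact/differentiable_continuous/derivable1_diffP/ex_derive.
Qed.

End arc_mass.

Section local_density.
Context {R : realType}.
Variables (b : nat -> R) (rho : probability (measurableTypeR R) R).
Hypothesis on : orthonormal_system rho (fun n x => (orthpoly b n).[x]).
Hypothesis b0 : b n @[n --> \oo] --> (0 : R).
Variables (B A : R).
Hypothesis bB : forall n, `|b n| <= B.
Hypothesis BA : 2 + B < A.
Local Notation E := (energy_poly b).

Let D : set (measurableTypeR R) := `[- A, A]%classic.

Let mD : measurable D. Proof. exact: measurable_itv. Qed.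

Let F (x : R) : R := fine (rho [set t : R | t <= x]).

Let A_gt2 : 2 < A.
Proof.
by apply: le_lt_trans BA; rewrite lerDl (le_trans _ (bB 0%N)).
Qed.

Lemma distribution_increment u v : u <= v ->
  F v - F u = fine (rho (`]u, v]%classic : set (measurableTypeR R))).
Proof.
move=> uv; rewrite /F.
pose U : set (measurableTypeR R) := `]-oo, u]%classic.
pose V : set (measurableTypeR R) := `]u, v]%classic.
have mU : measurable U by exact: measurable_itv.
have mV : measurable V by exact: measurable_itv.
have -> : [set t : R | t <= u] = U.
  by apply/seteqP; split => x; rewrite /U /= in_itv.
have -> : [set t : R | t <= v] = U `|` V.
  apply/seteqP; split => x; rewrite /U /V /= !in_itv/=.
    by move=> xv; have [xu|ux] := leP x u; [left|right].
  by case=> [/le_trans -> //|/andP[_ ->]].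
have fU : rho U \is a fin_num by exact: fin_num_measure.
have fV : rho V \is a fin_num by exact: fin_num_measure.
rewrite measureU//; first by rewrite fineD// addrAC subrr add0r.
apply/seteqP; split => x //; rewrite /U /V /= !in_itv/= => -[xu /andP[ux _]].
by move: ux; rewrite ltNge xu.
Qed.

Lemma integral_step (c u v : R) : - A <= u -> u <= v -> v <= A ->
  rho.-integrable D (EFin \o (cst c \_ (`]u, v]%classic : set (measurableTypeR R)))) /\
  \int[rho]_(x in D) (cst c \_ (`]u, v]%classic : set (measurableTypeR R))) x = c * (F v - F u).
Proof.
move=> Au uv vA; pose V : set (measurableTypeR R) := `]u, v]%classic.
have mV : measurable V by exact: measurable_itv.
have VD : V `<=` D.
  move=> x; rewrite /V /D /= !in_itv/= => /andP[ux xv].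
  by rewrite (le_trans Au (ltW ux)) (le_trans xv vA).
split.
  rewrite -restrict_EFin; apply/(integrable_restrict rho mV mD (EFin \o cst c)).
  by rewrite setIidr//; exact: finite_measure_integrable_cst.
by rewrite -Rintegral_mkcondr setIidr// Rintegral_cst// distribution_increment.
Qed.

Lemma trapezoid_energy_integrable u v k N : 0 < k -> u <= v ->
  rho.-integrable D (EFin \o (fun x => trapezoid u v k x * (E N).[x])).
Proof.
move=> k0 uv; have [] // := @moment_energy_bound _ _ _ on _ _ bB BA 1 N (trapezoid u v k) ler01.
- by apply: measurable_realfun.continuous_measurable_fun; exact: trapezoid_continuous.
- by move=> x _; have /andP[t0 t1] := trapezoid_bounds x k0 uv; rewrite ger0_norm.
Qed.

Variables (E0 eps : R) (N0 : nat).
Hypothesis eps0 : 0 <= eps <= E0.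

(** Where the trapezoid does not vanish, [E N] is within [eps] of [E0], so [E0 - eps] times the
    indicator of []u, v]] lies below the trapezoid times [E N]; this is integrated and [N] tends to
    infinity. *)
Lemma increment_le_semicircle u v k : 0 < k -> u <= v -> -2 <= u - k -> v + k <= 2 ->
  (forall x N, u - k <= x <= v + k -> (N0 <= N)%N -> `|(E N).[x] - E0| <= eps) ->
  (E0 - eps) * (F v - F u) <= semicircle (trapezoid u v k).
Proof.
move=> k0 uv ku kv hE.
have A0 : 0 < A by apply: lt_trans A_gt2.
have := weak_limit on b0 bB BA (@trapezoid_continuous R u v k) (trapezoid_approximable u v k A0).
move/cvgr_to_ge; apply; near=> N.
have uA : - A <= u by move: A_gt2 k0 ku; lra.
have vA : v <= A by move: A_gt2 k0 kv; lra.
have [ii <-] := integral_step (E0 - eps) uA uv vA.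
apply: le_Rintegral => //; first exact: trapezoid_energy_integrable.
have N0N : (N0 <= N)%N by near: N; exact: nbhs_infty_ge.
move=> x _; have /andP[t0 t1] := trapezoid_bounds x k0 uv.
have hx : u - k <= x <= v + k -> E0 - eps <= (E N).[x].
  by move=> h; have := hE x N h N0N; rewrite ler_norml => /andP[h1 _]; lra.
rewrite patchE; case: ifPn.
  rewrite mem_setE in_itv/= => /andP[ux xv]; rewrite trapezoid1 ?(ltW ux)// mul1r.
  by apply: hx; lra.
move=> _; have [h|] := boolP ((x <= u - k) || (v + k <= x)).
  by rewrite trapezoid0// mul0r.
rewrite negb_or -!ltNge => /andP[h1 h2]; rewrite mulr_ge0//.
by apply: le_trans (hx _); [case/andP: eps0 => _ h; rewrite subr_ge0|rewrite !ltW].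
Unshelve. all: by end_near. Qed.

Lemma semicircle_le_increment u v k : 0 < k -> u <= v -> -2 <= u - k -> v + k <= 2 ->
  (forall x N, u - k <= x <= v + k -> (N0 <= N)%N -> `|(E N).[x] - E0| <= eps) ->
  semicircle (trapezoid u v k) <= (E0 + eps) * (F (v + k) - F (u - k)).
Proof.
move=> k0 uv ku kv hE.
have A0 : 0 < A by apply: lt_trans A_gt2.
have := weak_limit on b0 bB BA (@trapezoid_continuous R u v k) (trapezoid_approximable u v k A0).
move/cvgr_to_le; apply; near=> N.
have uA : - A <= u - k by move: A_gt2 k0 ku; lra.
have vA : v + k <= A by move: A_gt2 k0 kv; lra.
have uvk : u - k <= v + k by lra.
have [ii <-] := integral_step (E0 + eps) uA uvk vA.
apply: le_Rintegral => //; first exact: trapezoid_energy_integrable.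
have N0N : (N0 <= N)%N by near: N; exact: nbhs_infty_ge.
move=> x _; have /andP[t0 t1] := trapezoid_bounds x k0 uv.
have eE : 0 <= E0 + eps by case/andP: eps0 => h1 h2; rewrite addr_ge0// (le_trans h1).
rewrite patchE; case: ifPn; rewrite mem_setE in_itv/=.
  move=> /andP[ux xv].
  apply: (@le_trans _ _ (trapezoid u v k x * (E0 + eps))); last by rewrite ler_piMl.
  apply: ler_wpM2l => //; have := hE x N _ N0N; rewrite (ltW ux) xv => /(_ isT).
  by rewrite ler_norml => /andP[_ h]; lra.
rewrite negb_and -leNgt -ltNge => h; rewrite trapezoid0 ?mul0r//.
by case/orP: h => h; apply/orP; [left|right; exact: ltW].
Unshelve. all: by end_near. Qed.

End local_density.

Section density_formula.
Context {R : realType}.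
Variables (b : nat -> R) (rho : probability (measurableTypeR R) R).
Hypothesis on : orthonormal_system rho (fun n x => (orthpoly b n).[x]).
Hypothesis b0 : b n @[n --> \oo] --> (0 : R).
Variables (B : R).
Hypothesis bB : forall n, `|b n| <= B.
Variables (la E0 : R).
Hypothesis la_itv : -2 < la < 2.
Hypothesis E0_gt0 : 0 < E0.
Hypothesis energy_limit : forall eps : R, 0 < eps -> exists2 eta, 0 < eta & exists N0, forall x N,
  `|x - la| < eta -> (N0 <= N)%N -> `|(energy_poly b N).[x] - E0| <= eps.
Local Notation G := (@semicircle_cdf R).

Let F (x : R) : R := fine (rho [set t : R | t <= x]).

(** Trapezoids with ramps of width [k] outside, respectively inside, the interval compare the
    increments. In both cases [k] moves only the arguments of the continuous [G], while [F] is taken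
    at [u] and [v], so [k] can tend to 0. *)
Lemma increment_squeeze (eps : R) : 0 < eps -> eps <= E0 -> exists2 eta : R, 0 < eta &
  forall u v, `|u - la| < eta -> `|v - la| < eta -> u <= v ->
  (E0 - eps) * (F v - F u) <= G v - G u <= (E0 + eps) * (F v - F u).
Proof.
move=> e0 eE; have [eta1 eta1_gt0 [N0 hN]] := energy_limit e0.
have /andP[la1 la2] := la_itv.
have [eta [eta_gt0 eta_le1 eta_le2 eta_le3]] : exists eta : R,
    [/\ 0 < eta, eta <= eta1, eta <= 2 - la & eta <= la + 2].
  exists (Num.min eta1 (Num.min (2 - la) (la + 2))).
  rewrite !lt_min eta1_gt0 !ge_min !lexx !orbT; split => //=.
  by apply/andP; split; lra.
have BA : 2 + B < 3 + B by rewrite ltrD2r ltr_nat.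
have eE0 : 0 <= eps <= E0 by rewrite (ltW e0).
exists eta => // u v; rewrite !ltr_distl => /andP[u1 u2] /andP[v1 v2].
rewrite le_eqVlt => /predU1P[<-|uv]; first by rewrite !subrr !mulr0 lexx.
have hE u' v' : la - eta < u' -> v' < la + eta -> forall x N, u' <= x <= v' ->
    (N0 <= N)%N -> `|(energy_poly b N).[x] - E0| <= eps.
  move=> h1 h2 x N /andP[ux xv]; apply: hN; rewrite ltr_distl.
  by clear -ux xv h1 h2 eta_le1; apply/andP; split; lra.
have cG x : la - eta < x < la + eta -> {for x, continuous G}.
  by move=> /andP[H H0]; apply: continuous_semicircle_cdf; apply/andP; split; lra.
have cv (x s : R) : la - eta < x < la + eta -> G (x + s * k) @[k --> 0^'+] --> G x.
  move=> hx; have := cG x hx; rewrite /continuous_at => h.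
  apply: (@cvg_comp _ _ _ (fun k => x + s * k) G _ (nbhs x)) => //.
  apply: cvg_at_right_filter.
  have : x + s * k @[k --> (0 : R)] --> x + s * 0.
    by apply: cvgD; [exact: cvg_cst|apply: cvgM => //; exact: cvg_cst].
  by rewrite mulr0 addr0.
have hu : la - eta < u < la + eta by rewrite u1.
have hv : la - eta < v < la + eta by rewrite v1.
apply/andP; split.
  apply: (cvgr_to_ge (cvgB (cv v 1 hv) (cv u (-1) hu))); near=> k.
  have k0 : 0 < k by [].
  have k1 : k < u - (la - eta) by near: k; apply: nbhs_right_lt; rewrite subr_gt0.
  have k2 : k < la + eta - v by near: k; apply: nbhs_right_lt; rewrite subr_gt0.
  have h1 : -2 <= u - k by lra.
  have h2 : v + k <= 2 by lra.
  have ukv : u - k <= v + k by lra.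
  rewrite /= !fctE mul1r mulN1r.
  apply: (@le_trans _ _ (semicircle (trapezoid u v k))).
    apply: (increment_le_semicircle on b0 bB BA eE0 k0 (ltW uv) h1 h2).
    by apply: hE; lra.
  apply: semicircle_le => //; [exact: trapezoid_continuous| |].
    by move=> x; apply: trapezoid_bounds => //; exact: ltW.
  move=> x; rewrite negb_and -!ltNge => h; apply: trapezoid0 => //; first exact: ltW.
  by case/orP: h => h; apply/orP; [left|right]; exact: ltW.
apply: (cvgr_to_le (cvgB (cv v (-1) hv) (cv u 1 hu))); near=> k.
have k0 : 0 < k by [].
have k1 : k < (v - u) / 2 by near: k; apply: nbhs_right_lt; rewrite divr_gt0// subr_gt0.
rewrite /= !fctE mul1r mulN1r.
have uvk : u + k <= v - k by lra.
have u_ge : -2 <= u + k by lra.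
have v_le : v - k <= 2 by lra.
have u_ge' : -2 <= u by lra.
have v_le' : v <= 2 by lra.
apply: (@le_trans _ _ (semicircle (trapezoid (u + k) (v - k) k))).
  apply: semicircle_ge => //; first exact: trapezoid_continuous.
    by move=> x; have /andP[] := trapezoid_bounds x k0 uvk.
  by move=> x; exact: trapezoid1.
have := @semicircle_le_increment _ _ _ on b0 _ _ bB BA E0 eps N0 eE0 (u + k) (v - k) k k0 uvk.
rewrite addrK subrK; apply => //; exact: hE.
Unshelve. all: by end_near. Qed.

Lemma spectral_density_energy :
  spectral_density rho la = Num.sqrt (4 - la ^+ 2) / (2 * pi) / E0.
Proof.
set g' := Num.sqrt (4 - la ^+ 2) / (2 * pi).
have g'0 : 0 <= g' by rewrite divr_ge0 ?sqrtr_ge0// mulr_ge0 ?pi_ge0.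
have hG : h^-1 * (G (h + la) - G la) @[h --> 0^'] --> g'.
  have dG : is_derive la 1 G g' := is_derive_semicircle_cdf la_itv.
  have h : (fun h => h^-1 *: ((G \o shift la) (h *: 1) - G la)) @ 0^' --> 'D_1 G la.
    exact: (@ex_derive _ _ _ _ _ _ _ dG).
  rewrite -(@derive_val _ _ _ _ _ _ _ dG).
  have -> : (fun h => h^-1 * (G (h + la) - G la)) =
      (fun h => h^-1 *: ((G \o shift la) (h *: 1) - G la)) => //.
  by apply/funext => x; rewrite /= [_ *: 1]mulr1.
rewrite /spectral_density -/F /derive1.
apply: cvg_lim => //; apply/cvgrPdist_le => tol tol0.
(* [M] bounds the difference quotient [d] of [F]: once that of [G] is at most [g' + 1], the lower
   squeeze with [eps <= E0 / 2] gives [d * (E0 / 2) <= g' + 1]. *)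
have [M M0 ME] : exists2 M, 0 < M & M * E0 = 2 * (g' + 1).
  exists (2 * (g' + 1) / E0); last by rewrite divfK// gt_eqF.
  by rewrite divr_gt0// mulr_gt0//; lra.
pose eps := Num.min (E0 / 2) (tol * E0 / (2 * M)).
have eps0 : 0 < eps.
  by rewrite /eps lt_min (divr_gt0 E0_gt0)// divr_gt0// mulr_gt0//.
have eps1 : eps <= E0 / 2 by rewrite /eps ge_min lexx.
have eps2 : eps * M <= tol * E0 / 2.
  have : eps <= tol * E0 / (2 * M) by rewrite /eps ge_min lexx orbT.
  by rewrite ler_pdivlMr ?mulr_gt0// => h; lra.
have epsE : eps <= E0 by rewrite (le_trans eps1)// ler_pdivrMr// ler_pMr// ler1n.
have [eta eta0 heta] := increment_squeeze eps0 epsE.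
have tE : 0 < tol * E0 / 2 by rewrite divr_gt0// mulr_gt0.
near=> h.
have h0 : h != 0 by near: h; exact: nbhs_dnbhs_neq.
have hs : `|h| < eta by near: h; apply: dnbhs0_lt.
have g1 : `|g' - h^-1 * (G (h + la) - G la)| <= 1.
  by near: h; move/cvgrPdist_le: hG; apply.
have g2 : `|g' - h^-1 * (G (h + la) - G la)| <= tol * E0 / 2.
  by near: h; move/cvgrPdist_le: hG; apply.
rewrite /GRing.scale /=.
set d := h^-1 * (F (h + la) - F la); set g := h^-1 * (G (h + la) - G la) in g1 g2 *.
have /andP[d1 d2] : (E0 - eps) * d <= g <= (E0 + eps) * d.
  have ela : `|la - la| < eta by rewrite subrr normr0.
  have ehl : `|h + la - la| < eta by rewrite addrK.
  have [hpos|hneg] := ltP 0 h.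
    have hl : la <= h + la by rewrite lerDr ltW.
    have /andP[i1 i2] := heta _ _ ela ehl hl.
    have hi : 0 <= h^-1 by rewrite invr_ge0 ltW.
    by rewrite /d /g !(mulrCA _ h^-1) !ler_wpM2l.
  have hl : h + la <= la by rewrite gerDr.
  have /andP[i1 i2] := heta _ _ ehl ela hl.
  have hi : 0 <= - h^-1 by rewrite oppr_ge0 invr_le0.
  have j1 := ler_wpM2l hi i1; have j2 := ler_wpM2l hi i2.
  rewrite /d /g; clear -j1 j2; set i := h^-1 in j1 j2 *.
  by apply/andP; split; lra.
have dp : 0 <= d by clear -d1 d2 eps0; nra.
have dM : d <= M.
  rewrite -(ler_pM2r E0_gt0) ME.
  move: g1; rewrite ler_distl => /andP[g3 g4].
  by clear -g3 g4 d1 d2 dp eps1; nra.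
have key : `|g' - E0 * d| <= tol * E0.
  move: g2; rewrite !ler_distl => /andP[g3 g4].
  have ed : eps * d <= tol * E0 / 2 by apply: le_trans eps2; rewrite ler_pM2l.
  by clear -ed g3 g4 d1 d2; apply/andP; split; lra.
rewrite (_ : g' / E0 - d = (g' - E0 * d) / E0); last by field; rewrite gt_eqF.
by rewrite normrM normfV (gtr0_norm E0_gt0) ler_pdivrMr.
Unshelve. all: by end_near. Qed.

End density_formula.

(** * The density at the critical energy *)

(** Four times the form is [(2 - x) (u + v)^2 + (2 + x) (u - v)^2]. *)
Lemma energy_ge0 (R : realDomainType) (x u v : R) : `|x| <= 2 -> 0 <= u ^+ 2 - x * u * v + v ^+ 2.
Proof.
rewrite ler_norml => /andP[x1 x2].
have s1 : 0 <= (2 - x) * (u + v) ^+ 2 by rewrite mulr_ge0 ?sqr_ge0//; lra.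
have s2 : 0 <= (2 + x) * (u - v) ^+ 2 by rewrite mulr_ge0 ?sqr_ge0//; lra.
by rewrite -(@pmulr_rge0 _ 4)//; lra.
Qed.

Lemma l2_scale (R : realType) (z : R[i]) (u v : nat -> R[i]) :
  (forall n, v n = z * u n) -> l2 u -> l2 v.
Proof.
move=> e lu; rewrite /l2 /summable_seq.
rewrite (_ : (fun n => `|normc (v n) ^+ 2|) = (fun n => normc z ^+ 2 * `|normc (u n) ^+ 2|)).
  exact: is_cvg_seriesZ.
by apply/funext => n; rewrite e normcM exprMn normrM ger0_norm ?sqr_ge0.
Qed.

Lemma summable_tail (R : realType) (q : nat -> R) : summable_seq q -> exists Q : nat -> R,
  (forall N n, \sum_(N <= j < n) `|q j.+1| <= Q N) /\
  forall eta : R, 0 < eta -> exists n0, forall n, (n0 <= n)%N -> Q n <= eta.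
Proof.
move=> hq; set S := series (fun n => `|q n|) in hq *.
have nd : nondecreasing_seq S by apply: nondecreasing_series => n _ _; exact: normr_ge0.
exists (fun N => limn S - S N.+1); split.
  move=> N n; have [nN|Nn] := leqP n N.
    by rewrite big_geq// subr_ge0; exact: nondecreasing_cvgn_le.
  rewrite (_ : \sum_(N <= j < n) _ = S n.+1 - S N.+1); last first.
    by rewrite /S sub_series_geq ?ltnS 1?ltnW// big_add1.
  by rewrite lerD2r; exact: nondecreasing_cvgn_le.
move=> eta eta0; have /cvgrPdist_le /(_ _ eta0) [n0 _ h] := hq.
exists n0 => n n0n; have /= := h n.+1 (leq_trans n0n (leqnSn n)).
exact: le_trans (ler_norm _).
Qed.

Lemma orthpoly_solves (R : realType) (b : nat -> R) (la : R) :
  solves (fun n => (orthpoly b n).[la]) b la.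
Proof. by move=> n; rewrite orthpolySS hornerD hornerN hornerM hornerXsubC. Qed.

Lemma orthpoly_consecutive_neq0 (R : realType) (b : nat -> R) (la : R) n :
  ((orthpoly b n).[la] != 0) || ((orthpoly b n.+1).[la] != 0).
Proof.
elim: n => [|n IH]; first by rewrite /= hornerC oner_neq0.
have := orthpoly_solves b la n => /= e; apply/norP => -[].
rewrite !negbK => /eqP h1; rewrite e h1 mulr0 sub0r oppr_eq0 => /eqP h2.
by move: IH; rewrite h1 h2 eqxx.
Qed.

Section resonant_density.
Context {R : realType}.
Variables (z0 kappa : R[i]) (beta : R) (q : nat -> R).
Hypothesis z0_unit : z0 * conjc z0 = 1.
Hypothesis kappa_unit : kappa * conjc kappa = 1.
Hypothesis z0_im : Im z0 != 0.
Hypothesis z0_re : Re z0 != 0.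
Hypothesis beta_gt0 : 0 < beta.
Hypothesis q_l1 : summable_seq q.
Local Notation b := (resonant_potential z0 kappa beta q).
Variable rho : probability (measurableTypeR R) R.
Hypothesis on : orthonormal_system rho (fun n x => (orthpoly b n).[x]).
Local Notation nu := (2 * Re z0).
Hypothesis not_eigenvalue : ~ schroedinger_eigenvalue b nu%:C.
Hypothesis not_half_bound : ~ half_bound_state b nu%:C.

Let y (mu : R) n := (orthpoly b n).[nu + mu].

Lemma resonant_potential_cvg0 : b n @[n --> \oo] --> (0 : R).
Proof.
have hb := resonant_potential_bound q z0_unit kappa_unit beta_gt0.
have q0 : `|q n| @[n --> \oo] --> (0 : R) by exact: cvg_series_cvg_0 q_l1.
apply/norm_cvg0P; apply: (squeeze_cvgr _ (cvg_cst 0)); last first.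
  have -> : (0 : R) = 4 * `|Im z0| * beta * 0 + 0 by rewrite mulr0 addr0.
  by apply: cvgD; [apply: cvgM; [exact: cvg_cst|exact: cvg_harmonic]|exact: q0].
by near=> n; rewrite normr_ge0 /=; exact: hb.
Unshelve. all: by end_near. Qed.

Lemma resonant_potential_bounded : exists B, forall n, `|b n| <= B.
Proof.
have [M [_ h]] := cvg_seq_bounded (cvgP _ resonant_potential_cvg0).
by exists (M + 1) => n; apply: (h (M + 1)) => //; rewrite ltrDl.
Qed.

(** The orthogonal polynomials satisfy the boundary row as well, so a subordinate sequence of them
    is an eigenvector if it lies in [l2] and makes the critical energy a half-bound state
    otherwise. *)
Lemma subordinate_orthpoly_false :
  ~ subordinate b nu%:C (fun n => ((orthpoly b n).[nu])%:C).
Proof.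
set u := (fun n => _) => sub.
have eig : eigen_equation b nu%:C u.
  case => [|n]; last by case: sub.
  rewrite /u /= hornerC mulr1 hornerXsubC -(@realcD R) addrC subrK mulr1//.
have [lu|nlu] := pselect (l2 u); last by apply: not_half_bound; exists u.
apply: not_eigenvalue; exists u; split => //.
  by split => //; apply: (l2_scale eig).
by exists 0%N; rewrite /u /= hornerC oner_neq0.
Qed.

(** By the density formula the quotient is [sqrt (4 - x^2) / (2 pi)], at [x = nu + sg * t], over the
    square of [a (sg * t) * t^beta], which has the positive limit of [amp_power_limit]. *)
Lemma resonant_density_limit (sg : R) : `|sg| = 1 ->
  cvg (spectral_density rho (nu + sg * t) / t `^ (2 * beta) @[t --> 0^'+]).
Proof.
move=> sg1.
have [Q [qQ Q0]] := summable_tail q_l1.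
have [d d0 dist0] := res_dist z0_unit z0_im z0_re.
have ysol mu : solves (y mu) b (nu + mu) by exact: orthpoly_solves.
have y_neq0 mu n : (y mu n != 0) || (y mu n.+1 != 0) by exact: orthpoly_consecutive_neq0.
have y_cont n : continuous (fun mu => y mu n).
  move=> mu; apply: (@continuous_comp _ _ _ (fun mu => nu + mu) (horner (orthpoly b n))).
    by apply: cvgD => //; exact: cvg_cst.
  exact: continuous_horner.
have ysol0 : solves (y 0) b nu by have := ysol 0; rewrite addr0.
have [N1 hN1] := zero_energy_solution z0_unit kappa_unit z0_im beta_gt0 qQ Q0 d0 dist0.
have [K _ hK] := hN1 N1 (y 0) (leqnn N1) ysol0.
(* This is where the assumptions on the critical energy enter. *)
have K_neq0 : K != 0.
  apply/eqP => K0; rewrite K0 in hK; apply: subordinate_orthpoly_false.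
  have y0 : y 0 0%N = 1 by rewrite /y /= hornerC.
  have := subordinate_of_no_growth z0_unit kappa_unit z0_im beta_gt0 qQ Q0 d0 dist0 y0 ysol0 hK.
  by rewrite /y addr0.
have [r r0 [a ha]] := amp_limit z0_unit kappa_unit z0_im z0_re beta_gt0 qQ Q0 ysol y_neq0 y_cont.
have halim mu : 0 < `|mu| < r -> forall eta : R, 0 < eta -> exists n0, forall n, (n0 <= n)%N ->
  `|amp z0 y mu n - a mu| <= eta by move=> h; case: (ha mu h) => _ [].
have [L L0 hL] := amp_power_limit z0_unit kappa_unit z0_im z0_re beta_gt0 qQ Q0 d0 dist0
  ysol y_neq0 y_cont K_neq0 hK r0 sg1 halim.
have nu2 : `|nu| < 2.
  rewrite normrM ger0_norm// -[ltRHS]mulr1 ltr_pM2l//.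
  have e : Re z0 ^+ 2 + Im z0 ^+ 2 = 1 by rewrite -sqr_normcE (normc_unit z0_unit) expr1n.
  have i0 : 0 < Im z0 ^+ 2 by rewrite exprn_even_gt0.
  rewrite -[ltRHS]normr1 -ltr_sqr ?nnegrE ?normr_ge0// !real_normK ?num_real//; lra.
have [B bB] := resonant_potential_bounded.
have dens mu : 0 < `|mu| < r -> `|nu + mu| < 2 ->
    spectral_density rho (nu + mu) = Num.sqrt (4 - (nu + mu) ^+ 2) / (2 * pi) / a mu ^+ 2.
  move=> mur la2; have [a0 [_ hu]] := ha mu mur.
  apply: (spectral_density_energy on resonant_potential_cvg0 bB).
  - by rewrite -ltr_norml.
  - by rewrite exprn_gt0.
  - move=> eps eps0; pose e := Num.min 1 (eps / (2 * a mu + 1)).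
    have s0 : 0 < 2 * a mu + 1 by rewrite addr_gt0// mulr_gt0.
    have e0 : 0 < e by rewrite /e lt_min ltr01 divr_gt0.
    have e1 : e <= 1 by rewrite /e ge_min lexx.
    have e2 : e * (2 * a mu + 1) <= eps by rewrite -ler_pdivlMr// /e ge_min lexx orbT.
    have [t t0 [n0 hn]] := hu e e0.
    exists (Num.min t (2 - `|nu + mu|)); first by rewrite lt_min t0 subr_gt0.
    exists n0 => x n; rewrite lt_min => /andP[xt x2] n0n.
    have xle : `|x| <= 2.
      rewrite (_ : x = (x - (nu + mu)) + (nu + mu)); last by rewrite subrK.
      by rewrite (le_trans (ler_normD _ _))// -lerBrDr ltW.
    have := hn (x - nu) n; rewrite (_ : x - nu - mu = x - (nu + mu)); last by ring.
    move=> /(_ xt n0n).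
    have -> : (energy_poly b n).[x] = amp z0 y (x - nu) n ^+ 2.
      rewrite /amp sqr_sqrtr /energy /y (addrC nu) subrK; last exact: energy_ge0.
      by rewrite /energy_poly !hornerE.
    set A := amp _ _ _ _; move=> hA.
    rewrite subr_sqr normrM.
    have h2 : `|A + a mu| <= 2 * a mu + 1.
      rewrite (_ : A + a mu = (A - a mu) + 2 * a mu); last by ring.
      rewrite (le_trans (ler_normD _ _))// addrC lerD ?(le_trans hA)//.
      by rewrite ger0_norm// mulr_ge0// ltW.
    by apply: le_trans e2; apply: ler_pM.
apply/cvg_ex; exists (Num.sqrt (4 - nu ^+ 2) / (2 * pi) / L ^+ 2).
have cs : Num.sqrt (4 - (nu + sg * t) ^+ 2) / (2 * pi) / (a (sg * t) * t `^ beta) ^+ 2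
    @[t --> (0 : R)^'+] --> Num.sqrt (4 - nu ^+ 2) / (2 * pi) / L ^+ 2.
  apply: cvgM; last by apply: cvgV; [rewrite sqrf_eq0 gt_eqF|apply: cvgM].
  apply: cvgM; last exact: cvg_cst.
  apply: (@continuous_cvg _ _ _ _ _ (fun t => 4 - (nu + sg * t) ^+ 2)); first exact: sqrt_continuous.
  apply: cvg_at_right_filter.
  have : 4 - (nu + sg * t) ^+ 2 @[t --> (0 : R)] --> 4 - (nu + sg * 0) ^+ 2.
    have cl : nu + sg * t @[t --> (0 : R)] --> nu + sg * 0.
      by apply: cvgD; [exact: cvg_cst|apply: cvgM => //; exact: cvg_cst].
    by apply: cvgB; [exact: cvg_cst|apply: cvgM].
  by rewrite mulr0 addr0.
apply: cvg_trans cs; apply: near_eq_cvg; near=> t.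
have t0 : 0 < t by [].
have tr : t < r by near: t; exact: nbhs_right_lt.
have t2 : t < 2 - `|nu| by near: t; apply: nbhs_right_lt; rewrite subr_gt0.
have nt : `|sg * t| = t by rewrite normrM sg1 mul1r gtr0_norm.
have mur : 0 < `|sg * t| < r by rewrite nt t0.
have la2 : `|nu + sg * t| < 2.
  by rewrite (le_lt_trans (ler_normD _ _))// nt -ltrBrDl.
have [a0 _] := ha _ mur.
rewrite dens// exprMn [2 * beta]mulrC powRrM powR_mulrn ?powR_ge0//.
by rewrite [(a _ ^+ 2 * _)^-1]invfM mulrA.
Unshelve. all: by end_near. Qed.

End resonant_density.

(** * Trigonometric form of the potential and conclusion *)

Lemma sin_intpi (R : realType) (m : int) : sin (m%:~R * pi : R) = 0.
Proof.
by case: m => n; rewrite ?NegzE ?mulrNz ?mulNr ?sinN -?pmulrn sin_natpi ?oppr0.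
Qed.

Lemma sin_eq0 (R : realType) (x : R) : sin x = 0 -> exists m : int, x = m%:~R * pi.
Proof.
move=> sx; have p0 : (0 : R) < pi := pi_gt0 R.
pose m := Num.floor (x / pi); exists m.
pose y := x - m%:~R * pi.
have sy : sin y = 0 by rewrite /y sinB sx sin_intpi !(mul0r, mulr0) subrr.
have y0 : 0 <= y by rewrite subr_ge0 -ler_pdivlMr// floor_le_tmp.
have y1 : y < pi.
  have := floorD1_gt (x / pi).
  by rewrite ltr_pdivrMr// intrD mulrDl mul1r /y ltrBlDl.
apply/eqP; rewrite -subr_eq0 -/y; move: y0; rewrite le_eqVlt => /predU1P[<-//|y0].
by have := @sin_gt0_pi R y; rewrite y0 y1 sy ltxx => /(_ isT).
Qed.

Section exponential.
Context {R : realType}.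
Implicit Types s t : R.

Definition cis t : R[i] := (cos t +i* sin t)%C.

Lemma cisD s t : cis (s + t) = cis s * cis t.
Proof.
rewrite /cis cosD sinD; apply/eqP; rewrite eq_complex /= eqxx /=.
by apply/eqP; ring.
Qed.

Lemma cisX t n : cis t ^+ n = cis (n%:R * t).
Proof.
elim: n => [|n IH]; first by rewrite mul0r /cis cos0 sin0.
by rewrite exprSr IH -cisD -natr1 mulrDl mul1r.
Qed.

Lemma cis_unit t : cis t * conjc (cis t) = 1.
Proof.
apply/eqP; rewrite eq_complex /= mulrN opprK -!expr2 cos2Dsin2 eqxx /=.
by rewrite mulrN mulrC addrC subrr.
Qed.

(** [4 * sin w * beta] is [|c|] with the sign of [sin w], so the prefactor of [resonant_potential]
    is [c] when [c * sin w < 0] and [- c] otherwise; in the latter case raising [phi] by [pi / 2]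
    changes the sign of the sine. *)
Lemma resonant_potential_cis c w delta (q : nat -> R) : c != 0 -> sin w != 0 ->
  exists2 phi, 0 < `|c| / (4 * `|sin w|) &
    resonant_potential (cis w) (cis phi) (`|c| / (4 * `|sin w|)) q =
    oscillating_potential c w delta q.
Proof.
move=> c0 w0; have cp : 0 < `|c| by rewrite normr_gt0.
have wp : 0 < `|sin w| by rewrite normr_gt0.
have im phi k : Im ((cis phi * cis w ^+ k.+1) ^+ 2) = sin (2 * phi + 2 * w * k.+1%:R).
  by rewrite cisX -cisD cisX /=; congr sin; ring.
have b0 : 0 < `|c| / (4 * `|sin w|) by rewrite divr_gt0// mulr_gt0.
have [sg|sg] := ltP (c * sin w) 0.
  exists (delta / 2) => //; apply/funext => k; rewrite /resonant_potential /oscillating_potential im.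
  have -> : 2 * (delta / 2) + 2 * w * k.+1%:R = 2 * w * k.+1%:R + delta by field.
  congr (_ * _ / _ + _).
  rewrite /=; move: sg; have [cpos|cneg] := ltP 0 c.
    by rewrite pmulr_rlt0// => sn; rewrite (gtr0_norm cpos) ltr0_norm//; field.
  have {}cneg : c < 0 by rewrite lt_neqAle c0.
  by rewrite nmulr_rlt0// => sn; rewrite (ltr0_norm cneg) gtr0_norm//; field.
have {}sg : 0 < c * sin w by rewrite lt_neqAle eq_sym mulf_neq0.
exists (delta / 2 + pi / 2) => //; apply/funext => k; rewrite /resonant_potential /oscillating_potential im.
have -> : 2 * (delta / 2 + pi / 2) + 2 * w * k.+1%:R = 2 * w * k.+1%:R + delta + pi.
  by move: (pi : R) => P; field.
rewrite sinDpi mulrN -mulNr opprK; congr (_ * _ / _ + _).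
rewrite /=; move: sg; have [cpos|cneg] := ltP 0 c.
  by rewrite pmulr_rgt0// => sn; rewrite (gtr0_norm cpos) gtr0_norm//; field.
have {}cneg : c < 0 by rewrite lt_neqAle c0.
by rewrite nmulr_rgt0// => sn; rewrite (ltr0_norm cneg) ltr0_norm//; field.
Qed.

Lemma oscillating_potentialDpi c w delta (q : nat -> R) :
  oscillating_potential c (w + pi) delta q = oscillating_potential c w delta q.
Proof.
apply/funext => k; rewrite /oscillating_potential; congr (_ * _ / _ + _).
set x := 2 * w * k.+1%:R + delta.
have -> : 2 * (w + pi) * k.+1%:R + delta = x + (pi *+ 2) *+ k.+1.
  by rewrite /x -[_ *+ k.+1]mulr_natr -[pi *+ 2]mulr_natr; move: (pi : R) => P; ring.
by rewrite (periodicn (@sinD2pi R))//.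
Qed.

End exponential.

Theorem theorem5p1 (R : realType) (c omega delta : R) (q : nat -> R)
    (c_neq0 : c != 0)
    (omega_nres : forall m : int, omega <> m%:~R * (pi / 2))
    (q_l1 : summable_seq q)
    (rho : probability (measurableTypeR R) R)
    (rho_spectral :
      spectral_measure (oscillating_potential c omega delta q) rho)
    (nu : R) (nu_cr : nu = - (2 * cos omega) \/ nu = 2 * cos omega)
    (nu_not_eigenvalue :
      ~ schroedinger_eigenvalue (oscillating_potential c omega delta q) nu%:C)
    (nu_not_half_bound :
      ~ half_bound_state (oscillating_potential c omega delta q) nu%:C) :
  cvg (spectral_density rho x / `|x - nu| `^ (`|c| / (2 * `|sin omega|))
         @[x --> nu^'+]) /\
  cvg (spectral_density rho x / `|x - nu| `^ (`|c| / (2 * `|sin omega|))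
         @[x --> nu^'-]).
Proof.
have sc : sin omega != 0 /\ cos omega != 0.
  apply/andP; rewrite -negb_or -mulf_eq0; apply/eqP => sc0.
  have [|m hm] := @sin_eq0 R (omega + omega); first by rewrite sinD [cos _ * _]mulrC sc0 addr0.
  by apply: (omega_nres m); rewrite mulrA -hm; field.
(* Passing from [omega] to [omega + pi] keeps the potential and [|sin omega|] and changes the sign
   of [cos omega], hence exchanges the two critical points. *)
wlog nuE : omega omega_nres rho_spectral nu_cr nu_not_eigenvalue nu_not_half_bound sc / nu = 2 * cos omega.
  move=> wl; case: (nu_cr) => nuE; last exact: wl.
  have := wl (omega + pi); rewrite sinDpi cosDpi normrN oscillating_potentialDpi.
  apply => //.
  - move=> m hm; apply: (omega_nres (m - 2)); rewrite intrB mulrBl -hm.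
    by move: (pi : R) => P; field.
  - by rewrite nuE mulrN; right.
  - by case: sc => ? ?; rewrite !oppr_eq0.
  - by rewrite nuE mulrN.
have [s0 co0] := sc.
have [phi beta0 bE] := resonant_potential_cis delta q c_neq0 s0.
set beta := `|c| / (4 * `|sin omega|) in beta0 bE.
rewrite -bE in rho_spectral nu_not_eigenvalue nu_not_half_bound.
have betaE : `|c| / (2 * `|sin omega|) = 2 * beta.
  by rewrite /beta; field; rewrite normr_eq0.
have key sg : `|sg| = 1 ->
    cvg (spectral_density rho (nu + sg * t) / t `^ (2 * beta) @[t --> 0^'+]).
  move=> sg1; rewrite nuE in nu_not_eigenvalue nu_not_half_bound *.
  exact: (resonant_density_limit (cis_unit omega) (cis_unit phi) s0 co0 beta0 q_l1
    (proj1 rho_spectral) nu_not_eigenvalue nu_not_half_bound sg1).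
rewrite betaE; split.
  have /cvg_ex[l hl] := key 1 (normr1 _); apply/cvg_ex; exists l => A /hl h.
  apply/(nbhs_right0P nu); near=> e.
  have : A (spectral_density rho (nu + 1 * e) / e `^ (2 * beta)) by near: e; exact: h.
  by rewrite /= mul1r addrAC subrr add0r gtr0_norm.
have /cvg_ex[l hl] := key (-1) (normrN1 _); apply/cvg_ex; exists l => A /hl h.
apply/(nbhs_left0P nu); near=> e.
have : A (spectral_density rho (nu + -1 * e) / e `^ (2 * beta)) by near: e; exact: h.
by rewrite /= mulN1r addrAC subrr add0r normrN gtr0_norm.
Unshelve. all: by end_near. Qed.
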